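(* There exists a constant $C>0$ (independent of $a$) such that for every $B\in\mathbb{R}$ with $|B|\le C$ and every $a>0$, $$\lambda_1^B(\Omega_{a,a^{-1}})\ \ge\ \lambda_1^B(\Omega_{1,1}).$$
   Context: For $a,b>0$ let $\Omega_{a,b}:=\left(-\frac a2,\frac a2\right)\times\left(-\frac b2,\frac b2\right)\subset\mathbb{R}^2$. For a bounded open set $\Omega\subset\mathbb{R}^2$ and $B\in\mathbb{R}$, $\lambda_1^B(\Omega)$ denotes the lowest eigenvalue of the magnetic Dirichlet Laplacian with constant field $B$, i.e. of the problem $(-i\nabla-A)^2u=\lambda u$ in $\Omega$, $u=0$ on $\partial\Omega$, where $A:\overline{\Omega}\to\mathbb{R}^2$ is any smooth vector potential with $\operatorname{curl}A=\partial_1A_2-\partial_2A_1=B$. For rectangles the problem is understood as the spectral problem for the self-adjoint operator in $L^2(\Omega)$ (complex-valued functions) associated with the quadratic form $u\mapsto\|(\partial_1-iA_1)u\|_{L^2(\Omega)}^2+\|(\partial_2-iA_2)u\|_{L^2(\Omega)}^2$ with domain $W_0^{1,2}(\Omega)$; its spectrum does not depend on the choice of $A$ with $\operatorname{curl}A=B$. One may take $A(x)=\big(-\theta x_2,(1-\theta)x_1\big)B$ for any $\theta\in\mathbb{R}$. *)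

(* Defs.v *)
From HB Require Import structures.
From mathcomp Require Import all_boot all_order all_algebra.
From mathcomp Require Import complex.
From mathcomp Require Import all_classical all_reals all_analysis.

Set Implicit Arguments.
Unset Strict Implicit.
Unset Printing Implicit Defensive.

Import Order.TTheory GRing.Theory Num.Theory.
Import numFieldNormedType.Exports.

Local Open Scope classical_set_scope.
Local Open Scope ring_scope.
Local Open Scope complex_scope.

Section MagneticLaplacian.
Variable R : realType.
Implicit Types (Om : set (R * R)) (u v f g phi : R * R -> R[i]).

Definition rect (a b : R) : set (R * R) :=
  [set x | - (a / 2) < x.1 < a / 2 /\ - (b / 2) < x.2 < b / 2].

Definition leb2 := (@lebesgue_measure R \x @lebesgue_measure R)%E.

Definition e1 : R * R := (1, 0).
Definition e2 : R * R := (0, 1).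

Fixpoint Ck (k : nat) (h : R * R -> R) : Prop :=
  match k with
  | 0 => continuous h
  | k'.+1 => [/\ continuous h,
       forall x, derivable h x e1, forall x, derivable h x e2,
       Ck k' (fun x => 'D_e1 h x) & Ck k' (fun x => 'D_e2 h x)]
  end.

Definition smooth (h : R * R -> R) : Prop := forall k, Ck k h.

Definition pderivC (e : R * R) phi : R * R -> R[i] :=
  fun x => 'D_e (fun y => complex.Re (phi y)) x +i* 'D_e (fun y => complex.Im (phi y)) x.

Definition test_function Om phi : Prop :=
  [/\ smooth (fun x => complex.Re (phi x)), smooth (fun x => complex.Im (phi x)),
      compact (closure [set x | phi x <> 0]) &
      closure [set x | phi x <> 0] `<=` Om].

Definition integralC Om f : R[i] :=
  Rintegral leb2 Om (fun x => complex.Re (f x)) +i*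
  Rintegral leb2 Om (fun x => complex.Im (f x)).

Definition normL2sq Om f : \bar R :=
  (\int[leb2]_(x in Om) (complex.Re (f x) ^+ 2 + complex.Im (f x) ^+ 2)%:E)%E.

Definition L2 Om f : Prop :=
  [/\ measurable_fun Om (fun x => complex.Re (f x)),
      measurable_fun Om (fun x => complex.Im (f x)) &
      (normL2sq Om f < +oo)%E].

Definition innerL2 Om f g : R[i] := integralC Om (fun x => f x * conjc (g x)).

Definition weak_pderiv Om (e : R * R) u g : Prop :=
  forall phi, test_function Om phi ->
    integralC Om (fun x => u x * pderivC e phi x) =
    - integralC Om (fun x => g x * phi x).

(* u is in W^{1,2}(Om) with weak gradient (g1, g2). Weak gradients, being
   determined only almost everywhere, are carried along as arguments. *)
Definition W12 Om u g1 g2 : Prop :=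
  [/\ L2 Om u, L2 Om g1, L2 Om g2,
      weak_pderiv Om e1 u g1 & weak_pderiv Om e2 u g2].

(* W_0^{1,2}(Om): the closure of the test functions in W^{1,2}(Om). *)
Definition W12_0 Om u g1 g2 : Prop :=
  W12 Om u g1 g2 /\
  exists2 phi : nat -> R * R -> R[i],
    forall n, test_function Om (phi n) &
    (normL2sq Om (fun x => phi n x - u x)%R +
     normL2sq Om (fun x => pderivC e1 (phi n) x - g1 x)%R +
     normL2sq Om (fun x => pderivC e2 (phi n) x - g2 x)%R)%E
      @[n --> \oo] --> 0%E.

(* Smoothness of A up to the boundary is expressed by taking A to be the
   restriction of a smooth field on the plane; only its values on the closure
   of Om matter, and curl A = B is required on Om only. *)
Definition magnetic_potential (B : R) Om (A : R * R -> R * R) : Prop :=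
  [/\ smooth (fun x => (A x).1), smooth (fun x => (A x).2) &
      forall x, Om x ->
        'D_e1 (fun y => (A y).2) x - 'D_e2 (fun y => (A y).1) x = B].

(* (d_j - i A_j) u, where g stands for the weak derivative d_j u. *)
Definition mderiv (Aj : R * R -> R) u g : R * R -> R[i] :=
  fun x => g x - (0 +i* Aj x) * u x.

(* The sesquilinear form (linear in u) whose quadratic form is
   ||(d_1 - i A_1) u||^2 + ||(d_2 - i A_2) u||^2. *)
Definition magnetic_form Om (A : R * R -> R * R) u g1 g2 v h1 h2 : R[i] :=
  innerL2 Om (mderiv (fun x => (A x).1) u g1) (mderiv (fun x => (A x).1) v h1) +
  innerL2 Om (mderiv (fun x => (A x).2) u g2) (mderiv (fun x => (A x).2) v h2).

(* Graph of the self-adjoint operator T in L^2(Om) associated with the closed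
   form above on W_0^{1,2}(Om): u is in the domain of T and T u = f. *)
Definition magnetic_laplacian Om A u f : Prop :=
  L2 Om f /\
  exists g1 g2, W12_0 Om u g1 g2 /\
    forall v h1 h2, W12_0 Om v h1 h2 ->
      magnetic_form Om A u g1 g2 v h1 h2 = innerL2 Om f v.

Definition eigenvalue Om A (l : R) : Prop :=
  exists u, ~ {ae leb2, forall x, Om x -> u x = 0} /\
    magnetic_laplacian Om A u (fun x => l%:C * u x).

Definition lowest_eigenvalue Om A (l : R) : Prop :=
  eigenvalue Om A l /\ forall l', eigenvalue Om A l' -> l <= l'.

(* For a nonempty bounded open set Om a lowest eigenvalue exists and is unique; the default value 0
   of xget is then irrelevant. *)
Definition lambda1 Om A : R := xget 0 [set l | lowest_eigenvalue Om A l].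

End MagneticLaplacian.

(* Main.v *)
Require Import Defs.
From mathcomp Require Import all_boot all_order all_algebra.
From mathcomp Require Import complex.
From mathcomp Require Import all_classical all_reals all_analysis measurable_realfun.
From mathcomp Require Import ring lra.
Import Order.TTheory GRing.Theory Num.Theory.
Import numFieldNormedType.Exports.

Set Implicit Arguments.
Unset Strict Implicit.
Unset Printing Implicit Defensive.

Local Open Scope classical_set_scope.
Local Open Scope ring_scope.

(** Among the rectangles of area one the square has the least ground state energy.

    A dilation and a gauge transformation carry the rectangle of sides [a] and
    [a^-1] to the unit square with one linear potential that does not depend on
    [a] ([square_transfer]). With [t = a^2], [N(u)] the square norm of [u] and
    [P_j(u)] that of its [j]-th covariant derivative, the ground state energy of
    the rectangle is the infimum of [(t^-1 P_1 + t P_2) / N]. The arithmetic mean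
    dominates the geometric one, so that for all [t] this is at least the ground
    state energy [lam] of the square as soon as [4 P_1 P_2 >= lam^2 N^2]
    ([energy_product_ge], [dilated_energy_ge]).

    Without field the product bound is the inequality [P_j >= pi^2 N], which
    persists in a magnetic field ([pi2_le_D1]). With a field [lam = 2 pi^2 + mu] where
    [mu >= 0]. Let [p_j = P_j - pi^2 N >= 0] and, for [N(u) = 1], let
    [delta = p_1 + p_2 - mu] be the excess energy. As
    [4 P_1 P_2 = (P_1 + P_2)^2 - (P_1 - P_2)^2], the imbalance [P_1 - P_2] has to
    be small compared with the square root of [delta]. The quarter turn of the square
    preserves [N] and exchanges [P_1] and [P_2]. An almost minimizer of [p_1 + p_2]
    is almost unique, hence almost invariant under the turn, hence almost balanced.
    For a general [u], split off its component along an almost minimizer: the cross terms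
    are bounded by the Cauchy-Schwarz inequality for [p_1] and [p_2], which gives
    a multiple of [sqrt (mu delta)] ([imbalance_le]). Here [mu] is small with the
    field: a trial function bounds it by a multiple of [B^2] ([near_minimizer]).

    The uniqueness is quantitative: up to a multiple of [p_1 + p_2], the norm of [u]
    is controlled by its amplitude along the field-free ground state
    [cos (pi x_1) cos (pi x_2)] ([gap_magnetic]). This comes from the identity that
    turns [|f'|^2 - pi^2 |f|^2] into the square of [f' + pi tan (pi x) f]: along a
    segment the excess energy controls the variation of [f / cos (pi x)]
    ([two_point]), and two segments join any two points of the square ([gap_real]).

    The same gap yields the lowest eigenvalue of each rectangle. A minimizing
    sequence whose amplitude is kept equal to 1 is a Cauchy sequence in the form norm
    ([minimizing_sequence], [minimizing_cauchy]); its limit solves the eigenvalue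
    equation, and the eigenvalue is the infimum of the energy ([ground_state],
    [ground_energy]). *)

(** * Integration of continuous functions over segments and rectangles *)

Section plane_integration.
Variable R : realType.
Implicit Types (h : R * R -> R) (a b : R).

Local Notation mu := (@lebesgue_measure R).

(** The measurable sets of the plane are those of the product of two lines: an
    open set is a countable union of squares with rational centers and radii. *)
Lemma open_plane_measurable (O : set (R * R)) : open O -> measurable O.
Proof.
move=> oO.
pose F (q : (rat * rat) * rat) : set (R * R) :=
  if `[< 0 < (ratr q.2 : R) /\ ball (ratr q.1.1 : R, ratr q.1.2 : R) (ratr q.2) `<=` O >]
  then ball (ratr q.1.1 : R) (ratr q.2) `*` ball (ratr q.1.2 : R) (ratr q.2)
  else set0.
have -> : O = \bigcup_q F q.
  apply/seteqP; split => [[x y] Oxy | [x y] [[[q1 q2] r] _]]; last first.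
    rewrite /F; case: ifP => // /asboolP[/= r0 sub] [bx by_].
    by apply: sub; split.
  have /nbhs_ballP[e /= e0 sub] : nbhs (x, y) O by exact: open_nbhs_nbhs.
  have e4 : (0 : R) < e / 4 by rewrite divr_gt0.
  have [q1 q1P] : exists q, ratr q \in `](x - e / 4), (x + e / 4)[.
    by apply: rat_in_itvoo; lra.
  have [q2 q2P] : exists q, ratr q \in `](y - e / 4), (y + e / 4)[.
    by apply: rat_in_itvoo; lra.
  have [r rP] : exists q, ratr q \in `](e / 4), (e / 2)[.
    by apply: rat_in_itvoo; lra.
  move: q1P q2P rP; rewrite !in_itv /= => /andP[a1 a2] /andP[b1 b2] /andP[c1 c2].
  exists ((q1, q2), r) => //; rewrite /F /=.
  have -> : `[< 0 < (ratr r : R) /\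
      ball (ratr q1 : R, ratr q2 : R) (ratr r) `<=` O >] = true.
    apply/asboolP; split; first by lra.
    move=> [u v] [/= bu bv]; apply: sub; split => /=.
      move: bu; rewrite /ball /= !ltr_norml => /andP[]; lra.
    move: bv; rewrite /ball /= !ltr_norml => /andP[]; lra.
  by split; rewrite /= /ball /= ltr_norml; apply/andP; split; lra.
apply: countable_bigcupT_measurable; first exact: countableP.
move=> q; rewrite /F; case: ifP => // _.
by apply: measurableX; rewrite ball_itv; exact: measurable_itv.
Qed.

Lemma continuous_plane_measurable h :
  continuous h -> measurable_fun [set: R * R] h.
Proof.
move=> /continuousP ch; apply: (measurability _ (measurable_realfun.RGenOpens.measurableE R)).
move=> _ [_ [x [y ->] <-]]; rewrite setTI; apply: open_plane_measurable.
exact/ch/interval_open.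
Qed.

Lemma rectE a b :
  rect a b = `](- (a / 2)), (a / 2)[%classic `*` `](- (b / 2)), (b / 2)[%classic.
Proof. by apply/seteqP; split => -[x y] /=; rewrite !in_itv. Qed.

Lemma measurable_rect a b : measurable (rect a b).
Proof. by rewrite rectE; apply: measurableX. Qed.

Lemma leb2_rect_lty a b : (@leb2 R (rect a b) < +oo)%E.
Proof.
rewrite rectE /leb2 product_measure1E //; apply: lte_mul_pinfty => //.
  have /= := @lebesgue_measure_itv R `](- (a / 2)), (a / 2)[.
  by move=> ->; case: ifP => //= _; rewrite -EFinD ltry.
have /= := @lebesgue_measure_itv R `](- (b / 2)), (b / 2)[.
by move=> ->; case: ifP => //= _; rewrite -EFinD ltry.
Qed.

Lemma continuous_rect_bounded a b h : continuous h ->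
  exists M, forall x, `[(- (a / 2)), (a / 2)]%classic x.1 ->
    `[(- (b / 2)), (b / 2)]%classic x.2 -> `|h x| <= M.
Proof.
move=> ch.
have /compact_bounded : compact
    (h @` (`[(- (a / 2)), (a / 2)]%classic `*` `[(- (b / 2)), (b / 2)]%classic)).
  apply: continuous_compact; first exact: continuous_subspaceT.
  by apply: compact_setX; exact: segment_compact.
move=> [M [_ HM]]; exists (M + 1) => x x1 x2.
by apply: HM; [rewrite ltrDl | exists x].
Qed.

Lemma continuous_rect_integrable a b h : continuous h ->
  (@leb2 R).-integrable (rect a b) (EFin \o h).
Proof.
move=> ch; apply: measurable_bounded_integrable.
- exact: measurable_rect.
- exact: leb2_rect_lty.
- by apply: measurable_funTS; exact: continuous_plane_measurable.
have [M HM] := continuous_rect_bounded a b ch.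
exists M; split; first exact: num_real.
move=> N MN x [/andP[x1 x2] /andP[y1 y2]].
apply: le_trans (ltW MN); apply: HM; rewrite /= in_itv /=; apply/andP; split; exact: ltW.
Qed.

End plane_integration.

Section segment_integration.
Variable R : realType.
Implicit Types (f g : R -> R) (u v : R).
Local Notation mu := (@lebesgue_measure R).

Definition int1 u v f : R := \int[mu]_(x in `[u, v]) f x.

Lemma within_in u v f : {in `[u, v], continuous f} -> {within `[u, v], continuous f}.
Proof. by move=> cf; apply: continuous_in_subspaceT => x /set_mem /cf. Qed.

Lemma int1_integrable u v f : {in `[u, v], continuous f} ->
  mu.-integrable `[u, v] (EFin \o f).
Proof.
move=> cf; apply: continuous_compact_integrable; first exact: segment_compact.
exact: within_in.
Qed.

Lemma int1_ge0 u v f : (forall x, u <= x <= v -> 0 <= f x) -> 0 <= int1 u v f.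
Proof. by move=> f0; apply: Rintegral_ge0 => x /=; rewrite in_itv; exact: f0. Qed.

Lemma eq_int1 u v f g : (forall x, u <= x <= v -> f x = g x) -> int1 u v f = int1 u v g.
Proof.
by move=> fg; apply: eq_Rintegral => x /set_mem /=; rewrite in_itv; exact: fg.
Qed.

Lemma int1_le u v f g : {in `[u, v], continuous f} -> {in `[u, v], continuous g} ->
  (forall x, u <= x <= v -> f x <= g x) -> int1 u v f <= int1 u v g.
Proof.
by move=> cf cg fg; apply: le_Rintegral => //; exact: int1_integrable.
Qed.

Lemma int1D u v f g : {in `[u, v], continuous f} -> {in `[u, v], continuous g} ->
  int1 u v (fun x => f x + g x) = int1 u v f + int1 u v g.
Proof. by move=> cf cg; apply: RintegralD => //; exact: int1_integrable. Qed.

Lemma int1B u v f g : {in `[u, v], continuous f} -> {in `[u, v], continuous g} ->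
  int1 u v (fun x => f x - g x) = int1 u v f - int1 u v g.
Proof. by move=> cf cg; apply: RintegralB => //; exact: int1_integrable. Qed.

Lemma int1Z u v f c : {in `[u, v], continuous f} ->
  int1 u v (fun x => c * f x) = c * int1 u v f.
Proof. by move=> cf; apply: RintegralZl => //; exact: int1_integrable. Qed.

Lemma int1_cst u v c : u <= v -> int1 u v (fun=> c) = c * (v - u).
Proof.
move=> uv; rewrite /int1 Rintegral_cst //.
have /= -> := @lebesgue_measure_itv R `[u, v].
rewrite lte_fin; case: ltP => //= vu.
by have -> : v = u; [apply/eqP; rewrite eq_le uv vu | rewrite subrr].
Qed.

Lemma int1_FTC u v f F : u <= v -> {in `[u, v], continuous f} ->
  (forall x, u <= x <= v -> is_derive x 1 F (f x)) -> int1 u v f = F v - F u.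
Proof.
rewrite le_eqVlt => /predU1P[->|uv] cf dF.
  by rewrite /int1 set_itv1 Rintegral_set1 subrr.
have cF x : u <= x <= v -> {for x, continuous F}.
  by move=> /dF [dFx _]; apply/differentiable_continuous/derivable1_diffP.
rewrite /int1 /Rintegral (@continuous_FTC2 _ _ F) //; first exact: within_in.
- split.
  + by move=> x; rewrite in_itv /= => /andP[ux xv]; have [] : is_derive x 1 F (f x) by apply: dF; rewrite !ltW.
  + by apply: cvg_at_right_filter; apply: cF; rewrite lexx ltW.
  + by apply: cvg_at_left_filter; apply: cF; rewrite lexx ltW.
- move=> x; rewrite in_itv /= => /andP[ux xv].
  by rewrite derive1E; have [] : is_derive x 1 F (f x) by apply: dF; rewrite !ltW.
Qed.

Lemma int1_split u v w f : u <= w <= v -> {in `[u, v], continuous f} ->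
  int1 u v f = int1 u w f + int1 w v f.
Proof.
move=> /andP[uw wv] cf; rewrite /int1.
have := @Rintegral_itvB _ f (BLeft u) (BRight v) w (int1_integrable cf).
rewrite !bnd_simp => /(_ uw wv) E.
rewrite -[X in _ + X]Rintegral_itv_obnd_cbnd; first by rewrite -E addrC subrK.
apply: integrableS (int1_integrable cf) => //.
by apply: subset_itvr; rewrite bnd_simp.
Qed.

Lemma int1_sub u v x y f : u <= x -> x <= y -> y <= v -> {in `[u, v], continuous f} ->
  (forall z, u <= z <= v -> 0 <= f z) -> int1 x y f <= int1 u v f.
Proof.
move=> ux xy yv cf f0.
rewrite (@int1_split u v x) ?ux ?(le_trans xy) //.
have cf' : {in `[x, v], continuous f}.
  move=> z; rewrite in_itv /= => /andP[xz zv]; apply: cf.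
  by rewrite in_itv /= (le_trans ux xz).
rewrite (@int1_split x v y) ?xy //.
rewrite addrCA lerDl addr_ge0 //; apply: int1_ge0 => z /andP[a b]; apply: f0.
  by rewrite a (le_trans b) // (le_trans xy).
by rewrite b andbT (le_trans ux) // (le_trans xy).
Qed.

Lemma cont_in u v f : continuous f -> {in `[u, v], continuous f}.
Proof. by move=> cf x _; exact: cf. Qed.

End segment_integration.

Section fubini.
Variable R : realType.
Implicit Types (h : R * R -> R) (a b u v : R).
Local Notation mu := (@lebesgue_measure R).

Lemma slice1_continuous h y : continuous h -> continuous (fun x => h (x, y)).
Proof.
move=> ch x; apply: (@continuous_comp _ _ _ (fun x => (x, y)) h); last exact: ch.
have : (x', y) @[x' --> x] --> (x, y); last by [].
by apply: (@cvg_pair _ _ _ (nbhs x) (nbhs x) (nbhs y)); [exact: cvg_id | exact: cvg_cst].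
Qed.

Lemma slice2_continuous h x : continuous h -> continuous (fun y => h (x, y)).
Proof.
move=> ch y; apply: (@continuous_comp _ _ _ (fun y => (x, y)) h); last exact: ch.
have : (x, y') @[y' --> y] --> (x, y); last by [].
by apply: (@cvg_pair _ _ _ (nbhs y) (nbhs x) (nbhs y)); [exact: cvg_cst | exact: cvg_id].
Qed.

Lemma swap_arg_continuous h : continuous h -> continuous (fun x => h (x.2, x.1)).
Proof.
move=> ch x; apply: (@continuous_comp _ _ _ (fun x => (x.2, x.1)) h); last exact: ch.
by exact: swap_continuous.
Qed.

Lemma box_bounded u v u' v' h : continuous h ->
  exists M, forall x y, u <= x <= v -> u' <= y <= v' -> `|h (x, y)| <= M.
Proof.
move=> ch.
have /compact_bounded : compact (h @` (`[u, v]%classic `*` `[u', v']%classic)).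
  apply: continuous_compact; first exact: continuous_subspaceT.
  by apply: compact_setX; exact: segment_compact.
move=> [M [_ HM]]; exists (M + 1) => x y xP yP.
by apply: HM; [rewrite ltrDl | exists (x, y) => //; split; rewrite /= in_itv].
Qed.

Lemma int1_continuous u v h : continuous h ->
  continuous (fun x => int1 u v (fun y => h (x, y))).
Proof.
move=> ch x.
have [M HM] := box_bounded (x - 1) (x + 1) u v ch.
have := @continuity_under_integral R _ _ mu (fun x y => h (x, y)) `[u, v]%classic.
move=> /(_ (measurable_itv _) (x - 1) (x + 1)) /=.
apply.
- by move=> z _; apply/int1_integrable/cont_in/slice2_continuous.
- by apply/aeW => y _ z _; exact: slice1_continuous.
- by apply: (@int1_integrable _ u v (fun=> M)); apply: cont_in; exact: cst_continuous.
- move=> z; rewrite in_itv /= => /andP[z1 z2]; apply/aeW => y /=; rewrite in_itv /= => yP.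
  by apply: HM => //; rewrite !ltW.
- by rewrite inE /= in_itv /=; apply/andP; split; lra.
Qed.

(** Differentiation under the integral sign; on a compact box the derivative is
    bounded by its maximum. *)
Lemma int1_derive u v h h1 : continuous h -> continuous h1 ->
  (forall x y, is_derive (x : R) 1 (fun s : R => h (s, y) : R) (h1 (x, y))) ->
  forall x : R, is_derive x 1 (fun s : R => int1 u v (fun y => h (s, y)))
    (int1 u v (fun y => h1 (x, y))).
Proof.
move=> ch ch1 dh x.
have [M HM] := box_bounded (x - 1) (x + 1) u v ch1.
have Ix : `]x - 1, x + 1[%classic x by rewrite /= in_itv /=; apply/andP; split; lra.
pose f s y := h (s, y).
have intf z : `]x - 1, x + 1[%classic z -> mu.-integrable `[u, v]%classic (EFin \o f z).
  by move=> _; apply/int1_integrable/cont_in/slice2_continuous.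
have derf z y : `]x - 1, x + 1[%classic z -> `[u, v]%classic y -> derivable (f ^~ y) z 1.
  by move=> _ _; by case: (dh z y).
have intG : mu.-integrable `[u, v]%classic (EFin \o (fun=> `|M|)).
  by apply: (@int1_integrable _ u v (fun=> _)); apply: cont_in; exact: cst_continuous.
have Gub z y : `]x - 1, x + 1[%classic z -> `[u, v]%classic y ->
    `|partial1of2 f z y| <= (fun=> `|M|) y.
  rewrite /= !in_itv /= => /andP[z1 z2] yP; rewrite partial1of2E /f; have [_ ->] := dh z y.
  by apply: le_trans (ler_norm M); apply: HM => //; rewrite !ltW.
split.
  rewrite /int1; have := (@derivable_under_integral R _ _ mu f _ (measurable_itv _) x _ _ Ix intf derf (fun=> `|M|) (fun=> normr_ge0 M) intG Gub); exact.
rewrite -derive1E /int1.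
rewrite (@differentiation_under_integral R _ _ mu f _ (measurable_itv _) x _ _ Ix intf derf (fun=> `|M|) (fun=> normr_ge0 M) intG Gub).
by apply: eq_int1 => y _; rewrite partial1of2E /f; have [_ ->] := dh x y.
Qed.

Lemma int1_oo u v f : {in `[u, v], continuous f} ->
  \int[mu]_(x in `]u, v[) f x = int1 u v f.
Proof.
move=> /int1_integrable fi; rewrite /int1 Rintegral_itv_obnd_cbnd; last first.
  by apply: integrableS fi => //; apply: subset_itvScc; rewrite bnd_simp.
rewrite Rintegral_itv_bndo_bndc //.
by apply: integrableS fi => //; apply: subset_itvScc; rewrite bnd_simp.
Qed.

Definition int2 a b h : R := Rintegral (@leb2 R) (rect a b) h.

Lemma int2_fubini12 a b h : continuous h ->
  int2 a b h = int1 (- (a / 2)) (a / 2) (fun x => int1 (- (b / 2)) (b / 2) (fun y => h (x, y))).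
Proof.
move=> ch; rewrite -int1_oo; last exact/cont_in/int1_continuous.
rewrite /int2 /Rintegral; congr fine.
have hi := continuous_rect_integrable a b ch.
rewrite integral_mkcond /leb2 -integral12_prod_meas1; last first.
  by rewrite -integrable_mkcond //; exact: measurable_rect.
rewrite [RHS]integral_mkcond; apply: eq_integral => x _.
rewrite /fubini_F /patch mem_setE; case: ifPn => xP; last first.
  rewrite integral0_eq // => y _; case: ifPn => // /set_mem [/= xP' _].
  by move: xP; rewrite in_itv /= xP'.
rewrite -int1_oo; last exact/cont_in/slice2_continuous.
rewrite /Rintegral fineK; last first.
  apply: integrable_fin_num => //.
  apply: integrableS (int1_integrable (cont_in (slice2_continuous (x:=x) ch))) => //.
  by apply: subset_itvScc; rewrite bnd_simp.
rewrite [RHS]integral_mkcond; apply: eq_integral => y _.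
rewrite /patch [in RHS]mem_setE; move: xP; rewrite !in_itv /= => xP.
case: ifPn => yP; case: ifPn => //.
  by move: yP => /set_mem [_ /=] ->.
by move=> yP'; move: yP => /negP[]; apply/mem_set; split.
Qed.

End fubini.

Section fubini_swap.
Variable R : realType.
Implicit Types (h : R * R -> R) (a b u v : R).
Local Notation mu := (@lebesgue_measure R).

Lemma int2_fubini21 a b h : continuous h ->
  int2 a b h = int1 (- (b / 2)) (b / 2) (fun y => int1 (- (a / 2)) (a / 2) (fun x => h (x, y))).
Proof.
move=> ch; have ch' := @int1_continuous _ (- (a / 2)) (a / 2) _ (swap_arg_continuous ch).
rewrite -int1_oo; last exact/cont_in/ch'.
rewrite /int2 /Rintegral; congr fine.
have hi := continuous_rect_integrable a b ch.
rewrite integral_mkcond /leb2 -integral21_prod_meas1; last first.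
  by rewrite -integrable_mkcond //; exact: measurable_rect.
rewrite [RHS]integral_mkcond; apply: eq_integral => y _.
rewrite /fubini_G /patch mem_setE; case: ifPn => yP; last first.
  rewrite integral0_eq // => x _; case: ifPn => // /set_mem [_ /= yP'].
  by move: yP; rewrite in_itv /= yP'.
rewrite -int1_oo; last exact/cont_in/slice1_continuous.
rewrite /Rintegral fineK; last first.
  apply: integrable_fin_num => //.
  apply: integrableS (int1_integrable (cont_in (slice1_continuous (y:=y) ch))) => //.
  by apply: subset_itvScc; rewrite bnd_simp.
rewrite [RHS]integral_mkcond; apply: eq_integral => x _.
rewrite /patch [in RHS]mem_setE; move: yP; rewrite !in_itv /= => yP.
case: ifPn => xP; case: ifPn => //.
  by move: xP => /set_mem [/= ->].
by move=> xP'; move: xP => /negP[]; apply/mem_set; split.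
Qed.

Lemma eq_int2 a b h h' : (forall x, rect a b x -> h x = h' x) -> int2 a b h = int2 a b h'.
Proof. by move=> hh; apply: eq_Rintegral => x /set_mem; exact: hh. Qed.

Lemma int2D a b h h' : continuous h -> continuous h' ->
  int2 a b (fun x => h x + h' x) = int2 a b h + int2 a b h'.
Proof.
by move=> ch ch'; apply: RintegralD; [exact: measurable_rect|exact: continuous_rect_integrable..].
Qed.

Lemma int2B a b h h' : continuous h -> continuous h' ->
  int2 a b (fun x => h x - h' x) = int2 a b h - int2 a b h'.
Proof.
by move=> ch ch'; apply: RintegralB; [exact: measurable_rect|exact: continuous_rect_integrable..].
Qed.

Lemma int2Z a b h c : continuous h -> int2 a b (fun x => c * h x) = c * int2 a b h.
Proof.
by move=> ch; apply: RintegralZl; [exact: measurable_rect|exact: continuous_rect_integrable].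
Qed.

Lemma int2_le a b h h' : continuous h -> continuous h' ->
  (forall x, rect a b x -> h x <= h' x) -> int2 a b h <= int2 a b h'.
Proof.
move=> ch ch' hh.
by apply: le_Rintegral => //; [exact: measurable_rect|exact: continuous_rect_integrable..].
Qed.

End fubini_swap.

Section parametric.
Variable R : realType.

(** By compactness of the segment, [G (x, y)] is close to [G (x0, y)] uniformly
    in [y]. The parameter ranges over any topological space because it will be a
    point of the plane. *)
Lemma int1_param_continuous (T : topologicalType) (u v : R) (G : T * R -> R) :
  u <= v -> continuous G -> continuous (fun x => int1 u v (fun y => G (x, y))).
Proof.
move=> uv cG x0.
have cS x : continuous (fun y => G (x, y)).
  move=> y; apply: (@continuous_comp _ _ _ (fun y => (x, y)) G); last exact: cG.
  have : (x, y') @[y' --> y] --> (x, y); last by [].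
  by apply: (@cvg_pair _ _ _ (nbhs y) (nbhs x) (nbhs y)); [exact: cvg_cst | exact: cvg_id].
apply/cvgrPdist_le => /= e e0.
pose d := e / (v - u + 1).
have d0 : 0 < d by rewrite divr_gt0 //; lra.
have nx : \forall x \near x0, `[u, v]%classic `<=` (fun y => `|G (x0, y) - G (x, y)| <= d).
  have /compact_near_coveringP := @segment_compact R u v.
  move=> /(_ T (nbhs x0) (fun x y => `|G (x0, y) - G (x, y)| <= d) _); apply.
  move=> y _.
  have d2 : 0 < d / 2 by rewrite divr_gt0.
  have /cvgrPdist_le /(_ _ d2) [[A B] /= [nA nB] AB] := cG (x0, y).
  exists (B, A) => //= -[z1 z2] /= [Bz1 Az2].
  have := ler_distD (G (x0, y)) (G (x0, z1)) (G (z2, z1)).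
  have /= := AB (z2, z1) (conj Az2 Bz1).
  have /= := AB (x0, z1) (conj (nbhs_singleton nA) Bz1).
  by rewrite (distrC _ (G (x0, y))); lra.
near=> x.
rewrite -int1B; [|exact/cont_in/cS|exact/cont_in/cS].
apply: (@le_trans _ _ (int1 u v (fun=> d))); last first.
  rewrite int1_cst // /d -mulrA ler_piMr ?(ltW e0) //.
  rewrite mulrC ler_pdivrMr; lra.
have cD : {in `[u, v], continuous (fun y => G (x0, y) - G (x, y))}.
  by move=> y _; apply: cvgB; exact: cS.
apply: le_trans (le_normr_Rintegral _ (int1_integrable cD)) _ => //.
apply: (@int1_le _ u v (fun y => `|G (x0, y) - G (x, y)|)).
- by move=> y yP; apply: cvg_norm; exact: cD.
- by move=> y _; exact: cst_continuous.
- by near: x; apply: filterS nx => z nz y yP; apply: nz; rewrite /= in_itv.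
Unshelve. all: by end_near. Qed.

End parametric.

(** * Functions of class C^k on the plane *)

Section continuity.
Variables (T U V : topologicalType) (R : realType).

Lemma cont_comp (f : T -> U) (g : U -> V) : continuous f -> continuous g ->
  continuous (fun x => g (f x)).
Proof. by move=> cf cg x; apply: (@continuous_comp _ _ _ f g); [exact: cf|exact: cg]. Qed.

Lemma cont_pair (f : T -> U) (g : T -> V) : continuous f -> continuous g ->
  continuous (fun x => (f x, g x)).
Proof.
move=> cf cg x; have : (f x', g x') @[x' --> x] --> (f x, g x); last by [].
by apply: (@cvg_pair _ _ _ (nbhs x) (nbhs (f x)) (nbhs (g x))); [exact: cf|exact: cg].
Qed.

Lemma cont_id : continuous (fun x : T => x). Proof. by move=> x; exact: cvg_id. Qed.

Lemma cont_fst (f : T -> U * V) : continuous f -> continuous (fun x => (f x).1).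
Proof. by move=> cf x; apply: (cvg_comp _ _ (cf x)); exact: cvg_fst. Qed.

Lemma cont_snd (f : T -> U * V) : continuous f -> continuous (fun x => (f x).2).
Proof. by move=> cf x; apply: (cvg_comp _ _ (cf x)); exact: cvg_snd. Qed.

Implicit Types f g : T -> R.
Lemma contD f g : continuous f -> continuous g -> continuous (fun x => f x + g x).
Proof. by move=> cf cg x; apply: cvgD; [exact: cf|exact: cg]. Qed.

Lemma contB f g : continuous f -> continuous g -> continuous (fun x => f x - g x).
Proof. by move=> cf cg x; apply: cvgB; [exact: cf|exact: cg]. Qed.

Lemma contN f : continuous f -> continuous (fun x => - f x).
Proof. by move=> cf x; apply: cvgN; exact: cf. Qed.

Lemma contM f g : continuous f -> continuous g -> continuous (fun x => f x * g x).
Proof. by move=> cf cg x; apply: cvgM; [exact: cf|exact: cg]. Qed.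

Lemma contX f n : continuous f -> continuous (fun x => f x ^+ n).
Proof.
move=> cf; elim: n => [|n IH]; first exact: cst_continuous.
have -> : (fun x => f x ^+ n.+1) = (fun x => f x * f x ^+ n).
  by apply/funext => x; rewrite exprS.
exact: contM.
Qed.

End continuity.

Section partial_derivatives.
Variable R : realType.
Implicit Types (h : R * R -> R) (x : R * R).

Lemma slice1E h x : (fun s : R => s^-1 *: (h (s *: e1 R + x) - h x)) =
  (fun s : R => s^-1 *: (h (s *: 1 + x.1, x.2) - h x)).
Proof.
apply/funext => s; congr (_ *: (h _ - _)).
by case: x => x1 x2; congr pair; rewrite /= scaler0 add0r.
Qed.

Lemma slice2E h x : (fun s : R => s^-1 *: (h (s *: e2 R + x) - h x)) =
  (fun s : R => s^-1 *: (h (x.1, s *: 1 + x.2) - h x)).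
Proof.
apply/funext => s; congr (_ *: (h _ - _)).
by case: x => x1 x2; congr pair; rewrite /= scaler0 add0r.
Qed.

Lemma derivable_e1E h x :
  derivable h x (e1 R) = derivable (fun s : R => h (s, x.2) : R) x.1 1.
Proof. by rewrite /derivable slice1E; case: x. Qed.

Lemma derivable_e2E h x :
  derivable h x (e2 R) = derivable (fun s : R => h (x.1, s) : R) x.2 1.
Proof. by rewrite /derivable slice2E; case: x. Qed.

Lemma derive_e1E h x : 'D_(e1 R) h x = 'D_1 (fun s : R => h (s, x.2) : R) x.1.
Proof. by rewrite /derive slice1E; case: x. Qed.

Lemma derive_e2E h x : 'D_(e2 R) h x = 'D_1 (fun s : R => h (x.1, s) : R) x.2.
Proof. by rewrite /derive slice2E; case: x. Qed.

Lemma is_derive_e1P h x d :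
  is_derive x (e1 R) h d <-> is_derive x.1 1 (fun s : R => h (s, x.2) : R) d.
Proof.
split=> -[a b]; split.
- by rewrite -(derivable_e1E h x).
- by rewrite -(derive_e1E h x).
- by rewrite derivable_e1E.
- by rewrite derive_e1E.
Qed.

Lemma is_derive_e2P h x d :
  is_derive x (e2 R) h d <-> is_derive x.2 1 (fun s : R => h (x.1, s) : R) d.
Proof.
split=> -[a b]; split.
- by rewrite -(derivable_e2E h x).
- by rewrite -(derive_e2E h x).
- by rewrite derivable_e2E.
- by rewrite derive_e2E.
Qed.

Lemma is_derive_chain (f : R -> R) h x (v : R * R) a b :
  v = e1 R \/ v = e2 R -> is_derive x v h a -> is_derive (h x) 1 f b ->
  is_derive x v (f \o h) (b * a).
Proof.
move=> [->|->].
  move=> /is_derive_e1P Ha Hb; apply/is_derive_e1P.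
  have Hb' : is_derive ((fun s => h (s, x.2)) x.1) 1 f b by case: x {Ha} Hb.
  exact: (@is_derive1_comp _ f (fun s => h (s, x.2))).
move=> /is_derive_e2P Ha Hb; apply/is_derive_e2P.
have Hb' : is_derive ((fun s => h (x.1, s)) x.2) 1 f b by case: x {Ha} Hb.
exact: (@is_derive1_comp _ f (fun s => h (x.1, s))).
Qed.

Lemma Ck_continuous k h : Ck k h -> continuous h.
Proof. by case: k => [//|k] []. Qed.

Lemma CkS k h d1 d2 : continuous h ->
  (forall x, is_derive x (e1 R) h (d1 x)) -> (forall x, is_derive x (e2 R) h (d2 x)) ->
  Ck k d1 -> Ck k d2 -> Ck k.+1 h.
Proof.
move=> ch H1 H2 C1 C2; split; [by []|by move=> x; case: (H1 x)|by move=> x; case: (H2 x)| |].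
- by rewrite (_ : (fun x => _) = d1) //; apply/funext => x; case: (H1 x).
- by rewrite (_ : (fun x => _) = d2) //; apply/funext => x; case: (H2 x).
Qed.

Lemma Ck_is_derive k h x v : v = e1 R \/ v = e2 R -> Ck k.+1 h ->
  is_derive x v h ('D_v h x).
Proof. by move=> [->|->] [_ d1 d2 _ _]; split. Qed.

Lemma Ck_derive k h v : v = e1 R \/ v = e2 R -> Ck k.+1 h -> Ck k (fun x => 'D_v h x).
Proof. by move=> [->|->] []. Qed.

Lemma CkW k h : Ck k.+1 h -> Ck k h.
Proof.
elim: k h => [h []//|k IH h [ch d1 d2 c1 c2]].
by split; [exact: ch|exact: d1|exact: d2|exact: (IH _ c1)|exact: (IH _ c2)].
Qed.

Lemma smooth_derive h v : v = e1 R \/ v = e2 R -> smooth h ->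
  smooth (fun x => 'D_v h x).
Proof. by move=> Hv sh k; exact: Ck_derive (sh k.+1). Qed.

Lemma Ck_cst k (c : R) : Ck k (fun=> c).
Proof.
elim: k c => [|k IH] c; first exact: cst_continuous.
exact: (@CkS _ _ (fun=> 0) (fun=> 0) (@cst_continuous _ _ c)
  (fun x => is_derive_cst _ _ _) (fun x => is_derive_cst _ _ _) (IH 0) (IH 0)).
Qed.

Lemma CkD k h h' : Ck k h -> Ck k h' -> Ck k (fun x => h x + h' x).
Proof.
have cD (u v : R * R -> R) : continuous u -> continuous v -> continuous (fun x => u x + v x).
  by move=> cu cv x; apply: cvgD; [exact: cu|exact: cv].
elim: k h h' => [|k IH] h h' H H'; first exact: cD.
apply: (@CkS _ _ (fun x => 'D_(e1 R) h x + 'D_(e1 R) h' x) (fun x => 'D_(e2 R) h x + 'D_(e2 R) h' x)).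
- by apply: cD; [exact: (Ck_continuous H)|exact: (Ck_continuous H')].
- by move=> x; apply: is_deriveD; [apply: Ck_is_derive H|apply: Ck_is_derive H']; left.
- by move=> x; apply: is_deriveD; [apply: Ck_is_derive H|apply: Ck_is_derive H']; right.
- by apply: IH; apply: Ck_derive => //; left.
- by apply: IH; apply: Ck_derive => //; right.
Qed.

Lemma CkM k h h' : Ck k h -> Ck k h' -> Ck k (fun x => h x * h' x).
Proof.
have cM (u v : R * R -> R) : continuous u -> continuous v -> continuous (fun x => u x * v x).
  by move=> cu cv x; apply: cvgM; [exact: cu|exact: cv].
elim: k h h' => [|k IH] h h' H H'; first exact: cM.
apply: (@CkS _ _ (fun x => h x * 'D_(e1 R) h' x + h' x * 'D_(e1 R) h x)
   (fun x => h x * 'D_(e2 R) h' x + h' x * 'D_(e2 R) h x)).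
- by apply: cM; [exact: (Ck_continuous H)|exact: (Ck_continuous H')].
- by move=> x; apply: is_deriveM; [apply: Ck_is_derive H|apply: Ck_is_derive H']; left.
- by move=> x; apply: is_deriveM; [apply: Ck_is_derive H|apply: Ck_is_derive H']; right.
- by apply: CkD; apply: IH => //; try exact: CkW; apply: Ck_derive => //; left.
- by apply: CkD; apply: IH => //; try exact: CkW; apply: Ck_derive => //; right.
Qed.

Lemma Ck_fst k : Ck k (fun x : R * R => x.1).
Proof.
case: k => [|k]; first by move=> x; exact: cvg_fst.
apply: (@CkS _ _ (fun=> 1) (fun=> 0)); [by move=> x; exact: cvg_fst| | |exact: Ck_cst|exact: Ck_cst].
- by move=> x; apply/is_derive_e1P; exact: is_derive_id.
- by move=> x; apply/is_derive_e2P; exact: is_derive_cst.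
Qed.

Lemma Ck_snd k : Ck k (fun x : R * R => x.2).
Proof.
case: k => [|k]; first by move=> x; exact: cvg_snd.
apply: (@CkS _ _ (fun=> 0) (fun=> 1)); [by move=> x; exact: cvg_snd| | |exact: Ck_cst|exact: Ck_cst].
- by move=> x; apply/is_derive_e1P; exact: is_derive_cst.
- by move=> x; apply/is_derive_e2P; exact: is_derive_id.
Qed.

(** A family of one-variable functions closed under differentiation consists of
    smooth functions, and composition on the left with them preserves [Ck]. *)
Lemma Ck_comp (P : (R -> R) -> Prop) :
  (forall f, P f -> exists2 g, P g & forall s : R, is_derive s 1 f (g s)) ->
  forall k f h, P f -> Ck k h -> Ck k (fun x => f (h x)).
Proof.
move=> HP; have cP f : P f -> continuous f.
  move=> /HP[g _ df] s; have [d _] := df s.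
  exact/differentiable_continuous/derivable1_diffP.
have cc f h : P f -> continuous h -> continuous (fun x => f (h x)).
  move=> Pf ch x; apply: (@continuous_comp _ _ _ h f); first exact: ch.
  exact: cP.
elim=> [|k IH] f h Pf H; first exact: cc.
have [g Pg df] := HP _ Pf.
apply: (@CkS _ _ (fun x => g (h x) * 'D_(e1 R) h x) (fun x => g (h x) * 'D_(e2 R) h x)).
- by apply: cc => //; exact: Ck_continuous H.
- by move=> x; have := @is_derive_chain f h x (e1 R) _ _ (or_introl erefl) (@Ck_is_derive k h x _ (or_introl erefl) H) (df (h x)); exact.
- by move=> x; have := @is_derive_chain f h x (e2 R) _ _ (or_intror erefl) (@Ck_is_derive k h x _ (or_intror erefl) H) (df (h x)); exact.
- by apply: CkM; [apply: IH => //; exact: CkW | apply: Ck_derive H; left].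
- by apply: CkM; [apply: IH => //; exact: CkW | apply: Ck_derive H; right].
Qed.

Definition sincos (f : R -> R) := exists a b, f = (fun s => a * sin s + b * cos s).

Lemma sincos_derive f : sincos f -> exists2 g, sincos g & forall s : R, is_derive s 1 f (g s).
Proof.
move=> [a [b ->]]; exists (fun s => - b * sin s + a * cos s); first by exists (- b), a.
move=> s.
have D1 : is_derive s 1 (fun s : R => a * sin s) (a * cos s).
  have := is_deriveZ a (is_derive_sin s); exact.
have D2 : is_derive s 1 (fun s : R => b * cos s) (b * - sin s).
  have := is_deriveZ b (is_derive_cos s); exact.
rewrite (_ : - b * sin s + a * cos s = a * cos s + b * - sin s); last by ring.
exact: is_deriveD.
Qed.

Lemma Ck_sin k h : Ck k h -> Ck k (fun x => sin (h x)).
Proof.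
move=> H; have := Ck_comp sincos_derive; apply => //.
by exists 1, 0; apply/funext => s; rewrite mul1r mul0r addr0.
Qed.

Lemma Ck_cos k h : Ck k h -> Ck k (fun x => cos (h x)).
Proof.
move=> H; have := Ck_comp sincos_derive; apply => //.
by exists 0, 1; apply/funext => s; rewrite mul1r mul0r add0r.
Qed.

Lemma Ck_diag k h a b : Ck k h -> Ck k (fun x => h (a * x.1, b * x.2)).
Proof.
have cc (u : R * R -> R) : continuous u -> continuous (fun x => u (a * x.1, b * x.2)).
  move=> cu x; apply: (@continuous_comp _ _ _ (fun x : R * R => (a * x.1, b * x.2)) u); last exact: cu.
  have : (a * x'.1, b * x'.2) @[x' --> x] --> (a * x.1, b * x.2); last by [].
  apply: (@cvg_pair _ _ _ (nbhs x) (nbhs (a * x.1)) (nbhs (b * x.2))).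
    by apply: cvgM; [exact: cvg_cst|exact: cvg_fst].
  by apply: cvgM; [exact: cvg_cst|exact: cvg_snd].
elim: k h => [|k IH] h H; first exact: cc.
apply: (@CkS _ _ (fun x => a * 'D_(e1 R) h (a * x.1, b * x.2)) (fun x => b * 'D_(e2 R) h (a * x.1, b * x.2))).
- by apply: cc; exact: Ck_continuous H.
- move=> x; apply/is_derive_e1P => /=; rewrite [X in is_derive _ _ _ X]mulrC.
  have := @Ck_is_derive k h (a * x.1, b * x.2) (e1 R) (or_introl erefl) H.
  move=> /is_derive_e1P Dh; apply: (is_derive1_comp Dh).
  by have := is_deriveZ a (is_derive_id x.1 1); rewrite /GRing.scale /= mulr1.
- move=> x; apply/is_derive_e2P => /=; rewrite [X in is_derive _ _ _ X]mulrC.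
  have := @Ck_is_derive k h (a * x.1, b * x.2) (e2 R) (or_intror erefl) H.
  move=> /is_derive_e2P Dh; apply: (is_derive1_comp Dh).
  by have := is_deriveZ b (is_derive_id x.2 1); rewrite /GRing.scale /= mulr1.
- by apply: CkM; [exact: Ck_cst|apply: (IH (fun x => 'D_(e1 R) h x)); apply: Ck_derive H; left].
- by apply: CkM; [exact: Ck_cst|apply: (IH (fun x => 'D_(e2 R) h x)); apply: Ck_derive H; right].
Qed.

Lemma Ck_swap k h : Ck k h -> Ck k (fun x => h (x.2, x.1)).
Proof.
elim: k h => [|k IH] h H; first exact: swap_arg_continuous.
apply: (@CkS _ _ (fun x => 'D_(e2 R) h (x.2, x.1)) (fun x => 'D_(e1 R) h (x.2, x.1))).
- by apply: swap_arg_continuous; exact: Ck_continuous H.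
- move=> x; apply/is_derive_e1P => /=.
  have := @Ck_is_derive k h (x.2, x.1) (e2 R) (or_intror erefl) H.
  by move=> /is_derive_e2P.
- move=> x; apply/is_derive_e2P => /=.
  have := @Ck_is_derive k h (x.2, x.1) (e1 R) (or_introl erefl) H.
  by move=> /is_derive_e1P.
- by apply: (IH (fun x => 'D_(e2 R) h x)); apply: Ck_derive H; right.
- by apply: (IH (fun x => 'D_(e1 R) h x)); apply: Ck_derive H; left.
Qed.

End partial_derivatives.

(** * Potentials of curl-free fields *)

Section parametric_smooth.
Variable R : realType.
Implicit Types (g h : R * R -> R).

(** A derivative in the second variable brings out a factor [t]; the power of
    [t] is there for the induction on [n]. *)
Lemma Ck_int1_scaled n k g : Ck n g ->
  Ck n (fun x => int1 0 1 (fun t => t ^+ k * g (x.1, t * x.2))).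
Proof.
have cc k' u : continuous u ->
    continuous (fun x : R * R => int1 0 1 (fun t => t ^+ k' * u (x.1, t * x.2))).
  move=> cu.
  apply: (@int1_param_continuous R _ 0 1 (fun z : R * R * R => z.2 ^+ k' * u (z.1.1, z.2 * z.1.2))) => //.
  have c2 : continuous (fun z : R * R * R => z.2) by apply: cont_snd; exact: cont_id.
  have c1 : continuous (fun z : R * R * R => z.1) by apply: cont_fst; exact: cont_id.
  apply: contM; first exact: contX.
  apply: (cont_comp _ cu); apply: cont_pair; first exact: cont_fst.
  by apply: contM => //; exact: cont_snd.
have c2 : continuous (fun z : R * R => z.2) by apply: cont_snd; exact: cont_id.
have c1 : continuous (fun z : R * R => z.1) by apply: cont_fst; exact: cont_id.
elim: n k g => [|n IH] k g Hg; first exact: cc.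
have cg := Ck_continuous Hg.
have cd1 := Ck_continuous (Ck_derive (or_introl erefl) Hg).
have cd2 := Ck_continuous (Ck_derive (or_intror erefl) Hg).
apply: (@CkS _ _ _ (fun x => int1 0 1 (fun t => t ^+ k * 'D_(e1 R) g (x.1, t * x.2)))
  (fun x => int1 0 1 (fun t => t ^+ k.+1 * 'D_(e2 R) g (x.1, t * x.2)))).
- exact: cc.
- move=> x; apply/is_derive_e1P => /=.
  apply: (@int1_derive R 0 1 (fun z => z.2 ^+ k * g (z.1, z.2 * x.2))
     (fun z => z.2 ^+ k * 'D_(e1 R) g (z.1, z.2 * x.2))).
  + apply: contM; first exact: contX.
    apply: (cont_comp _ cg); apply: cont_pair => //; apply: contM => //; exact: cst_continuous.
  + apply: contM; first exact: contX.
    apply: (cont_comp _ cd1); apply: cont_pair => //; apply: contM => //; exact: cst_continuous.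
  + move=> s t /=; have := @Ck_is_derive _ n g (s, t * x.2) (e1 R) (or_introl erefl) Hg.
    by move=> /is_derive_e1P /= Dg; have := is_deriveZ (t ^+ k) Dg; exact.
- move=> x; apply/is_derive_e2P => /=.
  apply: (@int1_derive R 0 1 (fun z => z.2 ^+ k * g (x.1, z.2 * z.1))
     (fun z => z.2 ^+ k.+1 * 'D_(e2 R) g (x.1, z.2 * z.1))).
  + apply: contM; first exact: contX.
    apply: (cont_comp _ cg); apply: cont_pair; [exact: cst_continuous|exact: contM].
  + apply: contM; first exact: contX.
    apply: (cont_comp _ cd2); apply: cont_pair; [exact: cst_continuous|exact: contM].
  + move=> s t /=; have := @Ck_is_derive _ n g (x.1, t * s) (e2 R) (or_intror erefl) Hg.
    move=> /is_derive_e2P /= Dg.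
    have Dt : is_derive s 1 (fun s : R => t * s) t.
      by have := is_deriveZ t (is_derive_id s 1); rewrite /GRing.scale /= mulr1.
    have := is_deriveZ (t ^+ k) (is_derive1_comp Dg Dt).
    by rewrite /GRing.scale /= (mulrC _ t) mulrA -exprSr; exact.
- exact: (IH k (fun x => 'D_(e1 R) g x) (Ck_derive (or_introl erefl) Hg)).
- exact: (IH k.+1 (fun x => 'D_(e2 R) g x) (Ck_derive (or_intror erefl) Hg)).
Qed.

Lemma is_derive_comp1 (f g : R -> R) (x a b : R) : is_derive x 1 g a ->
  is_derive (g x) 1 f b -> is_derive x 1 (fun s : R => f (g s)) (b * a).
Proof. by move=> Dg Df; have := is_derive1_comp Df Dg; exact. Qed.

(** The primitive of [g] that vanishes at 0, written as an integral over a fixed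
    segment so that it depends smoothly on further parameters. *)
Lemma derive_scaled_mean (g g' : R -> R) : continuous g' ->
  (forall s : R, is_derive s 1 g (g' s)) ->
  forall s : R, is_derive s 1 (fun s : R => s * int1 0 1 (fun t => g (t * s))) (g s).
Proof.
move=> cg' dg s.
have cg : continuous g.
  by move=> z; have [d _] := dg z; exact/differentiable_continuous/derivable1_diffP.
have c2 : continuous (fun z : R * R => z.2) by apply: cont_snd; exact: cont_id.
have c1 : continuous (fun z : R * R => z.1) by apply: cont_fst; exact: cont_id.
have ct (c : R) : continuous (fun t : R => t * c).
  by apply: contM; [exact: cont_id|exact: cst_continuous].
have Dt z (c : R) : is_derive (z : R) 1 (fun z : R => c * z) c.
  by have := is_deriveZ c (is_derive_id z 1); rewrite /GRing.scale /= mulr1.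
have DJ := @int1_derive R 0 1 (fun z => g (z.2 * z.1)) (fun z => g' (z.2 * z.1) * z.2)
  (cont_comp (contM c2 c1) cg) (contM (cont_comp (contM c2 c1) cg') c2)
  (fun z t => is_derive1_comp (dg (t * z)) (Dt z t)) s.
have := is_deriveM (is_derive_id s 1) DJ; rewrite /GRing.scale /= mulr1.
rewrite -int1Z; last exact/cont_in/(contM (cont_comp (ct s) cg') (@cont_id _)).
rewrite -int1D; last 2 first.
- exact/cont_in/(contM (@cst_continuous _ _ s) (contM (cont_comp (ct s) cg') (@cont_id _))).
- exact/cont_in/(cont_comp (ct s) cg).
rewrite (_ : int1 0 1 _ = 1 * g (1 * s) - 0 * g (0 * s)); first by rewrite mul0r subr0 !mul1r; exact.
apply: (@int1_FTC _ 0 1 _ (fun t => t * g (t * s))) => //.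
- apply/cont_in/contD; last exact: (cont_comp (ct s) cg).
  exact: (contM (@cst_continuous _ _ s) (contM (cont_comp (ct s) cg') (@cont_id _))).
- move=> t _; have Dc : is_derive t 1 (fun t : R => t * s) s.
    by have := Dt t s; under eq_fun do rewrite mulrC.
  have := is_deriveM (is_derive_id t 1) (@is_derive_comp1 g (fun t => t * s) t _ _ Dc (dg (t * s))).
  rewrite /GRing.scale /= mulr1.
  by rewrite (_ : t * (g' (t * s) * s) = s * (g' (t * s) * t)) //; ring.
Qed.

(** The potential integrates the field along the broken line from the origin to
    [x] that first follows the horizontal axis, and that stays in the rectangle.
    Its two segments are parametrized by the unit interval, so that the
    potential is smooth on the whole plane. *)
Lemma poincare (b1 b2 : R * R -> R) (p q : R) : smooth b1 -> smooth b2 ->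
  (forall x, rect p q x -> 'D_(e1 R) b2 x = 'D_(e2 R) b1 x) ->
  exists2 chi, smooth chi &
    forall x, rect p q x -> 'D_(e1 R) chi x = b1 x /\ 'D_(e2 R) chi x = b2 x.
Proof.
move=> s1 s2 curl.
pose g1 : R * R -> R := fun x => b1 (x.2, 0 * x.1).
have sg1 : smooth g1.
  by move=> k; have := Ck_swap (Ck_diag 1 0 (s1 k)); under eq_fun do rewrite /= mul1r; exact.
pose G1 x := int1 0 1 (fun t : R => t ^+ 0 * g1 (x.1, t * x.2)).
pose G2 x := int1 0 1 (fun t : R => t ^+ 0 * b2 (x.1, t * x.2)).
have sG1 : smooth G1 by move=> k; exact: Ck_int1_scaled.
have sG2 : smooth G2 by move=> k; exact: Ck_int1_scaled.
exists (fun x => x.1 * G1 (x.2, x.1) + x.2 * G2 x).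
  move=> k; apply: CkD; apply: CkM; [exact: Ck_fst|exact: (Ck_swap (sG1 k))|exact: Ck_snd|exact: sG2].
have c1 := Ck_continuous (s1 0).
have d11 := smooth_derive (or_introl erefl) s1.
have d12 := smooth_derive (or_intror erefl) s1.
have d21 := smooth_derive (or_introl erefl) s2.
have d22 := smooth_derive (or_intror erefl) s2.
move=> [x1 x2] [/= X1 X2].
have X t : 0 <= t <= 1 -> rect p q (x1, t * x2).
  move=> /andP[t0 t1]; split => //=; move: X2 => /andP[l r]; apply/andP; split; nra.
pose f := fun s : R => b1 (s, 0).
have Df (s : R) : is_derive s 1 f ('D_(e1 R) b1 (s, 0)).
  have := @Ck_is_derive _ 0 b1 (s, 0) (e1 R) (or_introl erefl) (s1 1).
  by move=> /is_derive_e1P.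
have cf' : continuous (fun s : R => 'D_(e1 R) b1 (s, 0)).
  exact: (slice1_continuous (y := 0) (Ck_continuous (d11 0))).
pose h := fun s : R => b2 (x1, s).
have Dh (s : R) : is_derive s 1 h ('D_(e2 R) b2 (x1, s)).
  have := @Ck_is_derive _ 0 b2 (x1, s) (e2 R) (or_intror erefl) (s2 1).
  by move=> /is_derive_e2P.
have ch' : continuous (fun s : R => 'D_(e2 R) b2 (x1, s)).
  exact: (slice2_continuous (x := x1) (Ck_continuous (d22 0))).
pose k := fun s : R => b1 (x1, s).
have Dk (s : R) : is_derive s 1 k ('D_(e2 R) b1 (x1, s)).
  have := @Ck_is_derive _ 0 b1 (x1, s) (e2 R) (or_intror erefl) (s1 1).
  by move=> /is_derive_e2P.
have ck' : continuous (fun s : R => 'D_(e2 R) b1 (x1, s)).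
  exact: (slice2_continuous (x := x1) (Ck_continuous (d12 0))).
have ct (c : R) : continuous (fun t : R => t * c).
  by apply: contM; [exact: cont_id|exact: cst_continuous].
have Dt (z c : R) : is_derive (z : R) 1 (fun z : R => c * z) c.
  by have := is_deriveZ c (is_derive_id z 1); rewrite /GRing.scale /= mulr1.
split.
- rewrite derive_e1E /= /G1 /G2 /g1 /=.
  have -> : (fun s : R => s * int1 0 1 (fun t => t ^+ 0 * b1 (t * s, 0 * x2)) +
     x2 * int1 0 1 (fun t => t ^+ 0 * b2 (s, t * x2))) =
     (fun s : R => s * int1 0 1 (fun t => f (t * s)) +
     x2 * int1 0 1 (fun t => b2 (s, t * x2))).
    apply/funext => s; congr (_ * _ + _ * _); apply: eq_int1 => t _.
      by rewrite expr0 mul1r mul0r.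
    by rewrite expr0 mul1r.
  have D1 := derive_scaled_mean cf' Df x1.
  have c2t : continuous (fun z : R * R => (z.1, z.2 * x2)).
    apply: cont_pair; first by apply: cont_fst; exact: cont_id.
    by apply: cont_comp (ct x2); apply: cont_snd; exact: cont_id.
  have D2 := @int1_derive R 0 1 (fun z => b2 (z.1, z.2 * x2)) (fun z => 'D_(e1 R) b2 (z.1, z.2 * x2))
    (cont_comp c2t (Ck_continuous (s2 0))) (cont_comp c2t (Ck_continuous (d21 0))).
  have {}D2 : is_derive x1 1 (fun s : R => int1 0 1 (fun t => b2 (s, t * x2)))
      (int1 0 1 (fun t => 'D_(e1 R) b2 (x1, t * x2))).
    apply: D2 => s t.
    have := @Ck_is_derive _ 0 b2 (s, t * x2) (e1 R) (or_introl erefl) (s2 1).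
    by move=> /is_derive_e1P.
  have [_ ->] := is_deriveD D1 (is_deriveZ x2 D2).
  rewrite /GRing.scale /=.
  rewrite (@eq_int1 _ 0 1 _ (fun t => 'D_(e2 R) b1 (x1, t * x2))); last first.
    by move=> t t01; apply: curl; exact: X.
  rewrite -int1Z; last exact/cont_in/(cont_comp (ct x2) ck').
  rewrite (_ : int1 0 1 _ = k (1 * x2) - k (0 * x2)).
    by rewrite /f /k mul1r mul0r addrC subrK.
  apply: (@int1_FTC _ 0 1 _ (fun t => k (t * x2))) => //.
  + apply/cont_in/contM; [exact: cst_continuous|exact: (cont_comp (ct x2) ck')].
  + move=> t _; have Dc : is_derive t 1 (fun t : R => t * x2) x2.
      by have := Dt t x2; under eq_fun do rewrite mulrC.
    rewrite [X in is_derive _ _ _ X]mulrC.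
    exact: (@is_derive_comp1 k (fun t => t * x2) t _ _ Dc (Dk (t * x2))).
- rewrite derive_e2E /= /G1 /G2 /g1 /=.
  have -> : (fun s : R => x1 * int1 0 1 (fun t => t ^+ 0 * b1 (t * x1, 0 * s)) +
     s * int1 0 1 (fun t => t ^+ 0 * b2 (x1, t * s))) =
     (fun s : R => x1 * int1 0 1 (fun t => f (t * x1)) + s * int1 0 1 (fun t => h (t * s))).
    apply/funext => s; congr (_ * _ + _ * _); apply: eq_int1 => t _.
      by rewrite expr0 mul1r mul0r.
    by rewrite expr0 mul1r.
  have D1 := derive_scaled_mean ch' Dh x2.
  have [_ ->] := is_deriveD (is_derive_cst (x1 * int1 0 1 (fun t => f (t * x1))) x2 1) D1.
  by rewrite add0r.
Qed.

End parametric_smooth.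

(** * The one-dimensional spectral gap *)

Section one_dimensional.
Variable R : realType.
Implicit Types (f m G : R -> R) (k x y : R).

(** The function [tan (k x)] blows up at the ends of the segment when [k = pi];
    inequalities are proved for smaller [k] and extended by continuity. *)
Lemma limit_pi (g : R -> R) : continuous g ->
  (forall k, 0 < k < pi -> 0 <= g k) -> 0 <= g (pi : R).
Proof.
move=> cg g0; rewrite leNgt; apply/negP => gpi.
have : \forall k \near (pi : R), g k < 0.
  have /cvgrPdist_lt /(_ (- g pi)) := cg pi; rewrite oppr_gt0 => /(_ gpi).
  by apply: filterS => k; rewrite ltr_norml => /andP[+ _]; lra.
move=> /nbhs_ballP[e /= e0 be].
have p0 := @pi_gt0 R.
pose k := Num.max (pi / 2) (pi - e / 2).
have kP : 0 < k < pi.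
  rewrite lt_max gt_max; apply/andP; split; first by apply/orP; left; lra.
  by apply/andP; split; lra.
have : g k < 0.
  apply: be; rewrite /ball /= ltr_norml; move: kP => /andP[k0 kpi].
  have : pi - e / 2 <= k by rewrite /k le_max lexx orbT.
  by move=> H; apply/andP; split; lra.
by rewrite ltNge g0.
Qed.

Lemma cos_gt0_half k x : 0 < k < pi -> - (1 / 2) <= x <= 1 / 2 -> 0 < cos (k * x).
Proof.
move=> /andP[k0 kpi] /andP[x1 x2]; apply: cos_gt0_pihalf; apply/andP; split; nra.
Qed.

Lemma is_derive_tan_scaled k x : 0 < k < pi -> - (1 / 2) <= x <= 1 / 2 ->
  is_derive x 1 (fun s : R => tan (k * s)) ((cos (k * x)) ^- 2 * k).
Proof.
move=> kP xP; apply: (@is_derive_comp1 R tan (fun s => k * s)).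
  by have := is_deriveZ k (is_derive_id x 1); rewrite /GRing.scale /= mulr1.
by apply: is_derive_tan; rewrite gt_eqF // cos_gt0_half.
Qed.

Lemma is_derive_cos_scaled k x :
  is_derive x 1 (fun s : R => cos (k * s)) (- sin (k * x) * k).
Proof.
apply: (@is_derive_comp1 R cos (fun s => k * s)).
by have := is_deriveZ k (is_derive_id x 1); rewrite /GRing.scale /= mulr1.
Qed.

Lemma is_derive_sin_scaled k x :
  is_derive x 1 (fun s : R => sin (k * s)) (cos (k * x) * k).
Proof.
apply: (@is_derive_comp1 R sin (fun s => k * s)).
by have := is_deriveZ k (is_derive_id x 1); rewrite /GRing.scale /= mulr1.
Qed.

Lemma is_derive_cont f f' : (forall x, is_derive (x : R) 1 f (f' x)) -> continuous f.
Proof.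
by move=> df x; have [d _] := df x; exact/differentiable_continuous/derivable1_diffP.
Qed.

Lemma cos_scaled_cont k : continuous (fun s : R => cos (k * s)).
Proof. exact: is_derive_cont (is_derive_cos_scaled k). Qed.

Lemma tan_scaled_cont k : 0 < k < pi ->
  {in `[(- (1 / 2)), (1 / 2)], continuous (fun s : R => tan (k * s))}.
Proof.
move=> kP x; rewrite in_itv /= => /(is_derive_tan_scaled kP)[d _].
exact/differentiable_continuous/derivable1_diffP.
Qed.

Lemma cosV2_cont k : 0 < k < pi ->
  {in `[(- (1 / 2)), (1 / 2)], continuous (fun s : R => cos (k * s) ^- 2)}.
Proof.
move=> kP x; rewrite in_itv /= => xP; apply: cvgV; last exact: (contX (@cos_scaled_cont k)).
by rewrite expf_neq0 // gt_eqF // cos_gt0_half.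
Qed.

Lemma inD u v f G : {in `[u, v], continuous f} -> {in `[u, v], continuous G} ->
  {in `[u, v], continuous (fun x => f x + G x)}.
Proof. by move=> cf cg x xP; apply: cvgD; [exact: cf|exact: cg]. Qed.

Lemma inM u v f G : {in `[u, v], continuous f} -> {in `[u, v], continuous G} ->
  {in `[u, v], continuous (fun x => f x * G x)}.
Proof. by move=> cf cg x xP; apply: cvgM; [exact: cf|exact: cg]. Qed.

Lemma inS u v u' v' f : u <= u' -> v' <= v -> {in `[u, v], continuous f} ->
  {in `[u', v'], continuous f}.
Proof.
move=> uu vv cf x; rewrite in_itv /= => /andP[a b]; apply: cf.
by rewrite in_itv /= (le_trans uu a) (le_trans b vv).
Qed.

Lemma cosV2E k x : 0 < k < pi -> - (1 / 2) <= x <= 1 / 2 ->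
  cos (k * x) ^- 2 = 1 + tan (k * x) ^+ 2.
Proof.
move=> kP xP; have c0 := cos_gt0_half kP xP.
rewrite /tan expr_div_n -[1 in RHS](@divff _ (cos (k * x) ^+ 2)) ?expf_neq0 ?gt_eqF //.
by rewrite -mulrDl cos2Dsin2 mul1r.
Qed.

(** The substitution by which the lowest eigenvalue [pi ^ 2] enters: integrate the
    derivative of [tan (k x) m(x)], which vanishes at both ends. *)
Lemma int1_tan_shift k G m m' : 0 < k < pi -> continuous G -> continuous m' ->
  (forall x, is_derive (x : R) 1 m (m' x)) -> m (- (1 / 2)) = 0 -> m (1 / 2) = 0 ->
  int1 (- (1 / 2)) (1 / 2) (fun x => G x - k ^+ 2 * m x) =
  int1 (- (1 / 2)) (1 / 2)
    (fun x => G x + k * tan (k * x) * m' x + (k * tan (k * x)) ^+ 2 * m x).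
Proof.
move=> kP cG cm' dm m1 m2; have cm := is_derive_cont dm.
pose F x := k * (tan (k * x) * m x).
pose f x := k * (tan (k * x) * m' x + m x * (cos (k * x) ^- 2 * k)).
have cf : {in `[(- (1 / 2)), (1 / 2)], continuous f}.
  apply: inM; first exact/cont_in/cst_continuous.
  apply: inD.
    by apply: inM; [exact: tan_scaled_cont|exact: cont_in].
  apply: inM; first exact: cont_in.
  by apply: inM; [exact: cosV2_cont|exact/cont_in/cst_continuous].
have JF : int1 (- (1 / 2)) (1 / 2) f = 0.
  rewrite (_ : int1 _ _ _ = F (1 / 2) - F (- (1 / 2))).
    by rewrite /F m1 m2 !mulr0 subrr.
  apply: (@int1_FTC _ _ _ f F); [lra|exact: cf|].
  move=> x xP.
  by have := is_deriveZ k (is_deriveM (is_derive_tan_scaled kP xP) (dm x)); exact.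
have cL : continuous (fun x => G x - k ^+ 2 * m x).
  by apply: contB => //; apply: contM => //; exact: cst_continuous.
rewrite -[LHS]addr0 -JF -int1D; [|exact: cont_in|exact: cf].
apply: eq_int1 => x xP; rewrite /f cosV2E //; ring.
Qed.

(** The positivity hypothesis is used with [s = k tan (k x)]. It is a condition
    on [G], [m] and [m'], rather than on a function and its derivative, so that
    it covers the square moduli of a complex function and of its covariant
    derivative. *)
Lemma int1_pi2_le G m m' : continuous G -> continuous m' ->
  (forall x, is_derive (x : R) 1 m (m' x)) -> m (- (1 / 2)) = 0 -> m (1 / 2) = 0 ->
  (forall x s, - (1 / 2) <= x <= 1 / 2 -> 0 <= G x + s * m' x + s ^+ 2 * m x) ->
  0 <= int1 (- (1 / 2)) (1 / 2) (fun x => G x - pi ^+ 2 * m x).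
Proof.
move=> cG cm' dm m1 m2 pos; have cm := is_derive_cont dm.
have E k : int1 (- (1 / 2)) (1 / 2) (fun x => G x - k ^+ 2 * m x) =
    int1 (- (1 / 2)) (1 / 2) G - k ^+ 2 * int1 (- (1 / 2)) (1 / 2) m.
  rewrite int1B ?int1Z //; try exact: cont_in.
  by apply/cont_in/contM => //; exact: cst_continuous.
rewrite E; apply: (@limit_pi (fun k => int1 (- (1 / 2)) (1 / 2) G - k ^+ 2 * int1 (- (1 / 2)) (1 / 2) m)).
  apply: contB; first exact: cst_continuous.
  by apply: contM; [apply: contX; exact: cont_id|exact: cst_continuous].
move=> k kP; rewrite -E (int1_tan_shift kP cG cm' dm) //; apply: int1_ge0 => x xP.
exact: pos.
Qed.

(** On the right, the integrand becomes the square of [f' + k tan (k x) f],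
    which is [cos (k x)] times the derivative of [f / cos (k x)]; the
    Cauchy-Schwarz inequality bounds its integral below by the increment of
    [f / cos (k x)] from [x] to [y]. *)
Lemma two_point_k k f f' x y : 0 < k < pi -> continuous f' ->
  (forall x, is_derive (x : R) 1 f (f' x)) -> f (- (1 / 2)) = 0 -> f (1 / 2) = 0 ->
  - (1 / 2) <= x -> x <= y -> y <= 1 / 2 ->
  k * (f y * cos (k * x) - f x * cos (k * y)) ^+ 2 <=
  int1 (- (1 / 2)) (1 / 2) (fun x => f' x ^+ 2 - k ^+ 2 * f x ^+ 2).
Proof.
move=> kP cf' df f1 f2 x1 xy y2; have cf := is_derive_cont df.
have [k0 kpi] : 0 < k /\ k < pi by move: kP => /andP[].
have dm z : is_derive (z : R) 1 (fun s => f s ^+ 2) (2 * f z * f' z).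
  have := is_deriveM (df z) (df z); rewrite /GRing.scale /=.
  by rewrite (_ : f z * f' z + f z * f' z = 2 * f z * f' z) //; ring.
rewrite (@int1_tan_shift k (fun x => f' x ^+ 2) (fun s => f s ^+ 2) (fun z => 2 * f z * f' z)) //; last 4 first.
- exact: contX.
- by apply: contM => //; apply: contM => //; exact: cst_continuous.
- by rewrite f1 expr0n.
- by rewrite f2 expr0n.
pose S x := (f' x + k * tan (k * x) * f x) ^+ 2.
rewrite (@eq_int1 _ _ _ _ S); last by move=> z _; rewrite /S; ring.
have cT : {in `[(- (1 / 2)), (1 / 2)], continuous (fun x => f' x + k * tan (k * x) * f x)}.
  apply: inD; first exact: cont_in.
  apply: inM; last exact: cont_in.
  by apply: inM; [exact/cont_in/cst_continuous|exact: tan_scaled_cont].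
have cS : {in `[(- (1 / 2)), (1 / 2)], continuous S}.
  by apply: (@inM _ _ (fun x => f' x + k * tan (k * x) * f x)).
have S0 z : 0 <= S z by exact: sqr_ge0.
move: xy; rewrite le_eqVlt => /predU1P[->|xy].
  by rewrite subrr expr0n mulr0; exact: int1_ge0.
apply: le_trans (int1_sub x1 (ltW xy) y2 cS (fun z _ => S0 z)).
have cx : 0 < cos (k * x) by apply: cos_gt0_half => //; rewrite x1 /=; lra.
have cy : 0 < cos (k * y) by apply: cos_gt0_half => //; rewrite y2 andbT; lra.
have sxy : 0 < sin (k * (y - x)).
  by apply: sin_gt0_pi; apply/andP; split; nra.
set D := f y * cos (k * x) - f x * cos (k * y).
have TE : tan (k * y) - tan (k * x) = sin (k * (y - x)) / (cos (k * x) * cos (k * y)).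
  rewrite mulrBr sinB /tan; field; rewrite ?gt_eqF //.
(* The Cauchy-Schwarz inequality in the form [a ^ 2 >= 2 s a b - s ^ 2 b ^ 2],
   with [b = 1 / cos (k z)] and the optimal constant [s]. *)
pose s := k * D / sin (k * (y - x)).
pose H z := 2 * s * (f z / cos (k * z)) - s ^+ 2 / k * tan (k * z).
pose h z := 2 * s * ((f' z + k * tan (k * z) * f z) / cos (k * z)) - s ^+ 2 * cos (k * z) ^- 2.
have zP z : x <= z <= y -> - (1 / 2) <= z <= 1 / 2 by move=> /andP[a b]; apply/andP; split; lra.
have cV : {in `[x, y], continuous (fun z => (cos (k * z))^-1)}.
  move=> z; rewrite in_itv /= => /zP zP'; apply: cvgV; last exact: cos_scaled_cont.
  by rewrite gt_eqF // cos_gt0_half.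
have ch : {in `[x, y], continuous h}.
  have cc := inS x1 y2.
  apply: inD.
    apply: inM; first exact/cont_in/cst_continuous.
    by apply: inM => //; exact: cc.
  move=> z zP'; apply: cvgN; move: z zP'; apply: inM; first exact/cont_in/cst_continuous.
  by apply: cc; exact: cosV2_cont.
have JH : int1 x y h = H y - H x.
  apply: (@int1_FTC _ x y h H); [exact: ltW|exact: ch|].
  move=> z /zP zP'; have cz := cos_gt0_half kP zP'.
  have cz0 : cos (k * z) != 0 by rewrite gt_eqF.
  have dV := is_deriveV cz0 (is_derive_cos_scaled k z).
  have Hd := is_deriveB (is_deriveZ (2 * s) (is_deriveM (df z) dV))
    (is_deriveZ (s ^+ 2 / k) (is_derive_tan_scaled kP zP')).
  refine (@is_derive_eq _ _ _ H z 1 _ _ Hd _); rewrite /h.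
  rewrite /GRing.scale /= /tan; field; rewrite cz0 gt_eqF //.
have : int1 x y h <= int1 x y S.
  apply: int1_le => //; first exact: inS cS.
  move=> z /zP zP'; rewrite -subr_ge0.
  have cz := cos_gt0_half kP zP'.
  have -> : S z - h z = ((f' z + k * tan (k * z) * f z) - s / cos (k * z)) ^+ 2.
    rewrite /S /h; field; rewrite gt_eqF //.
  exact: sqr_ge0.
apply: le_trans; rewrite JH.
have -> : H y - H x = k * D ^+ 2 / (sin (k * (y - x)) * (cos (k * x) * cos (k * y))).
  have -> : H y - H x = 2 * s * (D / (cos (k * x) * cos (k * y))) - s ^+ 2 / k * (tan (k * y) - tan (k * x)).
    rewrite /H /D; field; rewrite !gt_eqF //.
  rewrite TE /s; field; rewrite !gt_eqF //.
rewrite ler_pdivlMr ?mulr_gt0 // ler_piMr //.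
by rewrite mulr_ge0 ?sqr_ge0 // ltW.
Qed.

(** Two-point form of the one-dimensional spectral gap: only multiples of
    [cos (pi x)] attain the bottom [pi ^ 2] of the Dirichlet spectrum, and the
    excess energy controls the distance to them. *)
Lemma two_point f f' x y : continuous f' ->
  (forall x, is_derive (x : R) 1 f (f' x)) -> f (- (1 / 2)) = 0 -> f (1 / 2) = 0 ->
  - (1 / 2) <= x <= 1 / 2 -> - (1 / 2) <= y <= 1 / 2 ->
  2 * (f y * cos (pi * x) - f x * cos (pi * y)) ^+ 2 <=
  int1 (- (1 / 2)) (1 / 2) (fun x => f' x ^+ 2 - pi ^+ 2 * f x ^+ 2).
Proof.
move=> cf' df f1 f2 xP yP.
have cf := is_derive_cont df.
wlog xy : x y xP yP / x <= y.
  move=> H; have /orP[xy|yx] := le_total x y; first exact: H.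
  by rewrite -sqrrN opprB; exact: H.
move: xP yP => /andP[x1 x2] /andP[y1 y2].
set D := _ - _.
apply: (@le_trans _ _ (pi * D ^+ 2)); first by rewrite ler_wpM2r ?sqr_ge0 ?pi_ge2.
rewrite -subr_ge0.
have E k : int1 (- (1 / 2)) (1 / 2) (fun x => f' x ^+ 2 - k ^+ 2 * f x ^+ 2) =
    int1 (- (1 / 2)) (1 / 2) (fun x => f' x ^+ 2) - k ^+ 2 * int1 (- (1 / 2)) (1 / 2) (fun x => f x ^+ 2).
  rewrite int1B ?int1Z //; try exact/cont_in/contX.
  by apply/cont_in/contM; [exact: cst_continuous|exact: contX].
rewrite E /D.
apply: (@limit_pi (fun k => int1 (- (1 / 2)) (1 / 2) (fun x => f' x ^+ 2)
  - k ^+ 2 * int1 (- (1 / 2)) (1 / 2) (fun x => f x ^+ 2)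
  - k * (f y * cos (k * x) - f x * cos (k * y)) ^+ 2)).
  have cid : continuous (fun k : R => k) by exact: cont_id.
  have cc z : continuous (fun k : R => cos (k * z)).
    by have := @cos_scaled_cont z; under eq_fun do rewrite mulrC.
  have cst c : continuous (fun _ : R => c : R) by exact: cst_continuous.
  apply: contB.
    by apply: contB => //; apply: contM => //; exact: contX.
  by apply: contM => //; apply: contX; apply: contB; apply: contM.
by move=> k kP; rewrite subr_ge0 -E; exact: two_point_k.
Qed.

End one_dimensional.

(** * The spectral gap of the square without field *)

Section two_dimensional.
Variable R : realType.
Implicit Types (v : R * R -> R).

Definition cos2 (x : R * R) : R := cos (pi * x.1) * cos (pi * x.2).

Lemma cos2_cont : continuous cos2.
Proof.
apply: contM; apply: (cont_comp _ (@cos_scaled_cont R pi)).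
  by apply: cont_fst; exact: cont_id.
by apply: cont_snd; exact: cont_id.
Qed.

Lemma int1_cos_sqr : int1 (- (1 / 2)) (1 / 2) (fun x : R => cos (pi * x) ^+ 2) = 1 / 2.
Proof.
have p0 : (pi : R) != 0 by rewrite gt_eqF // pi_gt0.
pose F (x : R) := 2^-1 * (x + pi^-1 * (sin (pi * x) * cos (pi * x))).
rewrite (_ : int1 _ _ _ = F (1 / 2) - F (- (1 / 2))).
  rewrite /F mulrN cosN (_ : pi * (1 / 2) = pi / 2); last by ring.
  rewrite cos_pihalf !mulr0; lra.
apply: (@int1_FTC _ _ _ (fun x => cos (pi * x) ^+ 2) F).
- by lra.
- by apply/cont_in/contX; exact: cos_scaled_cont.
- move=> x _.
  have H := is_deriveZ 2^-1 (is_deriveD (is_derive_id x 1)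
    (is_deriveZ pi^-1 (is_deriveM (is_derive_sin_scaled pi x) (is_derive_cos_scaled pi x)))).
  refine (@is_derive_eq _ _ _ F x 1 _ _ H _).
  rewrite /GRing.scale /=.
  have := cos2Dsin2 (pi * x); set c := cos _; set s := sin _ => E.
  have -> : pi^-1 * (s * (- s * pi) + c * (c * pi)) = (pi^-1 * pi) * (c ^+ 2 - s ^+ 2) by ring.
  rewrite mulVf // mul1r.
  lra.
Qed.

Lemma int2_cos2_sqr : int2 1 1 (fun x : R * R => cos2 x ^+ 2) = 4^-1.
Proof.
rewrite int2_fubini12; last exact: (contX cos2_cont).
rewrite (@eq_int1 _ _ _ _ (fun x : R => 2^-1 * cos (pi * x) ^+ 2)); last first.
  move=> x _; rewrite /cos2 /=.
  rewrite (@eq_int1 _ _ _ _ (fun y : R => cos (pi * x) ^+ 2 * cos (pi * y) ^+ 2)); last first.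
    by move=> y _; rewrite exprMn.
  rewrite int1Z; last by apply/cont_in/contX; exact: cos_scaled_cont.
  rewrite int1_cos_sqr; ring.
rewrite int1Z; last by apply/cont_in/contX; exact: cos_scaled_cont.
by rewrite int1_cos_sqr; field.
Qed.

Lemma int2_cst (c : R) : int2 1 1 (fun=> c) = c.
Proof.
rewrite int2_fubini12; last exact: cst_continuous.
rewrite (@eq_int1 _ _ _ _ (fun _ : R => c)); last by move=> x _; rewrite int1_cst; lra.
by rewrite int1_cst; lra.
Qed.

Let in1 (x : R * R) : rect 1 1 x ->
  - (1 / 2) <= x.1 <= 1 / 2 /\ - (1 / 2) <= x.2 <= 1 / 2.
Proof. by move=> [/andP[a b] /andP[c d]]; rewrite !ltW. Qed.

(** Poincare inequality with one exceptional direction, for a real function on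
    the unit square: join the two points [x] and [y] by a horizontal and a
    vertical segment, use [two_point] on each of them, and integrate over [x]
    and [y]. *)
Lemma gap_real v v1 v2 : continuous v -> continuous v1 -> continuous v2 ->
  (forall x, is_derive x (e1 R) v (v1 x)) -> (forall x, is_derive x (e2 R) v (v2 x)) ->
  (forall y, v (- (1 / 2), y) = 0 /\ v (1 / 2, y) = 0) ->
  (forall x, v (x, - (1 / 2)) = 0 /\ v (x, 1 / 2) = 0) ->
  2^-1 * int2 1 1 (fun x => v x ^+ 2) <=
  2 * int2 1 1 (fun x => cos2 x * v x) ^+ 2 +
  int2 1 1 (fun x => v1 x ^+ 2 + v2 x ^+ 2 - 2 * pi ^+ 2 * v x ^+ 2).
Proof.
move=> cv cv1 cv2 dv1 dv2 bd1 bd2.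
pose f1 x := v1 x ^+ 2 - pi ^+ 2 * v x ^+ 2.
pose f2 x := v2 x ^+ 2 - pi ^+ 2 * v x ^+ 2.
have cst c : continuous (fun _ : R * R => c : R) by exact: cst_continuous.
have cs : continuous (fun x => v x ^+ 2) by exact: contX.
have cf1 : continuous f1 by apply: contB; [exact: contX|exact: contM].
have cf2 : continuous f2 by apply: contB; [exact: contX|exact: contM].
pose E1 t := int1 (- (1 / 2)) (1 / 2) (fun s => f1 (s, t)).
pose E2 s := int1 (- (1 / 2)) (1 / 2) (fun t => f2 (s, t)).
have cE1 : continuous E1 := @int1_continuous _ _ _ _ (swap_arg_continuous cf1).
have cE2 : continuous E2 := @int1_continuous _ _ _ _ cf2.
have c1 : continuous (fun z : R * R => z.1) by apply: cont_fst; exact: cont_id.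
have c2 : continuous (fun z : R * R => z.2) by apply: cont_snd; exact: cont_id.
have IE1 : int2 1 1 (fun x => E1 x.2) = int2 1 1 f1.
  rewrite (int2_fubini21 _ _ (cont_comp c2 cE1)) (int2_fubini21 _ _ cf1) /=.
  by apply: eq_int1 => t _; rewrite int1_cst; [rewrite /E1; lra|lra].
have IE2 : int2 1 1 (fun x => E2 x.1) = int2 1 1 f2.
  rewrite (int2_fubini12 _ _ (cont_comp c1 cE2)) (int2_fubini12 _ _ cf2) /=.
  by apply: eq_int1 => t _; rewrite int1_cst; [rewrite /E2; lra|lra].
have H1 t x y : - (1 / 2) <= x <= 1 / 2 -> - (1 / 2) <= y <= 1 / 2 ->
    2 * (v (y, t) * cos (pi * x) - v (x, t) * cos (pi * y)) ^+ 2 <= E1 t.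
  apply: (@two_point _ (fun s => v (s, t)) (fun s => v1 (s, t))).
  - exact: slice1_continuous.
  - by move=> s; have /is_derive_e1P := dv1 (s, t).
  - by case: (bd1 t).
  - by case: (bd1 t).
have H2 s x y : - (1 / 2) <= x <= 1 / 2 -> - (1 / 2) <= y <= 1 / 2 ->
    2 * (v (s, y) * cos (pi * x) - v (s, x) * cos (pi * y)) ^+ 2 <= E2 s.
  apply: (@two_point _ (fun t => v (s, t)) (fun t => v2 (s, t))).
  - exact: slice2_continuous.
  - by move=> t; have /is_derive_e2P := dv2 (s, t).
  - by case: (bd2 s).
  - by case: (bd2 s).
have cos01 (x : R) : - (1 / 2) <= x <= 1 / 2 -> cos (pi * x) ^+ 2 <= 1.
  by move=> _; rewrite -[leRHS](cos2Dsin2 (pi * x)) lerDl sqr_ge0.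
have key x y : rect 1 1 x -> rect 1 1 y ->
    (v x * cos2 y - v y * cos2 x) ^+ 2 <= E1 x.2 + E2 y.1.
  case: x y => [x1 x2] [y1 y2] /in1 /= [X1 X2] /in1 /= [Y1 Y2].
  have := H1 x2 y1 x1 Y1 X1; have := H2 y1 y2 x2 Y2 X2.
  have := cos01 _ Y2; have := cos01 _ X1; rewrite /cos2 /=.
  set a := cos (pi * y2); set b := cos (pi * x1); set c := cos (pi * y1); set d := cos (pi * x2).
  move=> a1 b1 h2 h1.
  pose p := v (x1, x2) * c - v (y1, x2) * b; pose q := v (y1, x2) * a - v (y1, y2) * d.
  have -> : v (x1, x2) * (c * a) - v (y1, y2) * (b * d) = p * a + q * b by rewrite /p /q; ring.
  have P : 2 * p ^+ 2 <= E1 x2 by [].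
  have Q : 2 * q ^+ 2 <= E2 y1 by [].
  have : (p * a) ^+ 2 <= p ^+ 2 by rewrite exprMn ler_piMr ?sqr_ge0.
  have : (q * b) ^+ 2 <= q ^+ 2 by rewrite exprMn ler_piMr ?sqr_ge0.
  have : 0 <= (p * a - q * b) ^+ 2 by exact: sqr_ge0.
  rewrite sqrrB sqrrD; lra.
pose A := int2 1 1 (fun x => v x ^+ 2).
pose l := int2 1 1 (fun x => cos2 x * v x).
have ccv : continuous (fun x => cos2 x * v x) by apply: contM => //; exact: cos2_cont.
have ccc : continuous (fun x : R * R => cos2 x ^+ 2) by apply: contX; exact: cos2_cont.
have Key y : rect 1 1 y ->
    A * cos2 y ^+ 2 - 2 * l * (cos2 y * v y) + 4^-1 * v y ^+ 2 <= int2 1 1 f1 + E2 y.1.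
  move=> yS.
  have cL : continuous (fun x => v x * cos2 y - v y * cos2 x).
    by apply: contB; apply: contM => //; exact: cos2_cont.
  have cD : continuous (fun x : R * R => E1 x.2 + E2 y.1).
    by apply: contD => //; exact: (cont_comp c2 cE1).
  have := int2_le (contX (n := 2) cL) cD (fun x xS => key x y xS yS).
  rewrite int2D //; last exact: (cont_comp c2 cE1).
  rewrite IE1 int2_cst; apply: le_trans.
  rewrite le_eqVlt; apply/orP; left; apply/eqP.
  rewrite (@eq_int2 _ _ _ (fun x => (v x * cos2 y - v y * cos2 x) ^+ 2)
    (fun x => cos2 y ^+ 2 * v x ^+ 2 + (- (2 * v y * cos2 y)) * (cos2 x * v x)
      + v y ^+ 2 * cos2 x ^+ 2)); last by move=> x _; ring.
  rewrite int2D; [|by apply: contD; apply: contM|exact: contM].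
  rewrite int2D; [|exact: contM..].
  rewrite !int2Z // int2_cos2_sqr -/A -/l; ring.
have cL1 : continuous (fun y => A * cos2 y ^+ 2 - 2 * l * (cos2 y * v y)).
  by apply: contB; exact: contM.
have := int2_le (contD cL1 (contM (cst 4^-1) cs)) (contD (cst (int2 1 1 f1)) (cont_comp c1 cE2)) Key.
rewrite int2D //; last exact: contM.
rewrite int2B //; [|exact: contM..].
rewrite int2D //; last exact: (cont_comp c1 cE2).
rewrite !int2Z // int2_cst IE2 int2_cos2_sqr -/A -/l.
have -> : int2 1 1 (fun x => v1 x ^+ 2 + v2 x ^+ 2 - 2 * pi ^+ 2 * v x ^+ 2) = int2 1 1 f1 + int2 1 1 f2.
  by rewrite -int2D //; apply: eq_int2 => x _; rewrite /f1 /f2; ring.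
by rewrite expr2; lra.
Qed.

End two_dimensional.

(** * Minimization and the product bound for abstract forms *)

Section forms.
Variables (R : realType) (V : lmodType R) (W : V -> Prop).
Implicit Types (b : V -> V -> R) (u v w : V) (c : R).

Definition linear_subspace := (forall u v, W u -> W v -> W (u + v)) /\
  (forall c u, W u -> W (c *: u)).

(** The laws are required on [W] only: the forms below are integrals, which are
    bilinear on integrable functions. *)
Definition psd b := [/\
  forall u v w, W u -> W v -> W w -> b (u + v) w = b u w + b v w,
  forall c u w, W u -> W w -> b (c *: u) w = c * b u w,
  forall u v, W u -> W v -> b u v = b v u &
  forall u, W u -> 0 <= b u u].

Hypothesis subW : linear_subspace.

Lemma subspaceD u v : W u -> W v -> W (u + v). Proof. exact: subW.1. Qed.
Lemma subspaceZ c u : W u -> W (c *: u). Proof. exact: subW.2. Qed.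
Lemma subspaceN u : W u -> W (- u).
Proof. by move=> Wu; rewrite -scaleN1r; exact: subspaceZ. Qed.
Lemma subspaceB u v : W u -> W v -> W (u - v).
Proof. by move=> Wu Wv; apply: subspaceD => //; exact: subspaceN. Qed.

Lemma psd_sym b u v : psd b -> W u -> W v -> b u v = b v u.
Proof. by move=> [_ _ S _]; exact: S. Qed.

Lemma psd_ge0 b u : psd b -> W u -> 0 <= b u u.
Proof. by move=> [_ _ _ P]; exact: P. Qed.

Lemma psdDl b u v w : psd b -> W u -> W v -> W w -> b (u + v) w = b u w + b v w.
Proof. by move=> [D _ _ _]; exact: D. Qed.

Lemma psdZl b c u w : psd b -> W u -> W w -> b (c *: u) w = c * b u w.
Proof. by move=> [_ Z _ _]; exact: Z. Qed.

Lemma psdDr b u v w : psd b -> W u -> W v -> W w -> b w (u + v) = b w u + b w v.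
Proof.
move=> hb Wu Wv Ww; rewrite (psd_sym hb) ?psdDl ?(psd_sym (u := w)) //.
exact: subspaceD.
Qed.

Lemma psdZr b c u w : psd b -> W u -> W w -> b w (c *: u) = c * b w u.
Proof.
by move=> hb Wu Ww; rewrite (psd_sym hb) ?psdZl ?(psd_sym (u := w)) //; exact: subspaceZ.
Qed.

Lemma psdD2 b c u v : psd b -> W u -> W v ->
  b (u + c *: v) (u + c *: v) = b u u + 2 * c * b u v + c ^+ 2 * b v v.
Proof.
move=> hb Wu Wv; have Wc := subspaceZ c Wv.
rewrite psdDl ?psdDr ?psdZr ?psdZl //; try exact: subspaceD.
rewrite (psd_sym hb Wv Wu); ring.
Qed.

Lemma psdZ2 b c u : psd b -> W u -> b (c *: u) (c *: u) = c ^+ 2 * b u u.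
Proof.
move=> hb Wu; have Wc := subspaceZ c Wu.
by rewrite psdZl ?psdZr // mulrA expr2.
Qed.

Lemma psdB2 b u v : psd b -> W u -> W v ->
  b (u - v) (u - v) = b u u - 2 * b u v + b v v.
Proof. by move=> hb Wu Wv; rewrite -scaleN1r psdD2 //; ring. Qed.

Lemma psd_CS b u v : psd b -> W u -> W v -> b u v ^+ 2 <= b u u * b v v.
Proof.
move=> hb Wu Wv.
have h0 c : 0 <= b u u + 2 * c * b u v + c ^+ 2 * b v v.
  by rewrite -psdD2 //; apply: psd_ge0 => //; apply: subspaceD => //; exact: subspaceZ.
have u0 := psd_ge0 hb Wu; have v0 := psd_ge0 hb Wv.
have [v00|vn0] := eqVneq (b v v) 0.
  have E : b u v = 0.
    apply/eqP/negPn/negP => E.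
    have := h0 (- (b u u + 1) / (2 * b u v)).
    rewrite v00 mulr0 addr0 (_ : 2 * _ * _ = - (b u u + 1)); last by field.
    by lra.
  by rewrite E v00 expr0n mulr0.
have vp : 0 < b v v by rewrite lt_def vn0.
have := h0 (- b u v / b v v).
rewrite (_ : _ + _ = b u u - b u v ^+ 2 / b v v); last by field.
by rewrite subr_ge0 ler_pdivrMr.
Qed.

Lemma psd_CS_le b u v x y : psd b -> W u -> W v -> 0 <= x -> 0 <= y ->
  b u u <= x ^+ 2 -> b v v <= y ^+ 2 -> `|b u v| <= x * y.
Proof.
move=> hb Wu Wv x0 y0 ux vy.
rewrite -[x * y]ger0_norm ?mulr_ge0 // -ler_sqr ?nnegrE //.
rewrite !real_normK ?num_real // exprMn.
apply: le_trans (psd_CS hb Wu Wv) _.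
by apply: ler_pM => //; exact: psd_ge0.
Qed.

Lemma psd_parallelogram b u v : psd b -> W u -> W v ->
  b (u - v) (u - v) <= 2 * (b u u + b v v).
Proof.
move=> hb Wu Wv.
have := psd_ge0 hb (subspaceD Wu Wv); rewrite -[v in u + v]scale1r psdD2 // psdB2 //; lra.
Qed.

Lemma psd_lin b b' (c : R) : psd b -> psd b' -> 0 <= c -> psd (fun u v => b u v + c * b' u v).
Proof.
move=> [D1 Z1 S1 P1] [D2 Z2 S2 P2] c0; split.
- by move=> u v w Wu Wv Ww; rewrite D1 // D2 //; ring.
- by move=> k u w Wu Ww; rewrite Z1 // Z2 //; ring.
- by move=> u v Wu Wv; rewrite S1 // S2.
- by move=> u Wu; rewrite addr_ge0 ?P1 // mulr_ge0 ?P2.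
Qed.

Lemma psd_sub b b' (c : R) : psd b -> psd b' ->
  (forall u, W u -> c * b' u u <= b u u) -> psd (fun u v => b u v - c * b' u v).
Proof.
move=> [D1 Z1 S1 P1] [D2 Z2 S2 P2] c0; split.
- by move=> u v w Wu Wv Ww; rewrite D1 // D2 //; ring.
- by move=> k u w Wu Ww; rewrite Z1 // Z2 //; ring.
- by move=> u v Wu Wv; rewrite S1 // S2.
- by move=> u Wu; rewrite subr_ge0 c0.
Qed.

(** [J] plays the role of multiplication by the imaginary unit: a real form
    invariant under it is the real part of a Hermitian form. *)
Variable (J : V -> V).
Hypotheses (WJ : forall u, W u -> W (J u)) (JJ : forall u, W u -> J (J u) = - u)
  (JD : forall u v, W u -> W v -> J (u + v) = J u + J v)
  (JZ : forall c u, W u -> J (c *: u) = c *: J u).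

Definition Jinv b := forall u v, W u -> W v -> b (J u) (J v) = b u v.

Lemma psd_J0 b u : psd b -> Jinv b -> W u -> b u (J u) = 0.
Proof.
move=> hb iJ Wu; have WJu := WJ Wu; have := iJ _ _ Wu WJu.
rewrite JJ // -scaleN1r (psdZr _ hb Wu WJu) (psd_sym hb WJu Wu); lra.
Qed.

Lemma psd_complex b x y u : psd b -> Jinv b -> W u ->
  b (x *: u + y *: J u) (x *: u + y *: J u) = (x ^+ 2 + y ^+ 2) * b u u.
Proof.
move=> hb iJ Wu; have WJu := WJ Wu.
rewrite psdD2 //; last exact: subspaceZ.
by rewrite psdZ2 // iJ // psdZl // psd_J0 //; ring.
Qed.

Variables (N : V -> V -> R) (l : V -> R).
Hypotheses (pN : psd N) (NJ : Jinv N)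
  (lD : forall u v, W u -> W v -> l (u + v) = l u + l v)
  (lZ : forall c u, W u -> l (c *: u) = c * l u).

Section minimize.
Variables (q : V -> V -> R) (K : R) (w0 : V).
Hypotheses (pq : psd q) (qJ : Jinv q) (K0 : 0 < K)
  (gap : forall v, W v -> N v v <= 8 * (l v ^+ 2 + l (J v) ^+ 2) + K * q v v)
  (Ww0 : W w0) (Nw0 : 0 < N w0 w0) (qw0 : K * q w0 w0 <= 2^-1 * N w0 w0).

(** By the gap, [l] cannot be small along a minimizing sequence, so that its
    values can be normalized to 1: complex multiples of a vector have the same
    Rayleigh quotient, and one of them has [l u = 1] and [l (J u) = 0]. *)
Lemma minimizing_sequence : exists mu : R, [/\ 0 <= mu, K * mu <= 2^-1,
  mu * N w0 w0 <= q w0 w0,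
  (forall v, W v -> mu * N v v <= q v v) &
  exists u : nat -> V, forall n,
    [/\ W (u n), l (u n) = 1, l (J (u n)) = 0 & q (u n) (u n) - mu * N (u n) (u n) <= n.+1%:R^-1]].
Proof.
pose A := [set x | exists2 w, W w & 0 < N w w /\ x = q w w / N w w].
have A0 : A !=set0 by exists (q w0 w0 / N w0 w0), w0.
have lbA : lbound A 0.
  by move=> x [w Ww [Nw ->]]; rewrite divr_ge0 ?psd_ge0 // ltW.
have hiA : has_inf A by split => //; exists 0.
pose mu := inf A.
have mu0 : 0 <= mu by exact: lb_le_inf.
have muq v : W v -> mu * N v v <= q v v.
  move=> Wv; have : 0 <= N v v by exact: psd_ge0.
  rewrite le_eqVlt => /predU1P[<-|Nv]; first by rewrite mulr0 psd_ge0.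
  rewrite -ler_pdivlMr //; apply: ge_inf; first by exists 0.
  by exists v.
have Kmu : K * mu <= 2^-1.
  rewrite -(ler_pM2r Nw0) -mulrA; apply: le_trans qw0.
  by rewrite ler_pM2l // muq.
exists mu; split => //; first exact: muq.
suff H n : exists u, [/\ W u, l u = 1, l (J u) = 0 & q u u - mu * N u u <= n.+1%:R^-1].
  by exists (fun n => projT1 (cid (H n))) => n; case: (cid (H n)).
pose e : R := Num.min ((4 * K)^-1) ((32 * n.+1%:R)^-1).
have e0 : 0 < e by rewrite lt_min !invr_gt0 !mulr_gt0.
have e1 : K * e <= 4^-1.
  have : e <= (4 * K)^-1 by rewrite /e ge_min lexx.
  rewrite -(ler_pM2l K0) => /le_trans; apply.
  by rewrite invfM mulrCA mulfV ?gt_eqF // mulr1.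
have e2 : 32 * e <= n.+1%:R^-1.
  have : e <= (32 * n.+1%:R)^-1 by rewrite /e ge_min lexx orbT.
  by rewrite invfM; move: (n.+1%:R^-1) => a; lra.
have [x [w Ww [Nw ->]]] := inf_adherent e0 hiA.
rewrite ltr_pdivrMr // -/mu => qw.
pose L := l w ^+ 2 + l (J w) ^+ 2.
have LN : N w w <= 32 * L.
  have := gap Ww; rewrite -/L => g.
  have : K * q w w <= (2^-1 + 4^-1) * N w w.
    apply: (@le_trans _ _ (K * ((mu + e) * N w w))).
      by rewrite ler_pM2l // ltW.
    by rewrite mulrA mulrDr ler_pM2r // lerD.
  lra.
have L0 : 0 < L by lra.
pose u := (l w / L) *: w + (l (J w) / L) *: J w.
have WJw := WJ Ww.
have Wu : W u by apply: subspaceD; exact: subspaceZ.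
exists u; split => //.
- rewrite /u lD ?lZ //; try exact: subspaceZ.
  rewrite (_ : _ + _ = L / L) ?divff ?gt_eqF //.
  by rewrite /L; field; rewrite gt_eqF.
- rewrite /u JD ?JZ ?JJ //; try exact: subspaceZ.
  rewrite lD; try (by apply: subspaceZ => //; exact: subspaceN); try exact: subspaceZ.
  rewrite !lZ //; last exact: subspaceN.
  by rewrite -scaleN1r lZ //; field; rewrite gt_eqF.
- rewrite /u !psd_complex //.
  have -> : (l w / L) ^+ 2 + (l (J w) / L) ^+ 2 = L^-1.
    rewrite !expr_div_n -mulrDl -/L expr2 invfM mulrA divff ?mul1r // gt_eqF //.
  rewrite mulrCA -mulrBr ler_pdivrMl //.
  apply: le_trans (_ : e * N w w <= _); first by lra.
  have : e * N w w <= e * (32 * L) by rewrite ler_pM2l.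
  have : 32 * e * L <= n.+1%:R^-1 * L by rewrite ler_pM2r.
  by rewrite [L / _]mulrC; move: (n.+1%:R^-1) => a; lra.
Qed.

(** The parallelogram identity bounds the excess energy of [u - v], and the gap
    applies to [u - v] without the terms in [l]. *)
Lemma minimizing_cauchy mu u v e : 0 <= mu -> K * mu <= 2^-1 ->
  (forall v, W v -> mu * N v v <= q v v) ->
  W u -> W v -> l u = l v -> l (J u) = l (J v) ->
  q u u - mu * N u u <= e -> q v v - mu * N v v <= e ->
  N (u - v) (u - v) <= 8 * K * e /\ q (u - v) (u - v) <= 8 * e.
Proof.
move=> mu0 Kmu muq Wu Wv luv lJuv ue ve.
have Wd := subspaceB Wu Wv; have WJu := WJ Wu; have WJv := WJ Wv.
have ld : l (u - v) = 0 by rewrite -scaleN1r lD ?lZ ?luv //; [lra|exact: subspaceZ].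
have ldJ : l (J (u - v)) = 0.
  rewrite -scaleN1r JD ?JZ // ?lD ?lZ ?lJuv //; [lra|exact: subspaceZ|exact: subspaceZ].
have pE := psd_sub pq pN muq.
have := psd_parallelogram pE Wu Wv.
have := gap Wd; rewrite ld ldJ expr0n addr0 mulr0 add0r => g.
set n := N (u - v) (u - v) in g *; set x := q (u - v) (u - v) in g * => E.
have n0 : 0 <= n by exact: psd_ge0.
have Kn : K * mu * n <= 2^-1 * n by rewrite ler_wpM2r.
have E' : K * (x - mu * n) <= K * (4 * e) by rewrite ler_pM2l //; lra.
have n1 : n <= 8 * K * e by lra.
split => //.
have : mu * n <= mu * (8 * K * e) by rewrite ler_wpM2l.
have e0 : 0 <= e by apply: le_trans ue; rewrite subr_ge0 muq.
have : K * mu * (8 * e) <= 2^-1 * (8 * e) by rewrite ler_wpM2r // mulr_ge0.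
lra.
Qed.

End minimize.

Section product.
Variables (p1 p2 : V -> V -> R) (rot : V -> V) (mu c : R).
Hypotheses (pp1 : psd p1) (pp2 : psd p2) (p1J : Jinv p1) (p2J : Jinv p2)
  (Wrot : forall u, W u -> W (rot u))
  (Nrot : forall u, W u -> N (rot u) (rot u) = N u u)
  (p1rot : forall u, W u -> p1 (rot u) (rot u) = p2 u u)
  (p2rot : forall u, W u -> p2 (rot u) (rot u) = p1 u u)
  (lrot : forall u, W u -> l (rot u) = l u)
  (lJrot : forall u, W u -> l (J (rot u)) = l (J u)).
(* The coefficient 1 gives [p] the shape of the forms of [psd_lin]. *)
Let p u v := p1 u v + 1 * p2 u v.
Hypotheses (gap : forall v, W v -> N v v <= 8 * (l v ^+ 2 + l (J v) ^+ 2) + 6 * p v v)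
  (lN : forall v, W v -> l v ^+ 2 <= 4^-1 * N v v)
  (mu0 : 0 <= mu) (mu1 : mu <= 24^-1) (c4 : 4 <= c)
  (muq : forall v, W v -> mu * N v v <= p v v)
  (near_min : forall e, 0 < e -> exists u, [/\ W u, l u = 1, l (J u) = 0 & p u u - mu * N u u <= e]).

Let pp : psd p. Proof. exact: psd_lin. Qed.
Let E u v := p u v - mu * N u v.
Let pE : psd E. Proof. exact: psd_sub. Qed.
Let pJ : Jinv p. Proof. by move=> u v Wu Wv; rewrite /p p1J // p2J. Qed.
Let EJ : Jinv E. Proof. by move=> u v Wu Wv; rewrite /E pJ // NJ. Qed.

Let p1_le u : W u -> p1 u u <= p u u.
Proof. by move=> Wu; rewrite /p mul1r lerDl psd_ge0. Qed.

Let p_le_E v : W v -> l v = 0 -> l (J v) = 0 -> p v v <= 3^-1 * 4 * E v v.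
Proof.
move=> Wv lv lJv; have := gap Wv; rewrite lv lJv expr0n addr0 mulr0 add0r => g.
have n0 := psd_ge0 pN Wv.
have : mu * N v v <= 24^-1 * N v v by rewrite ler_wpM2r.
rewrite /E; lra.
Qed.

(** Write [w] as a complex multiple of an almost minimizer [u] plus a remainder
    [v] with [l v = 0]. The form [p] is of the order of [mu] at [u], and of the
    order of the excess energy [r ^ 2] at [v] because of the gap; the cross
    terms are of the order of [m r]. The contribution of [u] itself vanishes in
    the limit, since the turn exchanges [p1] and [p2] and moves [u] little. *)
Lemma imbalance_le w r m : W w -> N w w = 1 -> 0 <= r -> 0 <= m ->
  E w w = r ^+ 2 -> mu = m ^+ 2 ->
  `|p1 w w - p2 w w| <= 17 / 2 * m * r + 4 / 3 * r ^+ 2.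
Proof.
move=> Ww Nw r0 m0 Er mum.
(* The accuracy [e] of the almost minimizer tends to 0. *)
suff H e : 0 < e -> e <= 3^-1 -> `|p1 w w - p2 w w| <=
    4 * e + 17 / 5 * ((5 / 2 * m + e) * (r + e)) + 4 / 3 * (r + e) ^+ 2.
  pose C := 4 + 17 / 5 * (5 / 2 * m + r + 1) + 4 / 3 * (2 * r + 1).
  have C0 : 0 < C by rewrite /C; lra.
  apply/ler_addgt0Pr => d d0.
  pose e := Num.min 3^-1 (d / C).
  have e0 : 0 < e by rewrite lt_min divr_gt0 //; apply/andP; split => //; lra.
  have e3 : e <= 3^-1 by rewrite ge_min lexx.
  have ed : C * e <= d by rewrite mulrC -ler_pdivlMr // ge_min lexx orbT.
  apply: le_trans (H e e0 e3) _.
  apply: le_trans (_ : 17 / 2 * m * r + 4 / 3 * r ^+ 2 + C * e <= _); last by rewrite lerD2l.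
  rewrite -subr_ge0.
  have -> : 17 / 2 * m * r + 4 / 3 * r ^+ 2 + C * e - (4 * e + 17 / 5 * ((5 / 2 * m + e) * (r + e)) + 4 / 3 * (r + e) ^+ 2) =
    (17 / 5 + 4 / 3) * (e * (1 - e)) by rewrite /C; field.
  by apply: mulr_ge0; [lra|apply: mulr_ge0; lra].
move=> e0 e3.
have [u [Wu lu lJu Eu]] := near_min (exprn_gt0 2 e0).
have WJu := WJ Wu; have WJw := WJ Ww.
have ee : e ^+ 2 <= 3^-1 * 3^-1 by rewrite expr2 ler_pM // ltW.
have Nu0 := psd_ge0 pN Wu.
have mN : mu * N u u <= 24^-1 * N u u by rewrite ler_wpM2r.
have Nu : N u u <= 12.
  have := gap Wu; rewrite lu lJu expr0n expr1n addr0 mulr1 => g; lra.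
have pu : p u u <= 12 * mu + e ^+ 2.
  have : mu * N u u <= mu * 12 by rewrite ler_wpM2l.
  by lra.
have pu1 : p u u <= 1 ^+ 2 by rewrite expr1n; lra.
(* the component of [w] along the almost minimizer [u] *)
pose x := l w; pose y := - l (J w).
have xy : x ^+ 2 + y ^+ 2 <= 2^-1.
  have := lN Ww; have := lN WJw; rewrite NJ // Nw /x /y sqrrN; lra.
have xy0 : 0 <= x ^+ 2 + y ^+ 2 by rewrite addr_ge0 ?sqr_ge0.
pose au := x *: u + y *: J u.
have Wau : W au by apply: subspaceD; exact: subspaceZ.
pose v := w - au.
have Wv : W v by exact: subspaceB.
have lau : l au = l w by rewrite /au lD ?lZ ?lu ?lJu ?mulr0 ?addr0 ?mulr1 //; exact: subspaceZ.
have lJau : l (J au) = l (J w).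
  rewrite /au JD ?JZ ?JJ //; try exact: subspaceZ.
  rewrite lD ?lZ ?lJu //; try exact: subspaceZ; try exact: subspaceN.
    by rewrite -scaleN1r lZ // lu /y; ring.
  by apply: subspaceZ; exact: subspaceN.
have lv : l v = 0 by rewrite /v -scaleN1r lD ?lZ ?lau //; [ring|exact: subspaceZ].
have lJv : l (J v) = 0.
  rewrite /v -scaleN1r JD ?JZ //; last exact: subspaceZ.
  rewrite lD ?lZ ?lJau //; [ring|exact: WJ|by apply: subspaceZ; exact: WJ].
have Eau : E au au <= e ^+ 2.
  rewrite /au psd_complex //; have := psd_ge0 pE Wu => E0.
  have : (x ^+ 2 + y ^+ 2) * E u u <= 2^-1 * E u u by rewrite ler_wpM2r.
  by move: Eu; rewrite -/(E u u); lra.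
have pau : p au au <= (5 / 2 * m + e) ^+ 2.
  rewrite /au psd_complex //; have := psd_ge0 pp Wu => P0.
  have : (x ^+ 2 + y ^+ 2) * p u u <= 2^-1 * p u u by rewrite ler_wpM2r.
  have : 0 <= m * e by rewrite mulr_ge0 // ltW.
  have : 0 <= m ^+ 2 by rewrite sqr_ge0.
  have := sqr_ge0 e; move: pu; rewrite mum sqrrD exprMn; lra.
have Ev : E v v <= (r + e) ^+ 2.
  have := @psd_CS_le E w au r e pE Ww Wau r0 (ltW e0) _ Eau.
  rewrite Er lexx => /(_ isT); rewrite ler_norml => /andP[c1 c2].
  rewrite /v psdB2 // Er sqrrD; lra.
have re0 : 0 <= r + e by lra.
have pv : p v v <= 4 / 3 * (r + e) ^+ 2 by have := p_le_E Wv lv lJv; lra.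
(* by rotation the almost minimizer is almost balanced *)
have du : `|p1 u u - p2 u u| <= 7 * e.
  pose z := u - rot u; have Wr := Wrot Wu; have Wz : W z by exact: subspaceB.
  have lz : l z = 0 by rewrite /z -scaleN1r lD ?lZ ?lrot //; [ring|exact: subspaceZ].
  have lJz : l (J z) = 0.
    rewrite /z -scaleN1r JD ?JZ //; last exact: subspaceZ.
    rewrite lD ?lZ ?lJrot //; [ring|exact: WJ|by apply: subspaceZ; exact: WJ].
  have Ez : E z z <= 4 * e ^+ 2.
    have := psd_parallelogram pE Wu Wr; rewrite -/z.
    have -> : E (rot u) (rot u) = E u u by rewrite /E /p p1rot // p2rot // Nrot //; ring.
    by move: Eu; rewrite -/(E u u); lra.
  have pz : p z z <= 6 * e ^+ 2 by have := p_le_E Wz lz lJz; have := sqr_ge0 e; lra.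
  have p1z : p1 z z <= 6 * e ^+ 2 by apply: le_trans (p1_le Wz) pz.
  have cs : `|p1 u z| <= 1 * (5 / 2 * e).
    apply: (psd_CS_le pp1 Wu Wz) => //; first by lra.
    - exact: le_trans (p1_le Wu) pu1.
    - by apply: le_trans p1z _; rewrite exprMn; have := sqr_ge0 e; lra.
  have z0 := psd_ge0 pp1 Wz.
  have -> : p1 u u - p2 u u = 2 * p1 u z - p1 z z.
    have -> : p2 u u = p1 (u - z) (u - z) by rewrite /z opprB addrC subrK p1rot.
    rewrite psdB2 //; ring.
  have e2 : 6 * e ^+ 2 <= 2 * e.
    have : e * e <= e * 3^-1 by rewrite ler_pM2l.
    by rewrite expr2; lra.
  move: cs; rewrite !ler_norml => /andP[c1 c2]; apply/andP; split; lra.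
have cross : `|p1 au v - p2 au v| <= 17 / 10 * ((5 / 2 * m + e) * (r + e)).
  have me0 : 0 <= 5 / 2 * m + e by lra.
  have a0 := psd_ge0 pp1 Wau; have b0 := psd_ge0 pp2 Wau.
  have a1 := psd_ge0 pp1 Wv; have b1 := psd_ge0 pp2 Wv.
  have pv0 := psd_ge0 pp Wv.
  rewrite -[leRHS]ger0_norm; last by rewrite mulr_ge0 ?mulr_ge0.
  rewrite -ler_sqr ?nnegrE // !real_normK ?num_real //.
  have s1 := psd_CS pp1 Wau Wv; have s2 := psd_CS pp2 Wau Wv.
  have m1 : p1 au au * p1 v v + p2 au au * p2 v v <= p au au * p v v.
    have : 0 <= p1 au au * p2 v v by rewrite mulr_ge0.
    have : 0 <= p2 au au * p1 v v by rewrite mulr_ge0.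
    by rewrite /p; lra.
  have m2 : p au au * p v v <= (5 / 2 * m + e) ^+ 2 * (4 / 3 * (r + e) ^+ 2).
    by apply: ler_pM => //; exact: psd_ge0.
  have : 0 <= (p1 au v + p2 au v) ^+ 2 by exact: sqr_ge0.
  have T0 : 0 <= (5 / 2 * m + e) ^+ 2 * (r + e) ^+ 2 by rewrite mulr_ge0 ?sqr_ge0.
  rewrite !exprMn sqrrB sqrrD; lra.
have dau : `|p1 au au - p2 au au| <= 4 * e.
  rewrite /au !psd_complex // -mulrBr normrM (ger0_norm xy0).
  have : (x ^+ 2 + y ^+ 2) * `|p1 u u - p2 u u| <= 2^-1 * `|p1 u u - p2 u u| by rewrite ler_wpM2r.
  lra.
have dv : `|p1 v v - p2 v v| <= 4 / 3 * (r + e) ^+ 2.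
  have := psd_ge0 pp1 Wv; have := psd_ge0 pp2 Wv; move: pv; rewrite /p ler_norml => *.
  by apply/andP; split; lra.
have wE : w = au + 1 *: v by rewrite scale1r /v addrC subrK.
have Q1 : p1 w w = p1 au au + 2 * 1 * p1 au v + 1 ^+ 2 * p1 v v by rewrite [in LHS]wE psdD2.
have Q2 : p2 w w = p2 au au + 2 * 1 * p2 au v + 1 ^+ 2 * p2 v v by rewrite [in LHS]wE psdD2.
rewrite Q1 Q2.
move: dau cross dv; rewrite !ler_norml => /andP[a1 a2] /andP[b1 b2] /andP[d1 d2].
by apply/andP; split; lra.
Qed.

(** Four times a product is the square of the sum minus the square of the
    difference. The difference is bounded by [imbalance_le] if the excess energy
    [d] is at most 1, and by the sum [mu + d] otherwise. *)
Lemma energy_product_ge w : W w -> N w w = 1 ->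
  (2 * c + mu) ^+ 2 <= 4 * (p1 w w + c) * (p2 w w + c).
Proof.
move=> Ww Nw.
pose d := E w w; have d0 : 0 <= d by exact: psd_ge0.
have Ed : p1 w w + p2 w w = mu + d by rewrite /d /E /p Nw; ring.
have P1 := psd_ge0 pp1 Ww; have P2 := psd_ge0 pp2 Ww.
set i := p1 w w - p2 w w.
have -> : 4 * (p1 w w + c) * (p2 w w + c) = (2 * c + mu + d) ^+ 2 - i ^+ 2.
  by rewrite -addrA -Ed /i; ring.
suff : i ^+ 2 <= 2 * (2 * c + mu) * d + d ^+ 2 by rewrite [(_ + d) ^+ 2]sqrrD; lra.
have cd : 16 * d <= 2 * (2 * c + mu) * d.
  have c4' := c4; have mu0' := mu0.
  have : 0 <= (2 * (2 * c + mu) - 16) * d by apply: mulr_ge0 => //; lra.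
  by lra.
have c4' := c4; have mu0' := mu0; have mu1' := mu1.
have [d1|d1] := leP d 1; last first.
  have md0 : 0 <= mu + d by lra.
  have : i ^+ 2 <= (mu + d) ^+ 2.
    rewrite -(real_normK (num_real i)) ler_sqr ?nnegrE //.
    by rewrite ler_norml /i; apply/andP; split; lra.
  have mm : mu * mu <= 24^-1 * 24^-1 by rewrite ler_pM.
  have : mu * d <= 24^-1 * d by rewrite ler_pM2r //; lra.
  rewrite sqrrD expr2; lra.
have [r0 rE] : 0 <= Num.sqrt d /\ d = Num.sqrt d ^+ 2 by rewrite sqr_sqrtr.
have [m0 mE] : 0 <= Num.sqrt mu /\ mu = Num.sqrt mu ^+ 2 by rewrite sqr_sqrtr.
have := imbalance_le Ww Nw r0 m0 rE mE; rewrite -/i.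
set r := Num.sqrt d in r0 rE *; set m := Num.sqrt mu in m0 mE * => H.
have mr0 : 0 <= m * r by rewrite mulr_ge0.
have H2 : i ^+ 2 <= (17 / 2 * m * r + 4 / 3 * r ^+ 2) ^+ 2.
  rewrite -(real_normK (num_real i)) ler_sqr ?nnegrE //.
  by apply: le_trans H.
have H3 : (17 / 2 * m * r + 4 / 3 * r ^+ 2) ^+ 2 <= 2 * (289 / 4 * (mu * d)) + 2 * (16 / 9 * d ^+ 2).
  have := sqr_ge0 (17 / 2 * m * r - 4 / 3 * r ^+ 2); rewrite mE rE sqrrB sqrrD.
  have -> : (17 / 2 * m * r) ^+ 2 = 289 / 4 * (m ^+ 2 * r ^+ 2) by field.
  have -> : (4 / 3 * r ^+ 2) ^+ 2 = 16 / 9 * (r ^+ 2) ^+ 2 by field.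
  lra.
have : mu * d <= 24^-1 * d by rewrite ler_wpM2r.
have : d * d <= 1 * d by rewrite ler_wpM2r.
rewrite -expr2; lra.
Qed.

(** The point of the product bound: it is insensitive to the dilation that
    multiplies the two energies by [t^-1] and [t]. *)
Lemma dilated_energy_ge t w : 0 < t -> W w ->
  (2 * c + mu) * N w w <= t^-1 * (p1 w w + c * N w w) + t * (p2 w w + c * N w w).
Proof.
move=> t0 Ww.
have : 0 <= N w w by exact: psd_ge0.
have P1 := psd_ge0 pp1 Ww; have P2 := psd_ge0 pp2 Ww.
rewrite le_eqVlt => /predU1P[<-|Nw].
  by rewrite !mulr0 !addr0 addr_ge0 // mulr_ge0 // ?invr_ge0 ltW.
pose k := (Num.sqrt (N w w))^-1.
have k2 : k ^+ 2 = (N w w)^-1 by rewrite /k exprVn sqr_sqrtr // ltW.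
have Wk : W (k *: w) by exact: subspaceZ.
have Nk : N (k *: w) (k *: w) = 1 by rewrite psdZ2 // k2 mulVf // gt_eqF.
have := energy_product_ge Wk Nk; rewrite !psdZ2 // k2.
set n := N w w in Nw *; set x := p1 w w in P1 *; set y := p2 w w in P2 *.
move=> H.
set X := t^-1 * (n^-1 * x + c); set Y := t * (n^-1 * y + c).
have c4' := c4; have mu0' := mu0; have c0 : 0 <= c by lra.
have X0 : 0 <= X.
  by apply: mulr_ge0; rewrite ?invr_ge0 ?(ltW t0) // addr_ge0 // mulr_ge0 // invr_ge0 ltW.
have Y0 : 0 <= Y.
  by apply: mulr_ge0; rewrite ?(ltW t0) // addr_ge0 // mulr_ge0 // invr_ge0 ltW.
have XY : X * Y = (n^-1 * x + c) * (n^-1 * y + c).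
  by rewrite /X /Y; field; rewrite !gt_eqF.
have : 2 * c + mu <= X + Y.
  rewrite -ler_sqr ?nnegrE ?addr_ge0 //; [|by lra].
  apply: le_trans H _; have := sqr_ge0 (X - Y); rewrite -mulrA -XY sqrrB sqrrD; lra.
rewrite -(ler_pM2r Nw) => /le_trans; apply.
rewrite le_eqVlt; apply/orP; left; apply/eqP.
by rewrite /X /Y; field; rewrite !gt_eqF.
Qed.

End product.
End forms.

(** * Completeness of square integrable functions *)

Section square_integrable.
Context d (T : measurableType d) (R : realType) (mu : {measure set T -> \bar R}).
Variables (D : set T) (mD : measurable D) (fD : (mu D < +oo)%E).
Implicit Types f g : T -> R.

Definition sqi f := measurable_fun D f /\ (\int[mu]_(x in D) (f x ^+ 2)%:E < +oo)%E.

Definition sqn f : R := \int[mu]_(x in D) (f x ^+ 2).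

Lemma sqi_integrable f : sqi f -> mu.-integrable D (fun x => (f x ^+ 2)%:E).
Proof.
move=> [mf If]; apply/integrableP; split.
  by apply/measurable_EFinP; exact: measurable_funX.
by under eq_integral do rewrite /= ger0_norm ?sqr_ge0 //.
Qed.

Lemma sqi_mul_integrable f g : sqi f -> sqi g ->
  mu.-integrable D (EFin \o (fun x => f x * g x)).
Proof.
move=> sf sg.
apply: (@le_integrable _ _ _ _ _ mD _ (fun x => ((f x ^+ 2)%:E + (g x ^+ 2)%:E)%E)).
- by apply/measurable_EFinP; apply: measurable_funM; [exact: sf.1|exact: sg.1].
- move=> x _; rewrite /= lee_fin [leRHS]ger0_norm ?addr_ge0 ?sqr_ge0 //.
  have := sqr_ge0 (f x - g x); have := sqr_ge0 (f x + g x).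
  by rewrite sqrrB sqrrD ler_norml => *; apply/andP; split; lra.
- by apply: integrableD => //; exact: sqi_integrable.
Qed.

Lemma sqn_ge0 f : 0 <= sqn f.
Proof. by apply: Rintegral_ge0 => x _; exact: sqr_ge0. Qed.

Lemma sqnE f : sqi f -> (\int[mu]_(x in D) (f x ^+ 2)%:E)%E = (sqn f)%:E.
Proof.
move=> sf; rewrite /sqn /Rintegral fineK //.
exact: integrable_fin_num (sqi_integrable sf).
Qed.

Lemma sqi_dom f g g' : measurable_fun D f -> sqi g -> sqi g' ->
  (forall x, D x -> f x ^+ 2 <= g x ^+ 2 + g' x ^+ 2) -> sqi f.
Proof.
move=> mf sg sg' H; split => //.
have : mu.-integrable D (fun x => ((g x ^+ 2)%:E + (g' x ^+ 2)%:E)%E).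
  by apply: integrableD => //; exact: sqi_integrable.
move=> ig; have mf2 : measurable_fun D (fun x => (f x ^+ 2)%:E).
  by apply/measurable_EFinP; exact: measurable_funX.
have : mu.-integrable D (fun x => (f x ^+ 2)%:E).
  apply: (le_integrable mD mf2 _ ig) => x Dx.
  by rewrite /= lee_fin !ger0_norm ?addr_ge0 ?sqr_ge0 //; exact: H.
move=> /integrableP[_]; apply: le_lt_trans; rewrite le_eqVlt; apply/orP; left; apply/eqP.
by apply: eq_integral => x _; rewrite /= ger0_norm ?sqr_ge0.
Qed.

Lemma sqiZ c f : sqi f -> sqi (fun x => c * f x).
Proof.
move=> sf; split; first by apply: measurable_funM => //; exact: sf.1.
under eq_integral do rewrite exprMn EFinM.
rewrite ge0_integralZl_EFin ?sqr_ge0 //.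
- by rewrite sqnE // -EFinM ltry.
- by move=> x _; rewrite lee_fin sqr_ge0.
- by apply/measurable_EFinP; apply: measurable_funX; exact: sf.1.
Qed.

Lemma sqiD f g : sqi f -> sqi g -> sqi (fun x => f x + g x).
Proof.
move=> sf sg; apply: (@sqi_dom _ (fun x => 2 * f x) (fun x => 2 * g x)).
- by apply: measurable_funD; [exact: sf.1|exact: sg.1].
- exact: sqiZ.
- exact: sqiZ.
- move=> x _; have := sqr_ge0 (f x - g x); rewrite !exprMn sqrrB sqrrD => H.
  have := sqr_ge0 (f x); have := sqr_ge0 (g x); lra.
Qed.

Lemma sqiB f g : sqi f -> sqi g -> sqi (fun x => f x - g x).
Proof.
move=> sf sg; rewrite (_ : (fun x => _) = (fun x => f x + -1 * g x)).
  by apply: sqiD => //; exact: sqiZ.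
by apply/funext => x; rewrite mulN1r.
Qed.

Lemma sqn_eq0_ae f : sqi f -> sqn f = 0 -> {ae mu, forall x, D x -> f x = 0}.
Proof.
move=> sf f0; have := sqnE sf; rewrite f0 => I0.
have mf2 : measurable_fun D (fun x => (f x ^+ 2)%:E).
  by apply/measurable_EFinP; apply: measurable_funX; exact: sf.1.
have : (\int[mu]_(x in D) `|(f x ^+ 2)%:E| = 0)%E.
  by apply: etrans I0; apply: eq_integral => x _; rewrite /= ger0_norm ?sqr_ge0.
move=> /(ae_eq_integral_abs _ mD mf2).
apply: filterS => x /= H Dx; have := H Dx; move=> /eqP.
by rewrite eqe sqrf_eq0 => /eqP.
Qed.

Lemma ae_sqn0 f (P : T -> Prop) : measurable_fun D f -> (forall x, P x -> f x = 0) ->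
  {ae mu, forall x, D x -> P x} -> sqn f = 0.
Proof.
move=> mf Pf aeP.
have E : (\int[mu]_(x in D) (f x ^+ 2)%:E = \int[mu]_(x in D) (cst 0%E) x)%E.
  apply: ae_eq_integral => //.
  - by apply/measurable_EFinP; exact: measurable_funX.
  - by move: aeP; apply: filterS => x H Dx; rewrite Pf ?expr0n //; exact: H.
by rewrite /sqn /Rintegral E integral0.
Qed.

Section complete.
Variable f : nat -> T -> R.
Hypotheses (sf : forall n, sqi (f n))
  (cauchy : forall e : R, 0 < e -> exists N : nat, forall n m, (N <= n)%N -> (N <= m)%N ->
     sqn (fun x => f n x - f m x) <= e).

Let pow4 (k : nat) : (0 : R) < 4^-1 ^+ k.
Proof. by rewrite exprn_gt0 // invr_gt0. Qed.

Let N (k : nat) : nat := projT1 (cid (cauchy (pow4 k))).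

Let NP k n m : (N k <= n)%N -> (N k <= m)%N -> sqn (fun x => f n x - f m x) <= 4^-1 ^+ k.
Proof. by rewrite /N; case: cid => /= a; apply. Qed.

Let idx k : nat := (\sum_(i < k.+1) N i + k)%N.
Let idxN k : (N k <= idx k)%N.
Proof. by rewrite /idx big_ord_recr /= -addnA (addnC (N k)) addnA leq_addl. Qed.
Let idxS k : (N k <= idx k.+1)%N.
Proof.
by rewrite /idx big_ord_recr big_ord_recr /= -!addnA (leq_trans _ (leq_addl _ _)) // leq_addr.
Qed.
Let idx_ge k : (k <= idx k)%N. Proof. exact: leq_addl. Qed.

Let g k := f (idx k).
Let del k x := `|g k.+1 x - g k x|.
Let M : R := fine (mu D).

Let mdel k : measurable_fun D (fun x => (del k x)%:E).
Proof.
apply/measurable_EFinP; apply: measurableT_comp => //.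
by apply: measurable_funB; exact: (sf _).1.
Qed.

Let muD : mu D = M%:E. Proof. by rewrite /M fineK // ge0_fin_numE. Qed.

Let int_del k : (\int[mu]_(x in D) (del k x)%:E <= (2^-1 ^+ k * (1 + M))%:E)%E.
Proof.
have sd : sqi (fun x => g k.+1 x - g k x) by exact: (sqiB (sf _) (sf _)).
have e2 : (0 : R) < 2 ^+ k by rewrite exprn_gt0.
apply: (@le_trans _ _ (\int[mu]_(x in D)
    ((2 ^+ k)%:E * ((g k.+1 x - g k x) ^+ 2)%:E + (2^-1 ^+ k)%:E))%E).
  apply: ge0_le_integral => //.
  - by move=> x _; rewrite lee_fin normr_ge0.
  - apply: emeasurable_funD => //.
    by apply: emeasurable_funM => //; exact: measurable_int (sqi_integrable sd).
  - move=> x _; rewrite /del -EFinM -EFinD lee_fin.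
    set y := g k.+1 x - g k x.
    have : 0 <= (2 ^+ k * `|y| - 1) ^+ 2 by exact: sqr_ge0.
    rewrite sqrrB expr1n mulr1 exprMn real_normK ?num_real // => H.
    have e2' : (0 : R) < 2^-1 ^+ k by rewrite exprn_gt0 // invr_gt0.
    have E : 2 ^+ k * 2^-1 ^+ k = 1 :> R by rewrite -exprMn divff // expr1n.
    have : 0 <= 2^-1 ^+ k * ((2 ^+ k) ^+ 2 * y ^+ 2 - 2 ^+ k * `|y| *+ 2 + 1).
      by rewrite mulr_ge0 // ltW.
    have -> : 2^-1 ^+ k * ((2 ^+ k) ^+ 2 * y ^+ 2 - 2 ^+ k * `|y| *+ 2 + 1) =
      (2 ^+ k * 2^-1 ^+ k) * (2 ^+ k * y ^+ 2) - (2 ^+ k * 2^-1 ^+ k) * `|y| *+ 2 + 2^-1 ^+ k by ring.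
    rewrite E !mul1r => {}H; have := normr_ge0 y; lra.
have mz : measurable_fun D (fun x => ((g k.+1 x - g k x) ^+ 2)%:E).
  exact: measurable_int (sqi_integrable sd).
have my : measurable_fun D (fun x => ((2 ^+ k)%:E * ((g k.+1 x - g k x) ^+ 2)%:E)%E).
  exact: emeasurable_funM.
have y0 x : D x -> (0 <= (2 ^+ k)%:E * ((g k.+1 x - g k x) ^+ 2)%:E)%E.
  by move=> _; rewrite -EFinM lee_fin mulr_ge0 ?sqr_ge0 // ltW.
have c0 x : D x -> (0 <= (2^-1 ^+ k : R)%:E)%E.
  by move=> _; rewrite lee_fin exprn_ge0 // invr_ge0.
have z0 x : D x -> (0 <= ((g k.+1 x - g k x) ^+ 2)%:E)%E by rewrite lee_fin sqr_ge0.
rewrite (ge0_integralD mu mD y0 my c0 (measurable_cst _)).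
rewrite (ge0_integralZl_EFin mu mD z0 mz (ltW e2)).
rewrite integral_cst // muD sqnE // -!EFinM -EFinD lee_fin mulrDr mulr1.
rewrite lerD2r.
have := NP (idxS k) (idxN k); rewrite -/(g k) -/(g k.+1) => H.
apply: (@le_trans _ _ (2 ^+ k * 4^-1 ^+ k)); first by rewrite ler_pM2l.
by rewrite -exprMn (_ : 2 * 4^-1 = 2^-1 :> R) //; field.
Qed.

Let S x := (\sum_(0 <= k <oo) (del k x)%:E)%E.

Let S_int : mu.-integrable D S.
Proof.
have mS : measurable_fun D S.
  apply: ge0_emeasurable_sum => // k x _; by rewrite lee_fin normr_ge0.
apply/integrableP; split => //.
rewrite (eq_integral S); last first.
  by move=> x _; rewrite gee0_abs //; apply: nneseries_ge0 => k _; rewrite lee_fin normr_ge0.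
rewrite integral_nneseries //; last by move=> k x _; rewrite lee_fin normr_ge0.
apply: (@le_lt_trans _ _ (2 * (1 + M))%:E); last exact: ltry.
apply: lime_le.
  by apply: is_cvg_nneseries => k _ _; apply: integral_ge0 => x _; rewrite lee_fin normr_ge0.
apply: nearW => n.
have M0 : 0 <= M by rewrite /M fine_ge0.
apply: (@le_trans _ _ (\sum_(0 <= k < n) (2^-1 ^+ k * (1 + M))%:E)%E).
  by apply: lee_sum => k _; exact: int_del.
rewrite sumEFin lee_fin -mulr_suml ler_pM2r ?ltr_pwDl //.
have -> : \sum_(0 <= i < n) 2^-1 ^+ i = 2 - 2 * 2^-1 ^+ n :> R.
  elim: n => [|n IH]; first by rewrite big_geq // expr0 mulr1 subrr.
  by rewrite big_nat_recr //= IH exprS; field.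
have : (0 : R) <= 2^-1 ^+ n by rewrite exprn_ge0 // invr_ge0.
lra.
Qed.

Let good x := cvgn (fun k => g k x).

Let good_ae : {ae mu, forall x, D x -> good x}.
Proof.
have := integrable_ae mD S_int; apply: filterS => x H Dx; have {H} := H Dx.
move=> Sfin; rewrite /good.
have bound n : \sum_(0 <= k < n) del k x <= fine (S x).
  rewrite -lee_fin fineK // -sumEFin.
  by apply: nneseries_lim_ge => k _ _; rewrite lee_fin normr_ge0.
have c1 : cvgn [normed series (fun k => g k.+1 x - g k x)].
  apply: nondecreasing_is_cvgn.
    by apply: nondecreasing_series => n _ _; exact: normr_ge0.
  by exists (fine (S x)) => _ [n _ <-]; exact: bound.
have := normed_cvg c1.
have -> : (fun k => g k x) =
    (fun k => g 0 x + series (fun k => g k.+1 x - g k x) k).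
  apply/funext => k; rewrite /series /= telescope_sumr //; ring.
by move=> c2; apply: is_cvgD => //; exact: is_cvg_cst.
Qed.

(** A subsequence whose increments have norm at most [2 ^ - k] converges almost
    everywhere, and the Fatou lemma makes the pointwise limit a limit in norm. *)
Lemma sqi_complete : exists h, sqi h /\
  forall e : R, 0 < e -> exists N : nat, forall n, (N <= n)%N -> sqn (fun x => f n x - h x) <= e.
Proof.
pose h x := fine (limn_esup (fun k => (g k x)%:E)).
have mh : measurable_fun D h.
  apply: (measurableT_comp (f := fine)) => //.
  apply: measurable_fun_limn_esup => k.
  by apply/measurable_EFinP; exact: (sf _).1.
have hE x : good x -> (fun k => g k x) @ \oo --> h x.
  move=> gx; have cE : (fun k => (g k x)%:E) @ \oo --> (limn (fun k => g k x))%:E.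
    exact: (cvg_comp _ _ gx).
  by rewrite /h (cvg_limn_einf_sup cE).2.
have key e n : (forall m, (n <= m)%N -> sqn (fun x => f m x - f n x) <= e) ->
    (\int[mu]_(x in D) ((f n x - h x) ^+ 2)%:E <= e%:E)%E.
  move=> He.
  have mk k : measurable_fun D (fun x => ((g k x - f n x) ^+ 2)%:E).
    by apply/measurable_EFinP; apply: measurable_funX; apply: measurable_funB; exact: (sf _).1.
  have mn : measurable_fun D (fun x => ((f n x - h x) ^+ 2)%:E).
    by apply/measurable_EFinP; apply: measurable_funX; apply: measurable_funB => //; exact: (sf _).1.
  have F := @fatou _ _ _ mu D mD (fun k x => ((g k x - f n x) ^+ 2)%:E) mk
    (fun k x _ => sqr_ge0 _).
  have mi : measurable_fun D (fun x => limn_einf (fun k => ((g k x - f n x) ^+ 2)%:E)).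
    rewrite (_ : (fun x => _) = (fun x => (- limn_esup (fun k => (- ((g k x - f n x) ^+ 2)%:E)))%E)).
      apply: measurableT_comp => //; apply: measurable_fun_limn_esup => k.
      exact: measurableT_comp.
    by apply/funext => x; rewrite -limn_einfN; congr limn_einf; apply/funext => k /=; rewrite opprK.
  apply: (@le_trans _ _ (\int[mu]_(x in D) limn_einf (fun k => ((g k x - f n x) ^+ 2)%:E))%E).
    apply: ae_ge0_le_integral => //.
    - by move=> x _; rewrite lee_fin sqr_ge0.
    - move=> x _; rewrite limn_einf_lim; apply: lime_ge; first exact: is_cvg_einfs.
      by apply: nearW => k; apply: le_ereal_inf_tmp => _ [j _ <-]; rewrite lee_fin sqr_ge0.
    - move: good_ae; apply: filterS => x Hx Dx.
      have c : (fun k => ((g k x - f n x) ^+ 2)%:E) @ \oo --> ((h x - f n x) ^+ 2)%:E.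
        apply: cvg_EFin; first by apply: nearW.
        apply: (@cvg_comp _ _ _ (fun k => g k x - f n x) (fun y => y ^+ 2) _ (nbhs (h x - f n x))).
          by apply: cvgB; [exact: hE (Hx Dx)|exact: cvg_cst].
        exact: exprn_continuous.
      by rewrite (cvg_limn_einf_sup c).1 -sqrrN opprB.
  apply: le_trans F _.
  rewrite limn_einf_lim; apply: lime_le; first exact: is_cvg_einfs.
  near=> k.
  apply: (@le_trans _ _ (\int[mu]_(x in D) ((g k x - f n x) ^+ 2)%:E)%E).
    by apply: ereal_inf_lbound; exists k => /=.
  rewrite sqnE; last exact: (sqiB (sf _) (sf _)).
  rewrite lee_fin; apply: He; apply: leq_trans (idx_ge k).
  by near: k; exact: nbhs_infty_ge.
have [N1 HN1] := cauchy ltr01.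
have s1 : sqi (fun x => f N1 x - h x).
  split; first by apply: measurable_funB => //; exact: (sf _).1.
  apply: le_lt_trans (key 1 N1 _) (ltry _).
  by move=> m Nm; exact: HN1.
exists h; split.
  rewrite (_ : h = (fun x => f N1 x - (f N1 x - h x))); last by apply/funext => x; ring.
  exact: sqiB.
move=> e e0; have [N2 HN2] := cauchy e0; exists N2 => n Nn.
have sn : sqi (fun x => f n x - h x).
  rewrite (_ : (fun x => _) = (fun x => (f n x - f N1 x) + (f N1 x - h x))); last by apply/funext => x; ring.
  by apply: sqiD => //; exact: sqiB.
rewrite -lee_fin -sqnE //; apply: key => m nm; apply: HN2 => //.
exact: leq_trans nm.
Unshelve. all: by end_near. Qed.

End complete.
End square_integrable.

(** * Square integrable complex functions *)

Section fields.
Local Open Scope complex_scope.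
Variable R : realType.
Local Notation V := (R * R -> R * R).
Implicit Types (u v g h : R * R -> R * R) (c : R).

(** Complex functions are handled as functions into the real plane, so that they
    form a real vector space carrying real bilinear forms. *)
Definition cpx u : R * R -> R[i] := fun x => (u x).1 +i* (u x).2.

Definition rpx (f : R * R -> R[i]) : V := fun x => (complex.Re (f x), complex.Im (f x)).

Lemma rpxK f : cpx (rpx f) = f.
Proof. by apply/funext => x; rewrite /cpx /rpx /=; case: (f x). Qed.

Definition imul u : V := fun x => (- (u x).2, (u x).1).

Lemma fD1 u v x : ((u + v) x).1 = (u x).1 + (v x).1. Proof. by []. Qed.
Lemma fD2 u v x : ((u + v) x).2 = (u x).2 + (v x).2. Proof. by []. Qed.
Lemma fN1 u x : ((- u) x).1 = - (u x).1. Proof. by []. Qed.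
Lemma fN2 u x : ((- u) x).2 = - (u x).2. Proof. by []. Qed.
Lemma fZ1 c u x : ((c *: u) x).1 = c * (u x).1. Proof. by []. Qed.
Lemma fZ2 c u x : ((c *: u) x).2 = c * (u x).2. Proof. by []. Qed.
Definition fE := (fD1, fD2, fN1, fN2, fZ1, fZ2).

Lemma field_ext u v : (forall x, (u x).1 = (v x).1) -> (forall x, (u x).2 = (v x).2) -> u = v.
Proof.
by move=> H1 H2; apply/funext => x; have := H1 x; have := H2 x;
   case: (u x) => a b; case: (v x) => a' b' /= -> ->.
Qed.

Lemma iimul u : imul (imul u) = - u.
Proof. by apply: field_ext. Qed.

Lemma imulD u v : imul (u + v) = imul u + imul v.
Proof. by apply: field_ext => x //=; rewrite opprD. Qed.

Lemma imulB u v : imul (u - v) = imul u - imul v.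
Proof. by apply: field_ext => x //=; rewrite opprD. Qed.

Lemma imulZ c u : imul (c *: u) = c *: imul u.
Proof. by apply: field_ext => x //=; rewrite [RHS]mulrN. Qed.

(** The covariant derivative [g - i A u], in real coordinates. *)
Definition cov (A : R * R -> R) u g : V :=
  fun x => ((g x).1 + A x * (u x).2, (g x).2 - A x * (u x).1).

Lemma mderivE (A : R * R -> R) u g : mderiv A (cpx u) (cpx g) = cpx (cov A u g).
Proof.
by apply/funext => x; apply/eqP; rewrite eq_complex /=; apply/andP; split; apply/eqP; ring.
Qed.

Lemma covD A u v g h : cov A (u + v) (g + h) = cov A u g + cov A v h.
Proof. by apply: field_ext => x; rewrite /cov /=; ring. Qed.

Lemma covZ A c u g : cov A (c *: u) (c *: g) = c *: cov A u g.
Proof. by apply: field_ext => x; rewrite /cov /= /GRing.scale /=; ring. Qed.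

Lemma covB A u v g h : cov A (u - v) (g - h) = cov A u g - cov A v h.
Proof. by apply: field_ext => x; rewrite /cov /=; ring. Qed.

Lemma cov_imul A u g : cov A (imul u) (imul g) = imul (cov A u g).
Proof. by apply: field_ext => x; rewrite /cov /imul /=; ring. Qed.

Section L2.
Variables (a b : R).
Local Notation Om := (rect a b).
Let mOm : measurable (Om : set (measurableTypeR R * measurableTypeR R)).
Proof. exact: measurable_rect. Qed.
Let bnd (h : R * R -> R) : continuous h -> exists M, forall x, Om x -> `|h x| <= M.
Proof.
move=> ch; have [M HM] := continuous_rect_bounded a b ch; exists M => x [/andP[x1 x2] /andP[y1 y2]].
by apply: HM; rewrite /= in_itv /=; apply/andP; split; exact: ltW.
Qed.
Local Notation sq := (@sqi _ _ R (@leb2 R) Om).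

Definition L2f u := sq (fun x => (u x).1) /\ sq (fun x => (u x).2).

(** The real part of the complex inner product. *)
Definition ip u v : R := Rintegral (@leb2 R) Om (fun x => (u x).1 * (v x).1 + (u x).2 * (v x).2).

Lemma ip_integrable u v : L2f u -> L2f v ->
  (@leb2 R).-integrable Om (EFin \o (fun x => (u x).1 * (v x).1 + (u x).2 * (v x).2)).
Proof.
move=> [u1 u2] [v1 v2].
have := integrableD mOm (sqi_mul_integrable mOm u1 v1) (sqi_mul_integrable mOm u2 v2).
by apply: eq_integrable => // x _ /=.
Qed.

Lemma ipE u v : L2f u -> L2f v -> ip u v =
  Rintegral (@leb2 R) Om (fun x => (u x).1 * (v x).1) +
  Rintegral (@leb2 R) Om (fun x => (u x).2 * (v x).2).
Proof.
by move=> [u1 u2] [v1 v2]; rewrite /ip RintegralD //; exact: sqi_mul_integrable.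
Qed.

Lemma ip_sqn u : L2f u -> ip u u =
  sqn (@leb2 R) Om (fun x => (u x).1) + sqn (@leb2 R) Om (fun x => (u x).2).
Proof. by move=> su; rewrite ipE // /sqn; congr (_ + _); apply: eq_Rintegral => x _; rewrite expr2. Qed.

Lemma normL2sqE u : L2f u -> normL2sq Om (cpx u) = (ip u u)%:E.
Proof.
move=> su; have [u1 u2] := su; rewrite ip_sqn // EFinD -!sqnE // /normL2sq /=.
under eq_integral do rewrite EFinD.
rewrite ge0_integralD //.
- by move=> x _; rewrite lee_fin sqr_ge0.
- by apply/measurable_EFinP; apply: measurable_funX; exact: u1.1.
- by move=> x _; rewrite lee_fin sqr_ge0.
- by apply/measurable_EFinP; apply: measurable_funX; exact: u2.1.
Qed.

Lemma L2P u : L2 Om (cpx u) <-> L2f u.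
Proof.
split.
  move=> [m1 m2 I].
  have le1 (k : R * R -> R) : measurable_fun Om k ->
      (forall x, k x ^+ 2 <= (u x).1 ^+ 2 + (u x).2 ^+ 2) -> sq k.
    move=> mk H; split => //; apply: le_lt_trans I; apply: ge0_le_integral => //.
    - by move=> x _; rewrite lee_fin sqr_ge0.
    - by apply/measurable_EFinP; exact: measurable_funX.
    - by apply/measurable_EFinP; apply: measurable_funD; exact: measurable_funX.
    - by move=> x _; rewrite lee_fin; exact: H.
  split; apply: le1 => // x; rewrite ?lerDl ?lerDr sqr_ge0 //.
move=> su; have [u1 u2] := su; split; [exact: u1.1|exact: u2.1|].
by rewrite normL2sqE // ltry.
Qed.

Lemma L2f_subspace : linear_subspace L2f.
Proof.
by split=> [u v [u1 u2] [v1 v2]|c u [u1 u2]]; split; [exact: sqiD|exact: sqiD|exact: sqiZ|exact: sqiZ].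
Qed.

Lemma L2f_imul u : L2f u -> L2f (imul u).
Proof.
move=> [u1 u2]; split => //=.
by rewrite (_ : (fun x => _) = (fun x => -1 * (u x).2)); [exact: sqiZ|apply/funext => x; rewrite mulN1r].
Qed.

Lemma ip_psd : psd L2f ip.
Proof.
split.
- move=> u v w su sv sw; rewrite /ip -RintegralD //; try exact: ip_integrable.
  by apply: eq_Rintegral => x _; rewrite !fE; ring.
- move=> c u w su sw; rewrite /ip -RintegralZl //; try exact: ip_integrable.
  by apply: eq_Rintegral => x _; rewrite !fE; ring.
- by move=> u v _ _; apply: eq_Rintegral => x _; ring.
- by move=> u _; apply: Rintegral_ge0 => x _; rewrite -!expr2 addr_ge0 ?sqr_ge0.
Qed.

Lemma ip_imul u v : ip (imul u) (imul v) = ip u v.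
Proof. by apply: eq_Rintegral => x _ /=; ring. Qed.

Lemma innerL2E u v : innerL2 Om (cpx u) (cpx v) = ip u v +i* ip u (imul v).
Proof.
by congr Complex; apply: eq_Rintegral => x _ /=; ring.
Qed.

Definition cvL2 (un : nat -> V) u := ip (un n - u) (un n - u) @[n --> \oo] --> (0 : R).

Lemma cvL2P (un : nat -> V) u : (forall e : R, 0 < e -> exists N : nat, forall n, (N <= n)%N ->
  ip (un n - u) (un n - u) <= e) -> (forall n, L2f (un n)) -> L2f u -> cvL2 un u.
Proof.
move=> H sn su; apply/cvgrPdist_le => e e0; have [N HN] := H e e0.
exists N => // n /= Nn; rewrite sub0r normrN ger0_norm; first exact: HN.
by apply: (psd_ge0 ip_psd) ; exact: (subspaceB L2f_subspace).
Qed.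

Let sub0 (un : nat -> V) u v : (forall n, L2f (un n)) -> L2f u -> L2f v -> cvL2 un u ->
  ip (un n - u) v @[n --> \oo] --> (0 : R).
Proof.
move=> sn su sv cu.
have H : Num.sqrt (ip (un n - u) (un n - u) * ip v v) @[n --> \oo] --> (0 : R).
  rewrite -[X in _ --> X]sqrtr0 -[X in Num.sqrt X](mul0r (ip v v)).
  apply: (@cvg_comp _ _ _ (fun n => ip (un n - u) (un n - u) * ip v v) Num.sqrt _ (nbhs (0 * ip v v))).
    by apply: cvgM => //; exact: cvg_cst.
  exact: sqrt_continuous.
apply: norm_cvg0; apply: (@squeeze_cvgr _ _ _ _ (cst 0) _ _ _ _ _ H); last exact: cvg_cst.
apply: nearW => n; rewrite normr_ge0 /= -sqrtr_sqr ler_sqrt.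
  by apply: (psd_CS L2f_subspace ip_psd) => // ; exact: (subspaceB L2f_subspace).
by rewrite mulr_ge0 //; apply: (psd_ge0 ip_psd) => // ; exact: (subspaceB L2f_subspace).
Qed.

Lemma ip_cvg_l (un : nat -> V) u v : (forall n, L2f (un n)) -> L2f u -> L2f v -> cvL2 un u ->
  ip (un n) v @[n --> \oo] --> ip u v.
Proof.
move=> sn su sv cu; apply: cvg_zero.
apply: cvg_trans (sub0 sn su sv cu); apply: near_eq_cvg; apply: nearW => n /=.
have Ss := L2f_subspace.
rewrite -scaleN1r (psdDl ip_psd) ?(psdZl _ ip_psd) ?mulN1r //.
exact: (subspaceZ Ss).
Qed.

Lemma ip_cvg_sq (un : nat -> V) u : (forall n, L2f (un n)) -> L2f u -> cvL2 un u ->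
  ip (un n) (un n) @[n --> \oo] --> ip u u.
Proof.
move=> sn su cu.
have E n : ip (un n) (un n) = ip (un n - u) (un n - u) + 2 * ip (un n) u - ip u u.
  by rewrite (psdB2 L2f_subspace ip_psd) //; ring.
have -> : ip u u = 0 + 2 * ip u u - ip u u by ring.
apply: cvg_trans (_ : ip (un n - u) (un n - u) + 2 * ip (un n) u - ip u u @[n --> \oo] --> _).
  by apply: near_eq_cvg; apply: nearW => n; rewrite -E.
apply: cvgB; last exact: cvg_cst.
apply: cvgD => //; apply: cvgM; first exact: cvg_cst.
exact: ip_cvg_l.
Qed.

Lemma L2f_complete (un : nat -> V) : (forall n, L2f (un n)) ->
  (forall e : R, 0 < e -> exists N : nat, forall n m, (N <= n)%N -> (N <= m)%N ->
     ip (un n - un m) (un n - un m) <= e) -> exists2 u, L2f u & cvL2 un u.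
Proof.
move=> sn C.
have fOm := leb2_rect_lty a b.
have sB n m : L2f (un n - un m) by exact: (subspaceB L2f_subspace).
have C1 (e : R) : 0 < e -> exists N : nat, forall n m, (N <= n)%N -> (N <= m)%N ->
     sqn (@leb2 R) Om (fun x => (un n x).1 - (un m x).1) <= e.
  move=> /C [N HN]; exists N => n m Nn Nm; have := HN n m Nn Nm; rewrite ip_sqn //.
  by apply: le_trans; rewrite lerDl sqn_ge0.
have C2 (e : R) : 0 < e -> exists N : nat, forall n m, (N <= n)%N -> (N <= m)%N ->
     sqn (@leb2 R) Om (fun x => (un n x).2 - (un m x).2) <= e.
  move=> /C [N HN]; exists N => n m Nn Nm; have := HN n m Nn Nm; rewrite ip_sqn //.
  by apply: le_trans; rewrite lerDr sqn_ge0.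
have [h1 [sh1 c1]] := sqi_complete mOm fOm (fun n => (sn n).1) C1.
have [h2 [sh2 c2]] := sqi_complete mOm fOm (fun n => (sn n).2) C2.
exists (fun x => (h1 x, h2 x)); first by split.
apply: cvL2P => // e e0.
have e2 : 0 < e / 2 by rewrite divr_gt0.
have [N1 H1] := c1 _ e2; have [N2 H2] := c2 _ e2.
exists (maxn N1 N2) => n; rewrite geq_max => /andP[n1 n2].
rewrite ip_sqn; last by exact: (subspaceB L2f_subspace).
by have := H1 n n1; have := H2 n n2; lra.
Qed.

Lemma cov_L2f A u g : continuous A -> L2f u -> L2f g -> L2f (cov A u g).
Proof.
move=> cA [u1 u2] [g1 g2]; have [M HM] := bnd cA.
have mA : measurable_fun Om A by apply: measurable_funTS; exact: continuous_plane_measurable.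
have sAu (f : R * R -> R) : sq f -> sq (fun x => A x * f x).
  move=> sf; apply: (@sqi_dom _ _ _ _ _ mOm _ (fun x => M * f x) (fun x => M * f x)).
  - by apply: measurable_funM => //; exact: sf.1.
  - exact: sqiZ.
  - exact: sqiZ.
  - move=> x /HM AM; rewrite !exprMn.
    have M0 : 0 <= M by apply: le_trans AM.
    have : A x ^+ 2 * f x ^+ 2 <= M ^+ 2 * f x ^+ 2.
      by rewrite ler_wpM2r ?sqr_ge0 // -(real_normK (num_real (A x))) ler_sqr.
    have : 0 <= M ^+ 2 * f x ^+ 2 by rewrite mulr_ge0 ?sqr_ge0.
    lra.
split => /=; first by apply: sqiD => //; exact: sAu.
by apply: sqiB => //; exact: sAu.
Qed.

(** The potential is bounded on the rectangle, so that the gradient and the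
    covariant gradient control each other up to the norm of the function. *)
Lemma cov_bound A : continuous A -> exists2 M : R, 0 <= M & forall u g, L2f u -> L2f g ->
  ip (cov A u g) (cov A u g) <= 2 * (ip g g + M * ip u u) /\
  ip g g <= 2 * (ip (cov A u g) (cov A u g) + M * ip u u).
Proof.
move=> cA; have [M HM] := bnd cA.
exists (M ^+ 2); first exact: sqr_ge0.
move=> u g su sg; have sc := cov_L2f cA su sg.
have Ax x : Om x -> A x ^+ 2 <= M ^+ 2.
  move=> /HM AM; have M0 : 0 <= M by apply: le_trans AM.
  by rewrite -(real_normK (num_real (A x))) ler_sqr.
have comb v w : L2f v -> L2f w ->
    ip v v + M ^+ 2 * ip w w =
    Rintegral (@leb2 R) Om (fun x => ((v x).1 * (v x).1 + (v x).2 * (v x).2) +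
      M ^+ 2 * ((w x).1 * (w x).1 + (w x).2 * (w x).2)).
  move=> sv sw; rewrite RintegralD ?RintegralZl //; try exact: ip_integrable.
  have := integrableZl mOm (M ^+ 2) (ip_integrable sw sw).
  by apply: eq_integrable => // x _ /=.
have int v w : L2f v -> L2f w -> (@leb2 R).-integrable Om (EFin \o (fun x =>
    2 * (((v x).1 * (v x).1 + (v x).2 * (v x).2) +
      M ^+ 2 * ((w x).1 * (w x).1 + (w x).2 * (w x).2)))).
  move=> sv sw; have := integrableZl mOm (M ^+ 2) (ip_integrable sw sw).
  move=> /(integrableD mOm (ip_integrable sv sv)) /(integrableZl mOm 2).
  by apply: eq_integrable => // x _ /=.
have tw v w : L2f v -> L2f w -> 2 * (ip v v + M ^+ 2 * ip w w) =
    Rintegral (@leb2 R) Om (fun x => 2 * (((v x).1 * (v x).1 + (v x).2 * (v x).2) +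
      M ^+ 2 * ((w x).1 * (w x).1 + (w x).2 * (w x).2))).
  move=> sv sw; rewrite comb // RintegralZl //.
  have := integrableZl mOm (M ^+ 2) (ip_integrable sw sw).
  move=> /(integrableD mOm (ip_integrable sv sv)).
  by apply: eq_integrable => // x _ /=.
have ineq (s A' y : R) : A' ^+ 2 <= M ^+ 2 -> (s + A' * y) ^+ 2 <= 2 * (s ^+ 2 + M ^+ 2 * y ^+ 2).
  move=> HA; have : A' ^+ 2 * y ^+ 2 <= M ^+ 2 * y ^+ 2 by rewrite ler_wpM2r ?sqr_ge0.
  by have := sqr_ge0 (s - A' * y); rewrite sqrrB sqrrD exprMn; lra.
rewrite !tw //; split; apply: le_Rintegral => //; try exact: ip_integrable; try exact: int.
- move=> x /Ax HA; rewrite /cov /= -!expr2.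
  have := ineq (g x).1 _ (u x).2 HA; have := ineq (g x).2 (- A x) (u x).1.
  by rewrite sqrrN => /(_ HA); rewrite mulNr; lra.
- move=> x /Ax HA; rewrite /cov /= -!expr2.
  have := ineq ((g x).2 - A x * (u x).1) _ (u x).1 HA.
  have := ineq ((g x).1 + A x * (u x).2) (- A x) (u x).2.
  rewrite sqrrN => /(_ HA).
  by rewrite subrK mulNr addrK; lra.
Qed.

Lemma cov_cvL2 A (un gn : nat -> V) u g : continuous A -> (forall n, L2f (un n)) -> L2f u ->
  (forall n, L2f (gn n)) -> L2f g -> cvL2 un u -> cvL2 gn g ->
  cvL2 (fun n => cov A (un n) (gn n)) (cov A u g).
Proof.
move=> cA sn su tn sg cu cg; have [M M0 HM] := cov_bound cA.
have Ss := L2f_subspace.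
have H : 2 * (ip (gn n - g) (gn n - g) + M * ip (un n - u) (un n - u)) @[n --> \oo] --> (0 : R).
  rewrite (_ : 0 = 2 * (0 + M * 0)); last by ring.
  apply: cvgM; first exact: cvg_cst.
  by apply: cvgD => //; apply: cvgM => //; exact: cvg_cst.
apply: (@squeeze_cvgr _ _ _ _ (cst 0) _ _ _ _ _ H); last exact: cvg_cst.
apply: nearW => n; rewrite -covB.
have su' : L2f (un n - u) by exact: (subspaceB Ss).
have sg' : L2f (gn n - g) by exact: (subspaceB Ss).
apply/andP; split; last by case: (HM _ _ su' sg').
by apply: (psd_ge0 ip_psd); exact: cov_L2f.
Qed.

End L2.
End fields.

(** * Test functions and weak derivatives *)

Section test_functions.
Local Open Scope complex_scope.
Variable R : realType.
Local Notation V := (R * R -> R * R).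
Implicit Types (u v w g h : R * R -> R * R) (c : R).

Definition pdv (e : R * R) u : V :=
  fun x => ('D_e (fun y => (u y).1) x, 'D_e (fun y => (u y).2) x).

Lemma pderivCE e u : pderivC e (cpx u) = cpx (pdv e u).
Proof. by []. Qed.

Lemma pdv_imul e u : smooth (fun x => (u x).2) -> e = e1 R \/ e = e2 R ->
  pdv e (imul u) = imul (pdv e u).
Proof.
move=> s2 He; apply: field_ext => x //=.
by have [_] := is_deriveN (Ck_is_derive x He (s2 1)).
Qed.

Variables (a b : R).
Hypotheses (a0 : 0 < a) (b0 : 0 < b).
Local Notation Om := (rect a b).

Definition tst u := test_function Om (cpx u).

Lemma cpx_eq0 u x : cpx u x = 0 <-> u x = 0.
Proof.
rewrite /cpx; case: (u x) => p q /=; split; first by case=> -> ->.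
by case=> -> ->.
Qed.

Lemma tst_smooth1 u : tst u -> smooth (fun x => (u x).1). Proof. by case. Qed.
Lemma tst_smooth2 u : tst u -> smooth (fun x => (u x).2). Proof. by case. Qed.

Lemma tst_out u x : tst u -> ~ Om x -> u x = 0.
Proof.
move=> [_ _ _ sub] nx; apply/cpx_eq0; apply/not_notP => /= ux.
by apply: nx; apply: sub; exact: subset_closure.
Qed.

(** The support of [w] lies in the union of the supports of [u] and [v]. *)
Lemma tst_dom u v w : tst u -> tst v -> smooth (fun x => (w x).1) ->
  smooth (fun x => (w x).2) -> (forall x, u x = 0 -> v x = 0 -> w x = 0) -> tst w.
Proof.
move=> [_ _ cu su] [_ _ cv sv] w1 w2 H.
have sub : closure [set x | cpx w x <> 0] `<=`
    closure [set x | cpx u x <> 0] `|` closure [set x | cpx v x <> 0].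
  rewrite -closureU; apply: closureS => x /= wx.
  have [ux|ux] := pselect (cpx u x = 0); last by left.
  right => vx; apply: wx; apply/cpx_eq0; apply: H; exact/cpx_eq0.
split => //.
- apply: subclosed_compact sub; first exact: closed_closure.
  exact: compactU.
- by move=> x /sub [/su|/sv].
Qed.

Lemma smoothD (f f' : R * R -> R) : smooth f -> smooth f' -> smooth (fun x => f x + f' x).
Proof. by move=> sf sf' k; exact: CkD. Qed.

Lemma smoothM (f f' : R * R -> R) : smooth f -> smooth f' -> smooth (fun x => f x * f' x).
Proof. by move=> sf sf' k; exact: CkM. Qed.

Lemma smooth_cst c : smooth (fun _ : R * R => c).
Proof. by move=> k; exact: Ck_cst. Qed.

Lemma smoothN (f : R * R -> R) : smooth f -> smooth (fun x => - f x).
Proof.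
move=> sf; rewrite (_ : (fun x => _) = (fun x => -1 * f x)).
  by apply: smoothM => //; exact: smooth_cst.
by apply/funext => x; rewrite mulN1r.
Qed.

Lemma tst_subspace : linear_subspace tst.
Proof.
split=> [u v tu tv|c u tu].
  apply: (tst_dom tu tv) => [||x ux vx].
  - by apply: smoothD; exact: tst_smooth1.
  - by apply: smoothD; exact: tst_smooth2.
  - by rewrite /GRing.add /= ux vx addr0.
apply: (tst_dom tu tu) => [||x ux _].
- by apply: (@smoothM (fun=> c)); [exact: smooth_cst|exact: tst_smooth1].
- by apply: (@smoothM (fun=> c)); [exact: smooth_cst|exact: tst_smooth2].
- by rewrite /GRing.scale /= ux scaler0.
Qed.

Lemma tst_imul u : tst u -> tst (imul u).
Proof.
move=> tu; apply: (tst_dom tu tu) => [||x ux _] /=.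
- by apply: smoothN; exact: tst_smooth2.
- exact: tst_smooth1.
- by rewrite /imul ux /= oppr0.
Qed.

Definition conjf u : V := fun x => ((u x).1, - (u x).2).

Lemma tst_conjf u : tst u -> tst (conjf u).
Proof.
move=> tu; apply: (tst_dom tu tu) => [||x ux _] /=.
- exact: tst_smooth1.
- by apply: smoothN; exact: tst_smooth2.
- by rewrite /conjf ux /= oppr0.
Qed.

Lemma tst_is_derive1 u e x : tst u -> e = e1 R \/ e = e2 R ->
  is_derive x e (fun y => (u y).1) (pdv e u x).1.
Proof. by move=> tu He; exact: Ck_is_derive (tst_smooth1 tu 1). Qed.

Lemma tst_is_derive2 u e x : tst u -> e = e1 R \/ e = e2 R ->
  is_derive x e (fun y => (u y).2) (pdv e u x).2.
Proof. by move=> tu He; exact: Ck_is_derive (tst_smooth2 tu 1). Qed.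

Lemma pdvD e u v : e = e1 R \/ e = e2 R -> tst u -> tst v -> pdv e (u + v) = pdv e u + pdv e v.
Proof.
move=> He tu tv; apply: field_ext => x /=.
  by have [_] := is_deriveD (tst_is_derive1 x tu He) (tst_is_derive1 x tv He).
by have [_] := is_deriveD (tst_is_derive2 x tu He) (tst_is_derive2 x tv He).
Qed.

Lemma pdvZ e c u : e = e1 R \/ e = e2 R -> tst u -> pdv e (c *: u) = c *: pdv e u.
Proof.
move=> He tu; apply: field_ext => x /=.
  by have [_] := is_deriveZ c (tst_is_derive1 x tu He).
by have [_] := is_deriveZ c (tst_is_derive2 x tu He).
Qed.

Lemma pdvB e u v : e = e1 R \/ e = e2 R -> tst u -> tst v -> pdv e (u - v) = pdv e u - pdv e v.
Proof.
move=> He tu tv; have tN : tst (-1 *: v) by exact: (subspaceZ tst_subspace).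
by rewrite -scaleN1r pdvD // pdvZ // scaleN1r.
Qed.

Lemma pdv_conjf e u : e = e1 R \/ e = e2 R -> tst u -> pdv e (conjf u) = conjf (pdv e u).
Proof.
move=> He tu; apply: field_ext => x //=.
by have [_] := is_deriveN (tst_is_derive2 x tu He).
Qed.

Lemma continuous_sqi (f : R * R -> R) : continuous f -> @sqi _ _ R (@leb2 R) Om f.
Proof.
move=> cf; split.
  by apply: measurable_funTS; exact: continuous_plane_measurable.
have := continuous_rect_integrable a b (contX (n := 2) cf).
move=> /integrableP[_]; apply: le_lt_trans; rewrite le_eqVlt; apply/orP; left; apply/eqP.
by apply: eq_integral => x _; rewrite /= ger0_norm ?sqr_ge0.
Qed.

Lemma tst_L2f u : tst u -> L2f a b u.
Proof.
move=> tu; split; apply: continuous_sqi.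
  exact: Ck_continuous (tst_smooth1 tu 0).
exact: Ck_continuous (tst_smooth2 tu 0).
Qed.

Lemma pdv_L2f e u : e = e1 R \/ e = e2 R -> tst u -> L2f a b (pdv e u).
Proof.
move=> He tu; split; apply: continuous_sqi => /=.
  exact: Ck_continuous (smooth_derive He (tst_smooth1 tu) 0).
exact: Ck_continuous (smooth_derive He (tst_smooth2 tu) 0).
Qed.

Lemma int2_derive_eq0 e (h : R * R -> R) : e = e1 R \/ e = e2 R -> smooth h ->
  (forall x, ~ Om x -> h x = 0) -> int2 a b (fun x => 'D_e h x) = 0.
Proof.
move=> He sh h0.
have cd := Ck_continuous (smooth_derive He sh 0).
have a0' := a0; have b0' := b0.
have a2 : - (a / 2) <= a / 2 by lra.
have b2 : - (b / 2) <= b / 2 by lra.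
case: He cd => -> cd.
  rewrite (int2_fubini21 _ _ cd) (@eq_int1 _ _ _ _ (fun=> 0)); first by rewrite int1_cst ?mul0r.
  move=> y _; rewrite (_ : int1 _ _ _ = h (a / 2, y) - h (- (a / 2), y)).
    rewrite !h0 ?subrr // => -[/= /andP[]]; rewrite ltxx //.
  apply: (@int1_FTC _ _ _ (fun x => 'D_(e1 R) h (x, y)) (fun x => h (x, y))) => //.
    exact/cont_in/(slice1_continuous (y := y) cd).
  move=> x _; have := Ck_is_derive (x, y) (or_introl erefl) (sh 1).
  by move=> /is_derive_e1P.
rewrite (int2_fubini12 _ _ cd) (@eq_int1 _ _ _ _ (fun=> 0)); first by rewrite int1_cst ?mul0r.
move=> x _; rewrite (_ : int1 _ _ _ = h (x, b / 2) - h (x, - (b / 2))).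
  rewrite !h0 ?subrr // => -[_ /= /andP[]]; rewrite ltxx //.
apply: (@int1_FTC _ _ _ (fun y => 'D_(e2 R) h (x, y)) (fun y => h (x, y))) => //.
  exact/cont_in/(slice2_continuous (x := x) cd).
move=> y _; have := Ck_is_derive (x, y) (or_intror erefl) (sh 1).
by move=> /is_derive_e2P.
Qed.

Lemma ip_parts e u v : e = e1 R \/ e = e2 R -> tst u -> tst v ->
  ip a b u (pdv e v) = - ip a b (pdv e u) v.
Proof.
move=> He tu tv; apply/eqP; rewrite -addr_eq0; apply/eqP.
pose h x := (u x).1 * (v x).1 + (u x).2 * (v x).2.
have sh : smooth h.
  apply: smoothD; apply: smoothM; [exact: tst_smooth1|exact: tst_smooth1|exact: tst_smooth2|exact: tst_smooth2].
have h0 x : ~ Om x -> h x = 0 by move=> nx; rewrite /h (tst_out tu nx) /= !mul0r addr0.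
rewrite -(int2_derive_eq0 He sh h0) /ip -RintegralD; last 3 first.
- exact: measurable_rect.
- exact: (ip_integrable (tst_L2f tu) (pdv_L2f He tv)).
- exact: (ip_integrable (pdv_L2f He tu) (tst_L2f tv)).
apply: eq_Rintegral => x _.
have [_ ->] := is_deriveD (is_deriveM (tst_is_derive1 x tu He) (tst_is_derive1 x tv He))
  (is_deriveM (tst_is_derive2 x tu He) (tst_is_derive2 x tv He)).
by rewrite /GRing.scale /=; ring.
Qed.

(** The pairing in the definition of weak derivatives is complex bilinear; its
    real and imaginary parts are real inner products with the conjugate test
    function and with [i] times it. *)
Lemma weak_pderivP e u g : e = e1 R \/ e = e2 R -> L2f a b u -> L2f a b g ->
  (forall v, tst v -> ip a b u (pdv e v) = - ip a b g v) ->
  weak_pderiv Om e (cpx u) (cpx g).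
Proof.
move=> He su sg H phi; rewrite -(rpxK phi); set v := rpx phi => tv.
have tc := tst_conjf tv; have ti := tst_imul tc.
have E1 := H _ tc; have E2 := H _ ti.
rewrite pdv_imul // in E2; last exact: tst_smooth2 tc.
rewrite !pdv_conjf // in E1 E2.
rewrite pderivCE.
have -> : integralC Om (fun x => cpx u x * cpx (pdv e v) x) =
    ip a b u (conjf (pdv e v)) +i* ip a b u (imul (conjf (pdv e v))).
  by congr Complex; apply: eq_Rintegral => x _ /=; ring.
have -> : integralC Om (fun x => cpx g x * cpx v x) =
    ip a b g (conjf v) +i* ip a b g (imul (conjf v)).
  by congr Complex; apply: eq_Rintegral => x _ /=; ring.
by rewrite E1 E2.
Qed.

End test_functions.

(** * Ground states from minimizing sequences *)

Section ground_state.
Local Open Scope complex_scope.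
Variable R : realType.
Local Notation V := (R * R -> R * R).
Implicit Types (u v w g h : R * R -> R * R) (c : R).
Variables (a b : R) (A : R * R -> R * R).
Hypotheses (a0 : 0 < a) (b0 : 0 < b)
  (cA1 : continuous (fun x => (A x).1)) (cA2 : continuous (fun x => (A x).2)).
Local Notation Om := (rect a b).
Local Notation ip := (ip a b).
Local Notation L2f := (L2f a b).
Local Notation tst := (tst a b).
Local Notation cvL2 := (cvL2 a b).
Local Notation A1 := (fun x => (A x).1).
Local Notation A2 := (fun x => (A x).2).

Let He1 : e1 R = e1 R \/ e1 R = e2 R. Proof. by left. Qed.
Let He2 : e2 R = e1 R \/ e2 R = e2 R. Proof. by right. Qed.

Definition D1 u : V := cov A1 u (pdv (e1 R) u).
Definition D2 u : V := cov A2 u (pdv (e2 R) u).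

Definition qA u v : R := ip (D1 u) (D1 v) + 1 * ip (D2 u) (D2 v).

Lemma D1_L2f u : tst u -> L2f (D1 u).
Proof. by move=> tu; apply: cov_L2f => //; [exact: tst_L2f|exact: pdv_L2f]. Qed.

Lemma D2_L2f u : tst u -> L2f (D2 u).
Proof. by move=> tu; apply: cov_L2f => //; [exact: tst_L2f|exact: pdv_L2f]. Qed.

Lemma D1D u v : tst u -> tst v -> D1 (u + v) = D1 u + D1 v.
Proof. by move=> tu tv; rewrite /D1 (pdvD (a := a) (b := b)) // covD. Qed.
Lemma D2D u v : tst u -> tst v -> D2 (u + v) = D2 u + D2 v.
Proof. by move=> tu tv; rewrite /D2 (pdvD (a := a) (b := b)) // covD. Qed.
Lemma D1Z c u : tst u -> D1 (c *: u) = c *: D1 u.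
Proof. by move=> tu; rewrite /D1 (pdvZ (a := a) (b := b)) // covZ. Qed.
Lemma D2Z c u : tst u -> D2 (c *: u) = c *: D2 u.
Proof. by move=> tu; rewrite /D2 (pdvZ (a := a) (b := b)) // covZ. Qed.

Lemma D1_imul u : tst u -> D1 (imul u) = imul (D1 u).
Proof. by move=> tu; rewrite /D1 pdv_imul ?cov_imul //; exact: tst_smooth2 tu. Qed.
Lemma D2_imul u : tst u -> D2 (imul u) = imul (D2 u).
Proof. by move=> tu; rewrite /D2 pdv_imul ?cov_imul //; exact: tst_smooth2 tu. Qed.

Lemma ip_psd_tst : psd tst ip.
Proof.
have [H1 H2 H3 H4] := ip_psd a b; split.
- by move=> u v w tu tv tw; apply: H1; exact: tst_L2f.
- by move=> c u w tu tw; apply: H2; exact: tst_L2f.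
- by move=> u v tu tv; apply: H3; exact: tst_L2f.
- by move=> u tu; apply: H4; exact: tst_L2f.
Qed.

Lemma D1_psd : psd tst (fun u v => ip (D1 u) (D1 v)).
Proof.
have [H1 H2 H3 H4] := ip_psd a b; split.
- by move=> u v w tu tv tw; rewrite D1D // H1 //; exact: D1_L2f.
- by move=> c u w tu tw; rewrite D1Z // H2 //; exact: D1_L2f.
- by move=> u v tu tv; rewrite H3 //; exact: D1_L2f.
- by move=> u tu; apply: H4; exact: D1_L2f.
Qed.

Lemma D2_psd : psd tst (fun u v => ip (D2 u) (D2 v)).
Proof.
have [H1 H2 H3 H4] := ip_psd a b; split.
- by move=> u v w tu tv tw; rewrite D2D // H1 //; exact: D2_L2f.
- by move=> c u w tu tw; rewrite D2Z // H2 //; exact: D2_L2f.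
- by move=> u v tu tv; rewrite H3 //; exact: D2_L2f.
- by move=> u tu; apply: H4; exact: D2_L2f.
Qed.

Lemma qA_psd : psd tst qA.
Proof. by apply: psd_lin; [exact: D1_psd|exact: D2_psd|exact: ler01]. Qed.

Let Q u g1 g2 v h1 h2 : R :=
  ip (cov A1 u g1) (cov A1 v h1) + ip (cov A2 u g2) (cov A2 v h2).

Lemma magnetic_formE u g1 g2 v h1 h2 :
  magnetic_form Om A (cpx u) (cpx g1) (cpx g2) (cpx v) (cpx h1) (cpx h2) =
  Q u g1 g2 v h1 h2 +i* Q u g1 g2 (imul v) (imul h1) (imul h2).
Proof. by rewrite /magnetic_form !mderivE !innerL2E -!cov_imul. Qed.

(* The form domain in real coordinates, as the closure of the test functions. *)
Let cl v h1 h2 := [/\ L2f v, L2f h1, L2f h2 &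
  exists psi : nat -> V, [/\ forall n, tst (psi n), cvL2 psi v,
    cvL2 (fun n => pdv (e1 R) (psi n)) h1 & cvL2 (fun n => pdv (e2 R) (psi n)) h2]].

Let cpxB u v : (fun x => cpx u x - cpx v x) = cpx (u - v).
Proof. by []. Qed.

Lemma W12_0_cl u' g1' g2' : W12_0 Om (cpx u') (cpx g1') (cpx g2') -> cl u' g1' g2'.
Proof.
move=> [[/L2P su /L2P s1 /L2P s2 _ _] [phi tphi cphi]]; split => //.
pose psi n := rpx (phi n).
have tpsi n : tst (psi n) by rewrite /tst /psi rpxK.
have Ss := L2f_subspace a b.
have E n : (normL2sq Om (fun x => phi n x - cpx u' x)%R +
     normL2sq Om (fun x => pderivC (e1 R) (phi n) x - cpx g1' x)%R +
     normL2sq Om (fun x => pderivC (e2 R) (phi n) x - cpx g2' x)%R)%E =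
  (ip (psi n - u') (psi n - u') + ip (pdv (e1 R) (psi n) - g1') (pdv (e1 R) (psi n) - g1') +
   ip (pdv (e2 R) (psi n) - g2') (pdv (e2 R) (psi n) - g2'))%:E.
  rewrite -(rpxK (phi n)) -/(psi n) !pderivCE !cpxB !normL2sqE //.
  - by apply: (subspaceB Ss) => //; apply: pdv_L2f.
  - by apply: (subspaceB Ss) => //; apply: pdv_L2f.
  - by apply: (subspaceB Ss) => //; apply: tst_L2f.
rewrite (funext E) in cphi.
have {}cphi : ip (psi n - u') (psi n - u') + ip (pdv (e1 R) (psi n) - g1') (pdv (e1 R) (psi n) - g1') +
   ip (pdv (e2 R) (psi n) - g2') (pdv (e2 R) (psi n) - g2') @[n --> \oo] --> (0 : R).
  exact: (@fine_cvg _ _ _ _ _ (0 : R) cphi).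
have p0 n : 0 <= ip (psi n - u') (psi n - u').
  by apply: (psd_ge0 (ip_psd a b)); apply: (subspaceB Ss) => //; apply: tst_L2f.
have p1 n : 0 <= ip (pdv (e1 R) (psi n) - g1') (pdv (e1 R) (psi n) - g1').
  by apply: (psd_ge0 (ip_psd a b)); apply: (subspaceB Ss) => //; apply: pdv_L2f.
have p2 n : 0 <= ip (pdv (e2 R) (psi n) - g2') (pdv (e2 R) (psi n) - g2').
  by apply: (psd_ge0 (ip_psd a b)); apply: (subspaceB Ss) => //; apply: pdv_L2f.
exists psi; split => //.
- apply: (squeeze_cvgr _ (cvg_cst 0) cphi); apply: nearW => n.
  by rewrite p0 /=; have := p1 n; have := p2 n; lra.
- apply: (squeeze_cvgr _ (cvg_cst 0) cphi); apply: nearW => n.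
  by rewrite p1 /=; have := p0 n; have := p2 n; lra.
- apply: (squeeze_cvgr _ (cvg_cst 0) cphi); apply: nearW => n.
  by rewrite p2 /=; have := p0 n; have := p1 n; lra.
Qed.

Lemma cl_W12_0 u g1 g2 : cl u g1 g2 -> W12_0 Om (cpx u) (cpx g1) (cpx g2).
Proof.
move=> [su s1 s2 [psi [tpsi cu c1 c2]]].
have Ss := L2f_subspace a b.
have wk e g : e = e1 R \/ e = e2 R -> L2f g -> cvL2 (fun n => pdv e (psi n)) g ->
    weak_pderiv Om e (cpx u) (cpx g).
  move=> He sg cg; apply: (weak_pderivP He su sg) => v tv.
  have L1 : ip (psi n) (pdv e v) @[n --> \oo] --> ip u (pdv e v).
    apply: ip_cvg_l => //; first by move=> n; exact: tst_L2f.
    exact: pdv_L2f.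
  have L2 : - ip (pdv e (psi n)) v @[n --> \oo] --> - ip g v.
    apply: cvgN; apply: ip_cvg_l => //; first by move=> n; exact: pdv_L2f.
    exact: tst_L2f.
  have E : (fun n => ip (psi n) (pdv e v)) = (fun n => - ip (pdv e (psi n)) v).
    by apply/funext => n; rewrite (ip_parts a0 b0 He).
  by rewrite E in L1; exact: (cvg_unique _ L1 L2).
split.
  by split; [apply/L2P|apply/L2P|apply/L2P|apply: wk|apply: wk].
exists (fun n => cpx (psi n)) => //.
have E n : (normL2sq Om (fun x => cpx (psi n) x - cpx u x)%R +
     normL2sq Om (fun x => pderivC (e1 R) (cpx (psi n)) x - cpx g1 x)%R +
     normL2sq Om (fun x => pderivC (e2 R) (cpx (psi n)) x - cpx g2 x)%R)%E =
  (ip (psi n - u) (psi n - u) + ip (pdv (e1 R) (psi n) - g1) (pdv (e1 R) (psi n) - g1) +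
   ip (pdv (e2 R) (psi n) - g2) (pdv (e2 R) (psi n) - g2))%:E.
  rewrite !pderivCE !cpxB !normL2sqE //.
  - by apply: (subspaceB Ss) => //; apply: pdv_L2f.
  - by apply: (subspaceB Ss) => //; apply: pdv_L2f.
  - by apply: (subspaceB Ss) => //; apply: tst_L2f.
rewrite (funext E); apply: cvg_EFin; first exact: nearW.
rewrite (_ : 0 = 0 + 0 + 0 :> R); last by ring.
by apply: cvgD => //; apply: cvgD.
Qed.

Lemma cl_imul u g1 g2 : cl u g1 g2 -> cl (imul u) (imul g1) (imul g2).
Proof.
move=> [su s1 s2 [psi [tpsi cu c1 c2]]]; split; try exact: L2f_imul.
have iB f g : imul f - imul g = imul (f - g).
  by rewrite imulB.
exists (fun n => imul (psi n)); split.
- by move=> n; exact: tst_imul.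
- by rewrite /cvL2; under eq_fun do rewrite iB ip_imul.
- have -> : (fun n => pdv (e1 R) (imul (psi n))) = (fun n => imul (pdv (e1 R) (psi n))).
    by apply/funext => n; rewrite pdv_imul //; exact: (tst_smooth2 (tpsi n)).
  by rewrite /cvL2; under eq_fun do rewrite iB ip_imul.
- have -> : (fun n => pdv (e2 R) (imul (psi n))) = (fun n => imul (pdv (e2 R) (psi n))).
    by apply/funext => n; rewrite pdv_imul //; exact: (tst_smooth2 (tpsi n)).
  by rewrite /cvL2; under eq_fun do rewrite iB ip_imul.
Qed.

Let cl_cov u g1 g2 (psi : nat -> V) : L2f u -> L2f g1 -> L2f g2 -> (forall n, tst (psi n)) ->
  cvL2 psi u -> cvL2 (fun n => pdv (e1 R) (psi n)) g1 -> cvL2 (fun n => pdv (e2 R) (psi n)) g2 ->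
  cvL2 (fun n => D1 (psi n)) (cov A1 u g1) /\ cvL2 (fun n => D2 (psi n)) (cov A2 u g2).
Proof.
move=> su s1 s2 tpsi cu c1 c2; split; apply: cov_cvL2 => //.
- by move=> n; exact: tst_L2f.
- by move=> n; exact: pdv_L2f.
- by move=> n; exact: tst_L2f.
- by move=> n; exact: pdv_L2f.
Qed.

Let cl_lower lam : (forall v, tst v -> lam * ip v v <= qA v v) ->
  forall u g1 g2, cl u g1 g2 -> lam * ip u u <= Q u g1 g2 u g1 g2.
Proof.
move=> H u g1 g2 [su s1 s2 [psi [tpsi cu c1 c2]]].
have [d1 d2] := cl_cov su s1 s2 tpsi cu c1 c2.
have sc1 : L2f (cov A1 u g1) by exact: cov_L2f.
have sc2 : L2f (cov A2 u g2) by exact: cov_L2f.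
have L1 : lam * ip (psi n) (psi n) @[n --> \oo] --> lam * ip u u.
  apply: cvgM; first exact: cvg_cst.
  by apply: ip_cvg_sq => // n; exact: tst_L2f.
have L2 : qA (psi n) (psi n) @[n --> \oo] --> Q u g1 g2 u g1 g2.
  rewrite /qA /Q; under eq_fun do rewrite mul1r.
  by apply: cvgD; apply: ip_cvg_sq => // n; [exact: D1_L2f|exact: D2_L2f].
apply: (ler_cvg_to L1 L2); apply: nearW => n; exact: H.
Qed.

(** The sequence converges in the form norm. Its limit satisfies the
    Euler-Lagrange equation because [qA - lam * ip] is a positive form [E] for
    which [E(phi_n, v) ^ 2 <= E(phi_n) E(v)] tends to 0; and no eigenvalue is
    smaller than the lower bound [lam] of the Rayleigh quotients. *)
Lemma ground_state (phi : nat -> V) lam c :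
  (forall n, tst (phi n)) -> (forall v, tst v -> lam * ip v v <= qA v v) ->
  (forall e : R, 0 < e -> exists N : nat, forall n, (N <= n)%N ->
     qA (phi n) (phi n) - lam * ip (phi n) (phi n) <= e) ->
  (forall e : R, 0 < e -> exists N : nat, forall n m, (N <= n)%N -> (N <= m)%N ->
     ip (phi n - phi m) (phi n - phi m) <= e /\ qA (phi n - phi m) (phi n - phi m) <= e) ->
  0 < c -> (forall n, c <= ip (phi n) (phi n)) ->
  lowest_eigenvalue Om A lam.
Proof.
move=> tphi low mini cauchy c0 cphi.
have Ss := L2f_subspace a b; have St := tst_subspace a b.
have sphi n : L2f (phi n) by exact: tst_L2f.
have C0 (e : R) : 0 < e -> exists N : nat, forall n m, (N <= n)%N -> (N <= m)%N ->
    ip (phi n - phi m) (phi n - phi m) <= e.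
  by move=> /cauchy [N HN]; exists N => n m Nn Nm; case: (HN n m Nn Nm).
have gradC e (Aj : R * R -> R) : e = e1 R \/ e = e2 R -> continuous Aj ->
    (forall v, tst v -> ip (cov Aj v (pdv e v)) (cov Aj v (pdv e v)) <= qA v v) ->
    exists2 g, L2f g & cvL2 (fun n => pdv e (phi n)) g.
  move=> He cAj HA; apply: L2f_complete; first by move=> n; exact: pdv_L2f.
  have [M M0 HM] := cov_bound a b cAj.
  move=> r r0; pose r' := r / (2 * (1 + M)).
  have r'0 : 0 < r' by rewrite divr_gt0 // mulr_gt0 // ltr_pwDl.
  have [N HN] := cauchy r' r'0; exists N => n m Nn Nm.
  have [i1 i2] := HN n m Nn Nm.
  have td : tst (phi n - phi m) by exact: (subspaceB St).
  rewrite -(pdvB (a := a) (b := b)) //.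
  have [_ B] := HM _ _ (tst_L2f td) (pdv_L2f He td).
  have B2 := HA _ td.
  have : M * ip (phi n - phi m) (phi n - phi m) <= M * r' by rewrite ler_wpM2l.
  have E : 2 * (1 + M) * r' = r by rewrite /r'; field; rewrite gt_eqF // ltr_pwDl.
  by lra.
have [u su cu] := L2f_complete sphi C0.
have [g1 s1 c1] : exists2 g, L2f g & cvL2 (fun n => pdv (e1 R) (phi n)) g.
  apply: (gradC _ A1) => // v tv; rewrite /qA mul1r lerDl.
  exact: (psd_ge0 D2_psd tv).
have [g2 s2 c2] : exists2 g, L2f g & cvL2 (fun n => pdv (e2 R) (phi n)) g.
  apply: (gradC _ A2) => // v tv; rewrite /qA mul1r lerDr.
  exact: (psd_ge0 D1_psd tv).
have clu : cl u g1 g2 by split => //; exists phi.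
have [d1 d2] := cl_cov su s1 s2 tphi cu c1 c2.
have sc1 : L2f (cov A1 u g1) by exact: cov_L2f.
have sc2 : L2f (cov A2 u g2) by exact: cov_L2f.
have u0 : 0 < ip u u.
  apply: lt_le_trans c0 _; apply: (ler_cvg_to (cvg_cst c) (ip_cvg_sq sphi su cu)).
  exact: nearW.
(* the Euler-Lagrange equation against test functions *)
have EL v : tst v -> Q u g1 g2 v (pdv (e1 R) v) (pdv (e2 R) v) = lam * ip u v.
  move=> tv.
  have L1 : qA (phi n) v - lam * ip (phi n) v @[n --> \oo] -->
      Q u g1 g2 v (pdv (e1 R) v) (pdv (e2 R) v) - lam * ip u v.
    rewrite /qA /Q; under eq_fun do rewrite mul1r.
    apply: cvgB.
      apply: cvgD; apply: ip_cvg_l => //.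
      - by move=> n; exact: D1_L2f.
      - exact: D1_L2f.
      - by move=> n; exact: D2_L2f.
      - exact: D2_L2f.
    apply: cvgM; first exact: cvg_cst.
    by apply: ip_cvg_l => //; exact: tst_L2f.
  have pE : psd tst (fun u v => qA u v - lam * ip u v).
    exact: (psd_sub qA_psd ip_psd_tst low).
  have L2 : qA (phi n) v - lam * ip (phi n) v @[n --> \oo] --> (0 : R).
    apply/cvgrPdist_le => e e0.
    pose k := qA v v - lam * ip v v; have k0 : 0 <= k by rewrite subr_ge0 low.
    pose r := e ^+ 2 / (k + 1).
    have r0 : 0 < r by rewrite divr_gt0 ?exprn_gt0 // ltr_wpDl.
    have [N HN] := mini r r0; exists N => // n /= Nn.
    rewrite sub0r normrN -ler_sqr ?nnegrE // ?(ltW e0) // real_normK ?num_real //.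
    have := psd_CS St pE (tphi n) tv; rewrite /= -/k => /le_trans; apply.
    apply: le_trans (_ : r * k <= _); first by rewrite ler_wpM2r // HN.
    by rewrite /r mulrAC ler_pdivrMr ?ltr_wpDl // ler_wpM2l ?sqr_ge0 // lerDl.
  by apply/eqP; rewrite -subr_eq0; apply/eqP; exact: (cvg_unique _ L1 L2).
have ELcl v h1 h2 : cl v h1 h2 -> Q u g1 g2 v h1 h2 = lam * ip u v.
  move=> [sv t1 t2 [psi [tpsi cv cp1 cp2]]].
  have [f1 f2] := cl_cov sv t1 t2 tpsi cv cp1 cp2.
  have tc1 : L2f (cov A1 v h1) by exact: cov_L2f.
  have tc2 : L2f (cov A2 v h2) by exact: cov_L2f.
  have sym x y : L2f x -> L2f y -> ip x y = ip y x by move=> *; exact: (psd_sym (ip_psd a b)).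
  have spsi n : L2f (psi n) by exact: tst_L2f.
  have r1 n : L2f (D1 (psi n)) by exact: D1_L2f.
  have r2 n : L2f (D2 (psi n)) by exact: D2_L2f.
  have L1 : lam * ip u (psi n) @[n --> \oo] --> lam * ip u v.
    apply: cvgM; first exact: cvg_cst.
    rewrite sym //; under eq_fun do rewrite sym //.
    exact: ip_cvg_l.
  have L2 : Q u g1 g2 (psi n) (pdv (e1 R) (psi n)) (pdv (e2 R) (psi n)) @[n --> \oo] --> Q u g1 g2 v h1 h2.
    rewrite /Q; apply: cvgD.
      rewrite sym //; under eq_fun => n do rewrite (sym _ _ sc1 (r1 n)).
      exact: ip_cvg_l.
    rewrite sym //; under eq_fun => n do rewrite (sym _ _ sc2 (r2 n)).
    exact: ip_cvg_l.
  have E : (fun n => Q u g1 g2 (psi n) (pdv (e1 R) (psi n)) (pdv (e2 R) (psi n))) =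
      (fun n => lam * ip u (psi n)) by apply/funext => n; rewrite EL.
  by rewrite E in L2; exact: (cvg_unique _ L2 L1).
have scale_cpx l v : (fun x => l%:C * cpx v x) = cpx (l *: v).
  apply/funext => x; apply/eqP; rewrite eq_complex /= !mul0r subr0 addr0.
  by rewrite /GRing.scale /= !eqxx.
split.
  exists (cpx u); split.
    move=> ae0; have : ip u u = 0; last by move=> E; rewrite E ltxx in u0.
    have mO : measurable (Om : set (measurableTypeR R * measurableTypeR R)) by exact: measurable_rect.
    have z (k : R * R -> R) : measurable_fun Om k -> (forall x, cpx u x = 0 -> k x = 0) ->
        sqn (@leb2 R) Om k = 0.
      by move=> mk kP; exact: (ae_sqn0 mO mk kP ae0).
    rewrite ip_sqn // !z ?addr0 //; [exact: su.2.1| |exact: su.1.1|].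
      by move=> x /cpx_eq0 ->.
    by move=> x /cpx_eq0 ->.
  split.
    by rewrite scale_cpx; apply/L2P; exact: (subspaceZ Ss).
  exists (cpx g1), (cpx g2); split; first exact: cl_W12_0.
  move=> v h1 h2; rewrite -(rpxK v) -(rpxK h1) -(rpxK h2) scale_cpx => /W12_0_cl clv.
  rewrite magnetic_formE innerL2E (ELcl _ _ _ clv) (ELcl _ _ _ (cl_imul clv)).
  have [sv _ _ _] := clv; have siv := L2f_imul sv.
  by rewrite !(psdZl _ (ip_psd a b)).
move=> l [w0 [+ [_ [k1 [k2 []]]]]].
rewrite -(rpxK w0) -(rpxK k1) -(rpxK k2); move: (rpx w0) (rpx k1) (rpx k2) => w h1 h2 wn0 Ww EV.
have clw := W12_0_cl Ww; have := EV _ _ _ Ww.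
have [sw _ _ _] := clw.
rewrite magnetic_formE scale_cpx innerL2E => -[ERe _].
have := cl_lower low clw; rewrite ERe (psdZl _ (ip_psd a b)) //.
have : 0 <= ip w w by exact: (psd_ge0 (ip_psd a b)).
rewrite le_eqVlt => /predU1P[w0E|w0p]; last by rewrite ler_pM2r.
exfalso; apply: wn0.
have [sw1 sw2] := sw.
have mO : measurable (Om : set (measurableTypeR R * measurableTypeR R)) by exact: measurable_rect.
have := ip_sqn sw; rewrite -w0E => /esym E.
have : sqn (@leb2 R) Om (fun x => (w x).1) == 0 /\ sqn (@leb2 R) Om (fun x => (w x).2) == 0.
  by apply/andP; rewrite -paddr_eq0 ?sqn_ge0 // E.
move=> [/eqP z1 /eqP z2].
have := sqn_eq0_ae mO sw2 z2; have := sqn_eq0_ae mO sw1 z1.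
by apply: filterS2 => x H1 H2 Ox; rewrite /cpx H1 ?H2.
Qed.

End ground_state.

(** * Changes of variables *)

Section change_of_variables.
Variable R : realType.
Implicit Types (f F : R -> R) (h : R * R -> R) (a b c d u v : R).

Lemma antiderivative f u v : continuous f ->
  exists F, forall x, u <= x <= v -> is_derive (x : R) 1 F (f x).
Proof.
move=> cf; exists (fun x => int1 (u - 1) x f) => x /andP[ux xv].
have x1 : x < x + 1 by rewrite ltrDl.
have := @continuous_FTC1_closed R f (u - 1) x (x + 1) x1 (int1_integrable (cont_in cf)).
have ux1 : u - 1 < x by lra.
move=> /(_ ux1 (cf x)) [d1 d2]; split; first exact: d1.
by rewrite -derive1E; exact: d2.
Qed.

Lemma int1_scale f c u v : 0 < c -> u <= v -> continuous f ->
  c * int1 u v (fun x => f (c * x)) = int1 (c * u) (c * v) f.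
Proof.
move=> c0 uv cf; have [F dF] := antiderivative (c * u) (c * v) cf.
have cuv : c * u <= c * v by rewrite ler_pM2l.
rewrite (int1_FTC cuv (cont_in cf) dF).
have cg : continuous (fun x => f (c * x)).
  by apply: cont_comp => //; apply: contM; [exact: cst_continuous|exact: cont_id].
rewrite -int1Z; last exact: cont_in.
apply: (@int1_FTC _ _ _ _ (fun x : R => F (c * x))) => //.
  by apply: cont_in; apply: contM => //; exact: cst_continuous.
move=> x /andP[ux xv]; rewrite mulrC.
apply: is_derive_comp1; last by apply: dF; rewrite !ler_pM2l // ux.
by have := is_deriveZ c (is_derive_id x (1 : R)); rewrite /GRing.scale /= mulr1.
Qed.

Lemma int1_reflect f u v : u <= v -> continuous f ->
  int1 u v (fun x => f (- x)) = int1 (- v) (- u) f.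
Proof.
move=> uv cf; have [F dF] := antiderivative (- v) (- u) cf.
have cuv : - v <= - u by rewrite lerN2.
rewrite (int1_FTC cuv (cont_in cf) dF).
have cg : continuous (fun x => f (- x)).
  by apply: cont_comp => //; apply: contN; exact: cont_id.
rewrite (_ : int1 _ _ _ = - F (- v) - - F (- u)); first by rewrite opprK addrC.
apply: (@int1_FTC _ _ _ (fun x : R => f (- x)) (fun x : R => - F (- x))) => [//||x /andP[ux xv]].
  exact: cont_in.
have D : is_derive (x : R) 1 (fun x : R => F (- x)) (f (- x) * -1).
  apply: is_derive_comp1; last by apply: dF; rewrite !lerN2 xv.
by have := is_deriveN D; rewrite mulrN1 opprK.
Qed.

Lemma int2_scale h a b c d : 0 <= a -> 0 <= b -> 0 < c -> 0 < d -> continuous h ->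
  c * d * int2 a b (fun x => h (c * x.1, d * x.2)) = int2 (c * a) (d * b) h.
Proof.
move=> a0 b0 c0 d0 ch.
have cs k l : continuous (fun x : R * R => h (k * x.1, l * x.2)).
  apply: cont_comp => //; apply: cont_pair; apply: contM.
  - exact: cst_continuous.
  - by apply: cont_fst; exact: cont_id.
  - exact: cst_continuous.
  - by apply: cont_snd; exact: cont_id.
have a2 : - (a / 2) <= a / 2 by lra.
have b2 : - (b / 2) <= b / 2 by lra.
rewrite !int2_fubini12 //=.
rewrite -!(mulrA d) -!(mulrA c) -!(mulrN d) -!(mulrN c) mulrA.
have cJ k : continuous (fun x : R => int1 (d * - (b / 2)) (d * (b / 2)) (fun y => h (k * x, y))).
  move: (@int1_continuous _ (d * - (b / 2)) (d * (b / 2)) _ (cs k 1)).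
  by under eq_fun do under eq_int1 do rewrite mul1r.
have cJ1 : continuous (fun x : R => int1 (d * - (b / 2)) (d * (b / 2)) (fun y => h (x, y))).
  exact: int1_continuous.
rewrite -(int1_scale c0 a2 cJ1) -mulrA; congr (_ * _); rewrite -int1Z; last first.
  by apply: cont_in; exact: (@int1_continuous _ _ _ _ (cs c d)).
apply: eq_int1 => x _; apply: (@int1_scale (fun y => h (c * x, y)) d) => //.
exact: (@slice2_continuous _ _ (c * x) ch).
Qed.

(** Fubini's theorem in both orders, and a reflection of one variable. *)
Lemma int2_rot h a : 0 <= a -> continuous h -> int2 a a (fun x => h (- x.2, x.1)) = int2 a a h.
Proof.
move=> a0 ch.
have a2 : - (a / 2) <= a / 2 by lra.
have cr : continuous (fun x : R * R => h (- x.2, x.1)).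
  apply: cont_comp => //; apply: cont_pair; [apply: contN; apply: cont_snd|apply: cont_fst]; exact: cont_id.
rewrite (int2_fubini12 _ _ cr) (int2_fubini21 _ _ ch) /=; apply: eq_int1 => x _.
rewrite (@int1_reflect (fun s => h (s, x))) ?opprK //.
exact: slice1_continuous.
Qed.

End change_of_variables.

Section test_maps.
Variable R : realType.
Implicit Types (u v w : R * R -> R * R) (m : R * R -> R * R).

(** The support of [w] lies in the image under [m'] of the support of [u], which
    is compact. *)
Lemma tst_map a b a' b' u w m m' : tst a b u -> continuous m -> continuous m' ->
  cancel m m' -> (forall x, rect a b x -> rect a' b' (m' x)) ->
  smooth (fun x => (w x).1) -> smooth (fun x => (w x).2) ->
  (forall x, u (m x) = 0 -> w x = 0) -> tst a' b' w.
Proof.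
move=> [_ _ cu su] cm cm' mK m'R w1 w2 H.
set K := closure [set x | cpx u x <> 0] in cu su.
have cK : compact (m' @` K).
  by apply: continuous_compact => //; exact: continuous_subspaceT.
have clK : closed (m' @` K) by apply: compact_closed => //; exact: norm_hausdorff.
have sub : closure [set x | cpx w x <> 0] `<=` m' @` K.
  apply: (subset_trans (B := closure (m' @` K))); last by rewrite -(closure_id _).1.
  apply: closureS => x /= wx; exists (m x); last by rewrite mK.
  apply: subset_closure => /= ux; apply: wx; apply/cpx_eq0; apply: H; exact/cpx_eq0.
split => //.
- by apply: subclosed_compact sub => //; exact: closed_closure.
- by move=> x /sub [y Ky <-]; apply: m'R; exact: su.
Qed.

End test_maps.

(** * Quarter turns, gauge transformations and dilations *)

Section transformations.
Variable R : realType.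
Local Notation V := (R * R -> R * R).
Implicit Types (u v w : R * R -> R * R) (A : R * R -> R * R) (chi : R * R -> R) (a b c d : R).

(** The linear potential of the constant field [B] that is equivariant under
    quarter turns. *)
Definition sgauge (B : R) : V := fun x => (- (B / 2 * x.2), B / 2 * x.1).

Lemma smooth_fst : smooth (fun x : R * R => x.1). Proof. by move=> k; exact: Ck_fst. Qed.
Lemma smooth_snd : smooth (fun x : R * R => x.2). Proof. by move=> k; exact: Ck_snd. Qed.

Lemma sgauge_smooth1 B : smooth (fun x => (sgauge B x).1).
Proof. by apply: smoothN; apply: smoothM; [exact: smooth_cst|exact: smooth_snd]. Qed.

Lemma sgauge_smooth2 B : smooth (fun x => (sgauge B x).2).
Proof. by apply: smoothM; [exact: smooth_cst|exact: smooth_fst]. Qed.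

Lemma smooth_cont (h : R * R -> R) : smooth h -> continuous h.
Proof. by move=> sh; exact: (sh 0%N). Qed.

Lemma D1_cont A a b u : smooth (fun x => (A x).1) -> tst a b u ->
  continuous (fun x => (D1 A u x).1) /\ continuous (fun x => (D1 A u x).2).
Proof.
move=> sA tu; have cA := smooth_cont sA.
have c1 := smooth_cont (tst_smooth1 tu); have c2 := smooth_cont (tst_smooth2 tu).
have d1 := smooth_cont (smooth_derive (or_introl erefl) (tst_smooth1 tu)).
have d2 := smooth_cont (smooth_derive (or_introl erefl) (tst_smooth2 tu)).
split; [apply: contD|apply: contB] => //; exact: contM.
Qed.

Lemma D2_cont A a b u : smooth (fun x => (A x).2) -> tst a b u ->
  continuous (fun x => (D2 A u x).1) /\ continuous (fun x => (D2 A u x).2).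
Proof.
move=> sA tu; have cA := smooth_cont sA.
have c1 := smooth_cont (tst_smooth1 tu); have c2 := smooth_cont (tst_smooth2 tu).
have d1 := smooth_cont (smooth_derive (or_intror erefl) (tst_smooth1 tu)).
have d2 := smooth_cont (smooth_derive (or_intror erefl) (tst_smooth2 tu)).
split; [apply: contD|apply: contB] => //; exact: contM.
Qed.

Definition qturn u : V := fun x => u (- x.2, x.1).

Lemma smooth_qturn (h : R * R -> R) : smooth h -> smooth (fun x => h (- x.2, x.1)).
Proof.
move=> sh k; have := Ck_swap (Ck_diag (-1) 1 (sh k)); rewrite /=.
by under eq_fun do rewrite mulN1r mul1r.
Qed.

Lemma tst_qturn a u : tst a a u -> tst a a (qturn u).
Proof.
move=> tu.
have cf := smooth_cont smooth_fst; have cs := smooth_cont smooth_snd.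
apply: (tst_map (m := fun x => (- x.2, x.1)) (m' := fun x => (x.2, - x.1)) tu) => //.
- by apply: cont_pair; [exact: contN|].
- by apply: cont_pair; [|exact: contN].
- by move=> [x y] /=; rewrite opprK.
- by move=> [x y] [/= /andP[x1 x2] y12]; split => //=; rewrite !ltrN2 x2 ltrNl x1.
- by apply: (smooth_qturn (tst_smooth1 tu)).
- by apply: (smooth_qturn (tst_smooth2 tu)).
Qed.

Lemma derive_e1_qturn (h : R * R -> R) x : Ck 1 h ->
  'D_(e1 R) (fun y => h (- y.2, y.1)) x = 'D_(e2 R) h (- x.2, x.1).
Proof.
move=> sh.
have /is_derive_e2P /= H := Ck_is_derive (- x.2, x.1) (or_intror erefl) sh.
by have := iffRL (is_derive_e1P (fun y => h (- y.2, y.1)) x _) H; move=> [_ ->].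
Qed.

Lemma derive_e2_qturn (h : R * R -> R) x : Ck 1 h ->
  'D_(e2 R) (fun y => h (- y.2, y.1)) x = - 'D_(e1 R) h (- x.2, x.1).
Proof.
move=> sh.
have /is_derive_e1P /= H := Ck_is_derive (- x.2, x.1) (or_introl erefl) sh.
have H' : is_derive x.2 1 (fun s : R => h (- s, x.1)) ('D_(e1 R) h (- x.2, x.1) * -1).
  by apply: (is_derive_comp1 (g := fun s : R => - s) (f := fun s => h (s, x.1))).
have := iffRL (is_derive_e2P (fun y => h (- y.2, y.1)) x _) H'.
by move=> [_ ->]; rewrite mulrN1.
Qed.

Lemma D1_qturn B a u : tst a a u -> D1 (sgauge B) (qturn u) = qturn (D2 (sgauge B) u).
Proof.
move=> tu; have s1 := tst_smooth1 tu 1%N; have s2 := tst_smooth2 tu 1%N.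
have E1 x : 'D_(e1 R) (fun y => (u (- y.2, y.1)).1) x = 'D_(e2 R) (fun y => (u y).1) (- x.2, x.1) by exact: (derive_e1_qturn x s1).
have E2 x : 'D_(e1 R) (fun y => (u (- y.2, y.1)).2) x = 'D_(e2 R) (fun y => (u y).2) (- x.2, x.1) by exact: (derive_e1_qturn x s2).
by apply: field_ext => x; rewrite /D1 /D2 /cov /qturn /pdv /= ?E1 ?E2 ?mulrN //.
Qed.

Lemma D2_qturn B a u : tst a a u -> D2 (sgauge B) (qturn u) = - qturn (D1 (sgauge B) u).
Proof.
move=> tu; have s1 := tst_smooth1 tu 1%N; have s2 := tst_smooth2 tu 1%N.
have E1 x : 'D_(e2 R) (fun y => (u (- y.2, y.1)).1) x = - 'D_(e1 R) (fun y => (u y).1) (- x.2, x.1) by exact: (derive_e2_qturn x s1).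
have E2 x : 'D_(e2 R) (fun y => (u (- y.2, y.1)).2) x = - 'D_(e1 R) (fun y => (u y).2) (- x.2, x.1) by exact: (derive_e2_qturn x s2).
by apply: field_ext => x; rewrite /D2 /cov /qturn /pdv ?fN1 ?fN2 /D1 /cov /pdv /= ?E1 ?E2; ring.
Qed.

Lemma ip_qturn a u : 0 <= a -> continuous (fun x => (u x).1) -> continuous (fun x => (u x).2) ->
  ip a a (qturn u) (qturn u) = ip a a u u.
Proof.
move=> a0 c1 c2.
have ch : continuous (fun x => (u x).1 * (u x).1 + (u x).2 * (u x).2).
  by apply: contD; apply: contM.
exact: (int2_rot a0 ch).
Qed.

Lemma ipN a b u : ip a b (- u) (- u) = ip a b u u.
Proof. by apply: eq_int2 => x _; rewrite !fE !mulrNN. Qed.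

(** Multiplication by [exp (i chi)], in real coordinates. *)
Definition gauge chi u : V := fun x =>
  (cos (chi x) * (u x).1 - sin (chi x) * (u x).2,
   sin (chi x) * (u x).1 + cos (chi x) * (u x).2).

Lemma smooth_cos chi : smooth chi -> smooth (fun x => cos (chi x)).
Proof. by move=> s k; exact: Ck_cos. Qed.
Lemma smooth_sin chi : smooth chi -> smooth (fun x => sin (chi x)).
Proof. by move=> s k; exact: Ck_sin. Qed.

Lemma gauge_smooth chi u : smooth chi -> smooth (fun x => (u x).1) -> smooth (fun x => (u x).2) ->
  smooth (fun x => (gauge chi u x).1) /\ smooth (fun x => (gauge chi u x).2).
Proof.
move=> sc s1 s2; have c := smooth_cos sc; have s := smooth_sin sc.
split; last by apply: smoothD; exact: smoothM.
by apply: smoothD; [|apply: smoothN]; apply: smoothM.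
Qed.

Lemma tst_gauge a b chi u : smooth chi -> tst a b u -> tst a b (gauge chi u).
Proof.
move=> sc tu; have [g1 g2] := gauge_smooth sc (tst_smooth1 tu) (tst_smooth2 tu).
by apply: (tst_dom tu tu) => // x ux _; rewrite /gauge ux /= !mulr0 subrr addr0.
Qed.

(** The equation for [chi] is asked at the point [x] only, since a gauge
    potential is available on the rectangle and not on the whole plane. *)
Lemma gauge_cov e chi u (A A' : R * R -> R) x : e = e1 R \/ e = e2 R -> smooth chi ->
  smooth (fun x => (u x).1) -> smooth (fun x => (u x).2) ->
  'D_e chi x = A' x - A x ->
  cov A' (gauge chi u) (pdv e (gauge chi u)) x = gauge chi (cov A u (pdv e u)) x.
Proof.
move=> He sc s1 s2 Hx.
have dc := Ck_is_derive x He (sc 1%N).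
have d1 := Ck_is_derive x He (s1 1%N); have d2 := Ck_is_derive x He (s2 1%N).
have ds := is_derive_chain He dc (is_derive_sin (chi x)).
have dk := is_derive_chain He dc (is_derive_cos (chi x)).
have [_ E1] := is_deriveB (is_deriveM dk d1) (is_deriveM ds d2).
have [_ E2] := is_deriveD (is_deriveM ds d1) (is_deriveM dk d2).
rewrite /cov /pdv /gauge /=; rewrite [X in (X + _, _)]E1 [X in (_, X - _)]E2 Hx /GRing.scale /=.
by congr pair; ring.
Qed.

Lemma gauge_sqr chi u x :
  (gauge chi u x).1 ^+ 2 + (gauge chi u x).2 ^+ 2 = (u x).1 ^+ 2 + (u x).2 ^+ 2.
Proof.
have := cos2Dsin2 (chi x); rewrite /gauge /= => E.
by rewrite -[RHS]mul1r -E; ring.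
Qed.

Lemma gaugeK chi u : gauge chi (gauge (fun x => - chi x) u) = u.
Proof.
by apply: field_ext => x; have := cos2Dsin2 (chi x); rewrite /gauge /= cosN sinN => E;
  rewrite -[RHS]mul1r -E; ring.
Qed.

Lemma gaugeB chi u v : gauge chi (u - v) = gauge chi u - gauge chi v.
Proof. by apply: field_ext => x; rewrite /gauge !fE /=; ring. Qed.

Lemma ip_gauge a b chi u v : (forall x, rect a b x -> v x = gauge chi u x) ->
  ip a b v v = ip a b u u.
Proof. by move=> H; apply: eq_int2 => x /H ->; rewrite -!expr2 gauge_sqr. Qed.

Definition dil c d u : V := fun x => u (c * x.1, d * x.2).

Lemma tst_dil a b c d u : 0 < c -> 0 < d -> tst (c * a) (d * b) u -> tst a b (dil c d u).
Proof.
move=> c0 d0 tu.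
have cf := smooth_cont smooth_fst; have cs := smooth_cont smooth_snd.
have cc (k l : R) : continuous (fun x : R * R => (k * x.1, l * x.2)).
  apply: cont_pair; apply: contM; [exact: cst_continuous| |exact: cst_continuous|] => //.
apply: (tst_map (m := fun x => (c * x.1, d * x.2)) (m' := fun x => (c^-1 * x.1, d^-1 * x.2)) tu) => //.
- by move=> [x y] /=; rewrite !mulKf // gt_eqF.
- move=> [x y] [/= /andP[x1 x2] /andP[y1 y2]]; split => /=; apply/andP; split.
  + by rewrite ltr_pdivlMl // mulrN mulrA.
  + by rewrite ltr_pdivrMl // mulrA.
  + by rewrite ltr_pdivlMl // mulrN mulrA.
  + by rewrite ltr_pdivrMl // mulrA.
- by move=> k; exact: (Ck_diag c d (tst_smooth1 tu k)).
- by move=> k; exact: (Ck_diag c d (tst_smooth2 tu k)).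
Qed.

Lemma derive_e1_dil (h : R * R -> R) c d x : Ck 1 h ->
  'D_(e1 R) (fun y => h (c * y.1, d * y.2)) x = c * 'D_(e1 R) h (c * x.1, d * x.2).
Proof.
move=> sh.
have /is_derive_e1P /= H := Ck_is_derive (c * x.1, d * x.2) (or_introl erefl) sh.
have dc : is_derive x.1 1 (fun s : R => c * s) c.
  by have := is_deriveZ c (is_derive_id x.1 (1 : R)); rewrite /GRing.scale /= mulr1.
have H' := is_derive_comp1 dc H.
have := iffRL (is_derive_e1P (fun y => h (c * y.1, d * y.2)) x _) H'.
by move=> [_ ->]; rewrite mulrC.
Qed.

Lemma derive_e2_dil (h : R * R -> R) c d x : Ck 1 h ->
  'D_(e2 R) (fun y => h (c * y.1, d * y.2)) x = d * 'D_(e2 R) h (c * x.1, d * x.2).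
Proof.
move=> sh.
have /is_derive_e2P /= H := Ck_is_derive (c * x.1, d * x.2) (or_intror erefl) sh.
have dc : is_derive x.2 1 (fun s : R => d * s) d.
  by have := is_deriveZ d (is_derive_id x.2 (1 : R)); rewrite /GRing.scale /= mulr1.
have H' := is_derive_comp1 dc H.
have := iffRL (is_derive_e2P (fun y => h (c * y.1, d * y.2)) x _) H'.
by move=> [_ ->]; rewrite mulrC.
Qed.

(** The potential for which covariant derivatives commute with [dil] up to the
    factors [c] and [d]. *)
Definition adil c d A : V := fun x =>
  (c * (A (c * x.1, d * x.2)).1, d * (A (c * x.1, d * x.2)).2).

Lemma D1_dil A a b c d u : tst a b u -> D1 (adil c d A) (dil c d u) = c *: dil c d (D1 A u).
Proof.
move=> tu; have s1 := tst_smooth1 tu 1%N; have s2 := tst_smooth2 tu 1%N.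
have E1 x : 'D_(e1 R) (fun y => (u (c * y.1, d * y.2)).1) x = c * 'D_(e1 R) (fun y => (u y).1) (c * x.1, d * x.2) by exact: (derive_e1_dil c d x s1).
have E2 x : 'D_(e1 R) (fun y => (u (c * y.1, d * y.2)).2) x = c * 'D_(e1 R) (fun y => (u y).2) (c * x.1, d * x.2) by exact: (derive_e1_dil c d x s2).
by apply: field_ext => x; rewrite /D1 /cov !fE /pdv /dil /adil /= ?E1 ?E2; ring.
Qed.

Lemma D2_dil A a b c d u : tst a b u -> D2 (adil c d A) (dil c d u) = d *: dil c d (D2 A u).
Proof.
move=> tu; have s1 := tst_smooth1 tu 1%N; have s2 := tst_smooth2 tu 1%N.
have E1 x : 'D_(e2 R) (fun y => (u (c * y.1, d * y.2)).1) x = d * 'D_(e2 R) (fun y => (u y).1) (c * x.1, d * x.2) by exact: (derive_e2_dil c d x s1).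
have E2 x : 'D_(e2 R) (fun y => (u (c * y.1, d * y.2)).2) x = d * 'D_(e2 R) (fun y => (u y).2) (c * x.1, d * x.2) by exact: (derive_e2_dil c d x s2).
by apply: field_ext => x; rewrite /D2 /cov !fE /pdv /dil /adil /= ?E1 ?E2; ring.
Qed.

Lemma ip_dil a b c d u : 0 <= a -> 0 <= b -> 0 < c -> 0 < d ->
  continuous (fun x => (u x).1) -> continuous (fun x => (u x).2) ->
  c * d * ip a b (dil c d u) (dil c d u) = ip (c * a) (d * b) u u.
Proof.
move=> a0 b0 c0 d0 c1 c2.
have ch : continuous (fun x => (u x).1 * (u x).1 + (u x).2 * (u x).2).
  by apply: contD; apply: contM.
exact: (int2_scale a0 b0 c0 d0 ch).
Qed.

End transformations.

(** * The magnetic forms on the unit square *)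

Section gap_constants.
Variable R : realType.

(** The square of a sum is at most [(1 + e) x ^ 2 + (1 + 1 / e) y ^ 2]. The
    choice [e = 1 / 256] keeps [2 pi ^ 2 e] well below the gap [1 / 2] of the
    problem without field. *)
Lemma cov_reverse_le (A : R * R -> R) (u g : R * R -> R * R) x : A x ^+ 2 <= 10000^-1 ->
  (g x).1 ^+ 2 + (g x).2 ^+ 2 <=
  257 / 256 * ((cov A u g x).1 ^+ 2 + (cov A u g x).2 ^+ 2) +
  257 / 10000 * ((u x).1 ^+ 2 + (u x).2 ^+ 2).
Proof.
rewrite /cov /=; move: (g x).1 (g x).2 (u x).1 (u x).2 (A x) => p q y z r Hr.
have Y : r ^+ 2 * y ^+ 2 <= 10000^-1 * y ^+ 2 by rewrite ler_wpM2r ?sqr_ge0.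
have Z : r ^+ 2 * z ^+ 2 <= 10000^-1 * z ^+ 2 by rewrite ler_wpM2r ?sqr_ge0.
have := sqr_ge0 ((p + r * z) / 16 + 16 * (r * z)).
have := sqr_ge0 ((q - r * y) / 16 - 16 * (r * y)).
rewrite (_ : ((q - r * y) / 16 - 16 * (r * y)) ^+ 2 =
  257 / 256 * (q - r * y) ^+ 2 + 257 * (r ^+ 2 * y ^+ 2) - q ^+ 2); last by field.
rewrite (_ : ((p + r * z) / 16 + 16 * (r * z)) ^+ 2 =
  257 / 256 * (p + r * z) ^+ 2 + 257 * (r ^+ 2 * z ^+ 2) - p ^+ 2); last by field.
by move: Y Z; move: ((q - r * y) ^+ 2) ((p + r * z) ^+ 2) (r ^+ 2 * y ^+ 2) (r ^+ 2 * z ^+ 2)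
  (p ^+ 2) (q ^+ 2) (y ^+ 2) (z ^+ 2) => *; lra.
Qed.

Lemma pi_sqr_bounds : 4 <= (pi : R) ^+ 2 <= 16.
Proof.
have p4 : (pi : R) <= 4 by have := @pihalf_lt2 R; lra.
have p2 : (2 : R) <= pi by exact: pi_ge2.
have p0 : (0 : R) <= pi by exact: pi_ge0.
have H1 : 2 * 2 <= (pi : R) * pi by apply: ler_pM.
have H2 : (pi : R) * pi <= 4 * 4 by apply: ler_pM.
by rewrite expr2; lra.
Qed.

(** The linear arithmetic of [gap_magnetic], where [P] stands for [pi ^ 2]. *)
Lemma gap_arith (n1 n2 g11 g12 g21 g22 X1 X2 a b P : R) :
  2^-1 * n1 <= 2 * a + (g11 + g21 - 2 * P * n1) ->
  2^-1 * n2 <= 2 * b + (g12 + g22 - 2 * P * n2) ->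
  g11 + g12 <= 257 / 256 * X1 + 257 / 10000 * (n1 + n2) ->
  g21 + g22 <= 257 / 256 * X2 + 257 / 10000 * (n1 + n2) ->
  P * (n1 + n2) <= 16 * (n1 + n2) -> 0 <= n1 + n2 ->
  0 <= X1 - P * (n1 + n2) -> 0 <= X2 - P * (n1 + n2) ->
  0 <= a -> 0 <= b ->
  n1 + n2 <= 8 * (a + b) + 6 * (X1 - P * (n1 + n2) + 1 * (X2 - P * (n1 + n2))).
Proof.
have -> : P * (n1 + n2) = P * n1 + P * n2 by ring.
rewrite -!(mulrA 2); move: (P * n1) (P * n2) => y z *; lra.
Qed.

End gap_constants.

Section unit_square.
Variable R : realType.
Implicit Types (u v w : R * R -> R * R).
Variable B : R.
Local Notation W := (tst (1 : R) 1).
Local Notation N := (ip (1 : R) 1).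
Local Notation A := (sgauge B).

(** The energy above [pi ^ 2], the bottom of the Dirichlet spectrum of a segment
    of unit length. *)
Definition excess1 u v : R := N (D1 A u) (D1 A v) - pi ^+ 2 * N u v.
Definition excess2 u v : R := N (D2 A u) (D2 A v) - pi ^+ 2 * N u v.

(** The inner product with the ground state of the square without field. *)
Definition amp u : R := int2 1 1 (fun x => cos2 x * (u x).1).

Let cA1 : continuous (fun x => (A x).1). Proof. exact: smooth_cont (sgauge_smooth1 B). Qed.
Let cA2 : continuous (fun x => (A x).2). Proof. exact: smooth_cont (sgauge_smooth2 B). Qed.

Lemma ip_sqrE a b u : ip a b u u = int2 a b (fun x => (u x).1 ^+ 2 + (u x).2 ^+ 2).
Proof. by apply: eq_int2 => x _; rewrite !expr2. Qed.

Lemma tst_cont a b u : tst a b u -> continuous (fun x => (u x).1) /\ continuous (fun x => (u x).2).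
Proof. by move=> tu; split; apply: smooth_cont; [exact: tst_smooth1 tu|exact: tst_smooth2 tu]. Qed.

Lemma sqr_cont u : continuous (fun x => (u x).1) -> continuous (fun x => (u x).2) ->
  continuous (fun x => (u x).1 ^+ 2 + (u x).2 ^+ 2).
Proof. by move=> c1 c2; apply: contD; apply: contX. Qed.

Lemma ip_sqrD a b u : continuous (fun x => (u x).1) -> continuous (fun x => (u x).2) ->
  ip a b u u = int2 a b (fun x => (u x).1 ^+ 2) + int2 a b (fun x => (u x).2 ^+ 2).
Proof. by move=> c1 c2; rewrite ip_sqrE int2D //; exact: contX. Qed.

Lemma tst_edge u : W u -> forall s : R,
  [/\ u (- (1 / 2), s) = 0, u (1 / 2, s) = 0, u (s, - (1 / 2)) = 0 & u (s, 1 / 2) = 0].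
Proof.
move=> tu s; split; apply: (tst_out tu) => -[/= /andP[x1 x2] /andP[y1 y2]].
- by rewrite ltxx in x1.
- by rewrite ltxx in x2.
- by rewrite ltxx in y1.
- by rewrite ltxx in y2.
Qed.

(** The one-dimensional inequality on every horizontal line, where a real
    multiple [s u] of the function is added to the covariant derivative: the
    cross term is [s] times the derivative of [|u| ^ 2], and the potential drops
    out of it. *)
Lemma pi2_le_D1 u : W u -> pi ^+ 2 * N u u <= N (D1 A u) (D1 A u).
Proof.
move=> tu; have [c1 c2] := tst_cont tu.
have [d1 d2] := D1_cont (sgauge_smooth1 B) tu.
have cu := sqr_cont c1 c2; have cd := sqr_cont d1 d2.
have g1 := smooth_cont (smooth_derive (or_introl erefl) (tst_smooth1 tu)).
have g2 := smooth_cont (smooth_derive (or_introl erefl) (tst_smooth2 tu)).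
rewrite !ip_sqrE -subr_ge0 -int2Z // -int2B //; last first.
  by apply: contM => //; exact: cst_continuous.
rewrite int2_fubini21; last first.
  by apply: contB => //; apply: contM => //; exact: cst_continuous.
apply: int1_ge0 => y _.
pose G x := (D1 A u (x, y)).1 ^+ 2 + (D1 A u (x, y)).2 ^+ 2.
pose m x := (u (x, y)).1 ^+ 2 + (u (x, y)).2 ^+ 2.
pose m' x := 2 * ((u (x, y)).1 * (pdv (e1 R) u (x, y)).1 + (u (x, y)).2 * (pdv (e1 R) u (x, y)).2).
apply: (@int1_pi2_le _ G m m').
- exact: (slice1_continuous (y := y) cd).
- apply: (@slice1_continuous _ (fun x => 2 * ((u x).1 * (pdv (e1 R) u x).1 + (u x).2 * (pdv (e1 R) u x).2)) y).
  apply: contM; first exact: cst_continuous.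
  by apply: contD; apply: contM.
- move=> x.
  have /is_derive_e1P /= H1 := tst_is_derive1 (x, y) tu (or_introl erefl).
  have /is_derive_e1P /= H2 := tst_is_derive2 (x, y) tu (or_introl erefl).
  have := is_deriveD (is_deriveM H1 H1) (is_deriveM H2 H2).
  move=> H; rewrite (_ : m = ((fun s => (u (s, y)).1) * (fun s => (u (s, y)).1) +
    (fun s => (u (s, y)).2) * (fun s => (u (s, y)).2))); last first.
    by apply/funext => s; rewrite /m !expr2.
  by apply: (is_derive_eq H); rewrite /m' /GRing.scale /=; ring.
- by rewrite /m; have [-> _ _ _] := tst_edge tu y; rewrite expr0n /= addr0.
- by rewrite /m; have [_ -> _ _] := tst_edge tu y; rewrite expr0n /= addr0.
move=> x s _.
have -> : G x + s * m' x + s ^+ 2 * m x =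
   ((D1 A u (x, y)).1 + s * (u (x, y)).1) ^+ 2 + ((D1 A u (x, y)).2 + s * (u (x, y)).2) ^+ 2.
  by rewrite /G /m' /m /D1 /cov /=; ring.
by rewrite addr_ge0 ?sqr_ge0.
Qed.

Lemma N_qturn u : W u -> N (qturn u) (qturn u) = N u u.
Proof. by move=> tu; have [c1 c2] := tst_cont tu; exact: ip_qturn. Qed.

Lemma D1_N_qturn u : W u -> N (D1 A (qturn u)) (D1 A (qturn u)) = N (D2 A u) (D2 A u).
Proof.
move=> tu; rewrite (D1_qturn B tu); have [c1 c2] := D2_cont (sgauge_smooth2 B) tu.
exact: ip_qturn.
Qed.

Lemma D2_N_qturn u : W u -> N (D2 A (qturn u)) (D2 A (qturn u)) = N (D1 A u) (D1 A u).
Proof.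
move=> tu; rewrite (D2_qturn B tu) ipN; have [c1 c2] := D1_cont (sgauge_smooth1 B) tu.
exact: ip_qturn.
Qed.

Lemma pi2_le_D2 u : W u -> pi ^+ 2 * N u u <= N (D2 A u) (D2 A u).
Proof. by move=> tu; rewrite -D1_N_qturn // -N_qturn //; apply: pi2_le_D1; exact: tst_qturn. Qed.

Lemma excess1_psd : psd W excess1.
Proof. exact: (psd_sub (D1_psd 1 1 cA1) (ip_psd_tst 1 1) pi2_le_D1). Qed.

Lemma excess2_psd : psd W excess2.
Proof. exact: (psd_sub (D2_psd 1 1 cA2) (ip_psd_tst 1 1) pi2_le_D2). Qed.

Lemma excess1_qturn u : W u -> excess1 (qturn u) (qturn u) = excess2 u u.
Proof. by move=> tu; rewrite /excess1 /excess2 D1_N_qturn // N_qturn. Qed.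

Lemma excess2_qturn u : W u -> excess2 (qturn u) (qturn u) = excess1 u u.
Proof. by move=> tu; rewrite /excess1 /excess2 D2_N_qturn // N_qturn. Qed.

Lemma N_Jinv : Jinv W (@imul R) N.
Proof. by move=> u v _ _; exact: ip_imul. Qed.

Lemma excess1_Jinv : Jinv W (@imul R) excess1.
Proof. by move=> u v tu tv; rewrite /excess1 !(D1_imul (a := 1) (b := 1)) // !ip_imul. Qed.

Lemma excess2_Jinv : Jinv W (@imul R) excess2.
Proof. by move=> u v tu tv; rewrite /excess2 !(D2_imul (a := 1) (b := 1)) // !ip_imul. Qed.

Let cphi u : W u -> continuous (fun x => cos2 x * (u x).1).
Proof. by move=> tu; have [c1 _] := tst_cont tu; apply: contM => //; exact: cos2_cont. Qed.

Lemma ampD u v : W u -> W v -> amp (u + v) = amp u + amp v.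
Proof.
by move=> tu tv; rewrite /amp -int2D; [apply: eq_int2 => x _; rewrite fD1 mulrDr|exact: cphi|exact: cphi].
Qed.

Lemma ampZ c u : W u -> amp (c *: u) = c * amp u.
Proof.
by move=> tu; rewrite /amp -int2Z; [apply: eq_int2 => x _; rewrite fZ1 mulrCA|exact: cphi].
Qed.

Lemma amp_qturn u : W u -> amp (qturn u) = amp u.
Proof.
move=> tu; rewrite /amp -(int2_rot ler01 (cphi tu)); apply: eq_int2 => x _.
by rewrite /cos2 /qturn /= mulrN cosN [cos (pi * x.1) * _]mulrC.
Qed.

Lemma amp_imul u : W u -> amp (imul u) ^+ 2 = int2 1 1 (fun x => cos2 x * (u x).2) ^+ 2.
Proof.
move=> tu; have [_ c2] := tst_cont tu.
rewrite /amp (_ : int2 1 1 _ = -1 * int2 1 1 (fun x => cos2 x * (u x).2)); first by ring.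
rewrite -int2Z; last by apply: contM => //; exact: cos2_cont.
by apply: eq_int2 => x _; rewrite /imul /= mulN1r mulrN.
Qed.

(** The Cauchy-Schwarz inequality with [cos2], whose square norm is [1 / 4] by
    [int2_cos2_sqr]. *)
Lemma amp_sqr_le v : W v -> amp v ^+ 2 <= 4^-1 * N v v.
Proof.
move=> tv; pose k (x : R * R) := (cos2 x, 0 : R).
have sk : L2f 1 1 k by split; apply: continuous_sqi; [exact: cos2_cont|exact: cst_continuous].
have := psd_CS (L2f_subspace 1 1) (ip_psd 1 1) sk (tst_L2f tv).
have -> : N k v = amp v by apply: eq_int2 => x _; rewrite /k /= mul0r addr0.
rewrite [N k k]ip_sqrE /k /=.
by under [int2 1 1 _]eq_int2 do rewrite expr0n addr0; rewrite int2_cos2_sqr.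
Qed.

Hypothesis Bs : `|B| <= 100^-1.

Let A_le x : rect 1 1 x -> (A x).1 ^+ 2 <= 10000^-1 /\ (A x).2 ^+ 2 <= 10000^-1.
Proof.
have Bs' := Bs; move=> [/andP[x1 x2] /andP[y1 y2]].
have h (s : R) : - (1 / 2) < s -> s < 1 / 2 -> (B / 2 * s) ^+ 2 <= 10000^-1.
  move=> s1 s2; have : `|B / 2 * s| <= 100^-1.
    have -> : B / 2 * s = B * (s / 2) by ring.
    rewrite normrM -[leRHS]mulr1; apply: ler_pM => //.
    by rewrite ler_norml; apply/andP; split; lra.
  move=> H; rewrite -(real_normK (num_real _)) expr2.
  have : `|B / 2 * s| * `|B / 2 * s| <= 100^-1 * 100^-1 by apply: ler_pM.
  by lra.
by rewrite /sgauge /= sqrrN; split; apply: h.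
Qed.

(** The real and imaginary parts of [v] satisfy the inequality without field
    [gap_real]; a weak potential changes the gradient little. *)
Lemma gap_magnetic v : W v ->
  N v v <= 8 * (amp v ^+ 2 + amp (imul v) ^+ 2) + 6 * (excess1 v v + 1 * excess2 v v).
Proof.
move=> tv; have [c1 c2] := tst_cont tv.
have [a1 a2] := D1_cont (sgauge_smooth1 B) tv; have [b1 b2] := D2_cont (sgauge_smooth2 B) tv.
have g11 := smooth_cont (smooth_derive (or_introl erefl) (tst_smooth1 tv)).
have g12 := smooth_cont (smooth_derive (or_introl erefl) (tst_smooth2 tv)).
have g21 := smooth_cont (smooth_derive (or_intror erefl) (tst_smooth1 tv)).
have g22 := smooth_cont (smooth_derive (or_intror erefl) (tst_smooth2 tv)).
have R1 := gap_real c1 g11 g21 (fun x => tst_is_derive1 x tv (or_introl erefl))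
  (fun x => tst_is_derive1 x tv (or_intror erefl)).
have R2 := gap_real c2 g12 g22 (fun x => tst_is_derive2 x tv (or_introl erefl))
  (fun x => tst_is_derive2 x tv (or_intror erefl)).
have {}R1 := R1 (fun y => ltac:(by have [-> -> _ _] := tst_edge tv y))
  (fun y => ltac:(by have [_ _ -> ->] := tst_edge tv y)).
have {}R2 := R2 (fun y => ltac:(by have [-> -> _ _] := tst_edge tv y))
  (fun y => ltac:(by have [_ _ -> ->] := tst_edge tv y)).
pose v1 := pdv (e1 R) v; pose v2 := pdv (e2 R) v.
have E (k d1 d2 : R * R -> R) : continuous k -> continuous d1 -> continuous d2 ->
  int2 1 1 (fun x => d1 x ^+ 2 + d2 x ^+ 2 - 2 * pi ^+ 2 * k x ^+ 2) =
  int2 1 1 (fun x => d1 x ^+ 2) + int2 1 1 (fun x => d2 x ^+ 2) - 2 * pi ^+ 2 * int2 1 1 (fun x => k x ^+ 2).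
  move=> ck cd1 cd2; have X (f : R * R -> R) : continuous f -> continuous (fun x => f x ^+ 2) by move=> cf; exact: contX.
  rewrite int2B ?int2D ?int2Z //; try exact: X.
  - by apply: contD; exact: X.
  - by apply: contM; [exact: cst_continuous|exact: X].
rewrite E // in R1; rewrite E // in R2.
have Nv := ip_sqrD 1 1 c1 c2.
have G e (A0 : R * R -> R) : e = e1 R \/ e = e2 R ->
    continuous (fun x => (cov A0 v (pdv e v) x).1) -> continuous (fun x => (cov A0 v (pdv e v) x).2) ->
    (forall x, rect 1 1 x -> A0 x ^+ 2 <= 10000^-1) ->
    N (pdv e v) (pdv e v) <=
      257 / 256 * N (cov A0 v (pdv e v)) (cov A0 v (pdv e v)) + 257 / 10000 * N v v.
  move=> He ca ca' HA; set g := pdv e v.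
  have cg := smooth_cont (smooth_derive He (tst_smooth1 tv)).
  have cg' := smooth_cont (smooth_derive He (tst_smooth2 tv)).
  have s1 := sqr_cont ca ca'; have s2 := sqr_cont c1 c2.
  rewrite !ip_sqrE -!int2Z // -int2D; last 2 first.
  - by apply: contM => //; exact: cst_continuous.
  - by apply: contM => //; exact: cst_continuous.
  apply: int2_le.
  - exact: sqr_cont.
  - by apply: contD; apply: contM => //; exact: cst_continuous.
  move=> x /HA; exact: cov_reverse_le.
have [H1 H2] : N v1 v1 <= 257 / 256 * N (D1 A v) (D1 A v) + 257 / 10000 * N v v /\
    N v2 v2 <= 257 / 256 * N (D2 A v) (D2 A v) + 257 / 10000 * N v v.
  split; first by apply: (G (e1 R) (fun x => (A x).1)) => //; [left|move=> x /A_le[]].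
  by apply: (G (e2 R) (fun x => (A x).2)) => //; [right|move=> x /A_le[]].
have N1 : N v1 v1 = int2 1 1 (fun x => (v1 x).1 ^+ 2) + int2 1 1 (fun x => (v1 x).2 ^+ 2).
  exact: (@ip_sqrD 1 1 v1 g11 g12).
have N2 : N v2 v2 = int2 1 1 (fun x => (v2 x).1 ^+ 2) + int2 1 1 (fun x => (v2 x).2 ^+ 2).
  exact: (@ip_sqrD 1 1 v2 g21 g22).
have [_ P] := andP (pi_sqr_bounds R).
have Nv0 : 0 <= N v v by exact: (psd_ge0 (ip_psd_tst 1 1) tv).
have PN : pi ^+ 2 * N v v <= 16 * N v v by rewrite ler_wpM2r.
have ai := amp_imul tv.
rewrite N1 Nv in H1; rewrite N2 Nv in H2; rewrite Nv in Nv0 PN.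
have Q1 := psd_ge0 excess1_psd tv; have Q2 := psd_ge0 excess2_psd tv.
rewrite /excess1 Nv in Q1; rewrite /excess2 Nv in Q2.
rewrite ai /excess1 /excess2 Nv.
exact: (gap_arith R1 R2 H1 H2 PN Nv0 Q1 Q2 (sqr_ge0 _) (sqr_ge0 _)).
Qed.

End unit_square.

(** * Smooth cut-offs and a one-dimensional trial function *)

Section flat_functions.
Variable R : realType.
Implicit Types (p : {poly R}) (s : R).

(** Products of [exp (- 1 / s)] by polynomials in [1 / s]: they form a class of
    flat functions that is closed under differentiation, as [Ck_comp] requires. *)
Definition flat p s : R := if 0 < s then p.[s^-1] * expR (- s^-1) else 0.

Lemma pow_expN_le k (r : R) : 0 <= r -> r ^+ k * expR (- r) <= k`!%:R.
Proof.
move=> r0; rewrite expRN ler_pdivrMr ?expR_gt0 //.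
case: k => [|k]; first by rewrite expr0 fact0 mul1r -expR0 ler_expR.
have := expR_ge1Dxn k r0; rewrite -(ler_pM2l (x := k.+1`!%:R)) ?ltr0n ?fact_gt0 //.
apply: le_trans; rewrite mulrDr mulr1 mulrCA mulfV ?mulr1 ?lerDr ?ler0n //.
Qed.

Lemma poly_expN_bounded p : exists2 C, 0 <= C & forall r : R, 0 <= r -> `|p.[r] * expR (- r)| <= C.
Proof.
exists (\sum_(i < size p) `|p`_i| * i`!%:R).
  by apply: sumr_ge0 => i _; rewrite mulr_ge0.
move=> r r0; rewrite horner_coef mulr_suml; apply: le_trans (ler_norm_sum _ _ _) _.
apply: ler_sum => i _; rewrite -mulrA normrM ler_wpM2l //.
by rewrite ger0_norm ?pow_expN_le // mulr_ge0 ?exprn_ge0 // expR_ge0.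
Qed.

(** Quadratic decay at the origin, which gives differentiability there. *)
Lemma flat_sqr_le p : exists2 C, 0 <= C & forall s, `|flat p s| <= C * s ^+ 2.
Proof.
have [C C0 HC] := poly_expN_bounded (p * 'X^2).
exists C => // s; rewrite /flat; case: ltP => s0; last by rewrite normr0 mulr_ge0 ?sqr_ge0.
have := HC s^-1; rewrite invr_ge0 ltW // hornerM hornerXn => /(_ isT).
rewrite -(ler_pM2r (exprn_gt0 2 s0)) => H; apply: le_trans H; rewrite le_eqVlt; apply/orP; left; apply/eqP.
rewrite mulrAC [in RHS]normrM -mulrA (ger0_norm (sqr_ge0 s^-1)) exprVn mulVf ?mulr1 //.
by rewrite expf_neq0 // gt_eqF.
Qed.

Lemma flat_derive p s : is_derive s 1 (flat p) (flat ('X^2 * (p - p^`())) s).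
Proof.
case: (ltgtP 0 s) => [s0|s0|<-].
- have near0 : \forall x \near s, p.[x^-1] * expR (- x^-1) = flat p x.
    have : \forall x \near s, 0 < x by exact: lt_nbhsr.
    by apply: filterS => x x0; rewrite /flat x0.
  apply: (near_eq_is_derive near0).
  have sn0 : s != 0 by rewrite gt_eqF.
  have Dv : is_derive (s : R) 1 (fun x : R => x^-1) (- s ^- 2).
    by have := is_deriveV sn0 (is_derive_id s (1 : R)); rewrite /GRing.scale /= mulr1.
  have D1 := is_derive_comp1 Dv (is_derive_poly p s^-1).
  have DN : is_derive (s : R) 1 (fun x : R => - x^-1) (s ^- 2).
    by have := is_deriveN Dv; rewrite opprK.
  have D2 := is_derive_comp1 DN (is_derive_expR (- s^-1)).
  apply: (is_derive_eq (is_deriveM D1 D2)).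
  by rewrite /flat s0 hornerM hornerXn hornerD hornerN exprVn /GRing.scale /=; ring.
- have near0 : \forall x \near s, 0 = flat p x.
    have : \forall x \near s, x < 0 by exact: lt_nbhsl.
    by apply: filterS => x x0; rewrite /flat ltNge ltW.
  have -> : flat ('X^2 * (p - p^`())) s = 0 by rewrite /flat ltNge ltW.
  exact: (near_eq_is_derive near0 (is_derive_cst _ _ _)).
have [C C0 HC] := flat_sqr_le p.
have f0 q : flat q 0 = 0 by rewrite /flat ltxx.
rewrite f0.
have L : h^-1 *: (flat p (h *: 1 + 0) - flat p 0) @[h --> 0^'] --> (0 : R).
  apply/cvgrPdist_le => e e0.
  have e1 : 0 < e / (C + 1) by rewrite divr_gt0 // ltr_wpDl.
  have : \forall h \near (0 : R)^', `|h| <= e / (C + 1).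
    apply: nbhs_dnbhs; exists (e / (C + 1)) => //= h /=; rewrite distrC subr0; exact: ltW.
  have : \forall h \near (0 : R)^', h != 0 by exact: nbhs_dnbhs_neq.
  apply: filterS2 => h h0 hle; rewrite sub0r normrN f0 subr0 addr0 /GRing.scale /= mulr1.
  rewrite normrM normfV ler_pdivrMl ?normr_gt0 //.
  apply: le_trans (HC h) _; rewrite -(real_normK (num_real h)) expr2 mulrCA ler_wpM2l //.
  apply: le_trans (_ : (C + 1) * (e / (C + 1)) <= _).
    by apply: ler_pM => //; rewrite lerDl.
  by rewrite mulrCA mulfV ?mulr1 // gt_eqF // ltr_wpDl.
split; last exact/cvg_lim.
by apply/cvg_ex; exists 0.
Qed.

Lemma smooth_flat p (h : R * R -> R) : smooth h -> smooth (fun x => flat p (h x)).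
Proof.
move=> sh k; apply: (@Ck_comp _ (fun f => exists p, f = flat p)) => //; last by exists p.
move=> _ [q ->]; exists (flat ('X^2 * (q - q^`()))); first by eexists.
exact: flat_derive.
Qed.

Definition step s := flat 1 s.
Definition step' s := flat ('X^2 * (1 - 1^`())) s.

Lemma step_derive s : is_derive s 1 step (step' s). Proof. exact: flat_derive. Qed.

Lemma step'E s : step' s = if 0 < s then s^-1 ^+ 2 * expR (- s^-1) else 0.
Proof.
have -> : step' s = flat 'X^2 s by rewrite /step' -polyC1 derivC subr0 polyC1 mulr1.
by rewrite /flat hornerXn.
Qed.

Lemma stepE s : step s = if 0 < s then expR (- s^-1) else 0.
Proof. by rewrite /step /flat hornerC mul1r. Qed.

Lemma step_le0 s : s <= 0 -> step s = 0.
Proof. by move=> s0; rewrite stepE ltNge s0. Qed.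

Lemma step_ge0 s : 0 <= step s.
Proof. by rewrite stepE; case: ifP => // _; exact: expR_ge0. Qed.

Lemma step_le1 s : step s <= 1.
Proof. by rewrite stepE; case: ifP => // s0; rewrite -expR0 ler_expR oppr_le0 invr_ge0 ltW. Qed.

Lemma step_ge s : 1 <= s -> expR (-1) <= step s.
Proof.
move=> s1; have s0 : 0 < s by rewrite (lt_le_trans _ s1).
by rewrite stepE s0 ler_expR lerN2 invf_le1.
Qed.

Lemma step'_ge0 s : 0 <= step' s.
Proof. by rewrite step'E; case: ifP => // _; rewrite mulr_ge0 ?sqr_ge0 ?expR_ge0. Qed.

(** The weight [(s + 1) ^ 2] is that of [cos (pi x) ^ 2] near the end of the
    segment, in the scaled variable of the cut-off; the right-hand side has the
    bounded primitive [4 * step s]. *)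
Lemma step'_sqr_le s : (s + 1) ^+ 2 * step' s ^+ 2 <= 4 * step' s.
Proof.
rewrite step'E; case: ltP => s0; last by rewrite expr0n !mulr0.
set r := s^-1; have r0 : 0 <= r by rewrite invr_ge0 ltW.
have e0 := expR_ge0 (- r).
suff H : (1 + r) ^+ 2 * expR (- r) <= 4.
  have -> : (s + 1) ^+ 2 * (r ^+ 2 * expR (- r)) ^+ 2 =
      ((1 + r) ^+ 2 * expR (- r)) * (r ^+ 2 * expR (- r)).
    by rewrite /r; field; rewrite gt_eqF.
  by apply: ler_wpM2r => //; rewrite mulr_ge0 ?sqr_ge0.
rewrite expRN ler_pdivrMr ?expR_gt0 //.
have h0 : 0 <= r / 2 by lra.
have := expR_ge1Dx (r / 2) => h1.
have h2 : (1 + r / 2) * (1 + r / 2) <= expR (r / 2) * expR (r / 2) by apply: ler_pM => //; lra.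
move: h2; rewrite -expRD -mulrDl (_ : (r + r) / 2 = r); last by field.
rewrite expr2; nra.
Qed.

End flat_functions.

Section trial_function.
Variable R : realType.
Implicit Types (f g : R -> R) (s x : R).
Variable n : R.
Hypothesis n8 : 8 <= n.
Let n0 : 0 < n. Proof. by have n8' := n8; lra. Qed.
Local Notation int1S := (int1 (- (1 / 2)) (1 / 2 : R)).

Let l s := n * (s + 1 / 2) - 1.
Let r s := n * (1 / 2 - s) - 1.
(** Vanishes within distance [n^-1] of the ends of the segment. *)
Definition cutoff s : R := step (n * (s + 1 / 2) - 1) * step (n * (1 / 2 - s) - 1).
Definition cutoff' s : R :=
  n * (step' (n * (s + 1 / 2) - 1) * step (n * (1 / 2 - s) - 1) -
       step (n * (s + 1 / 2) - 1) * step' (n * (1 / 2 - s) - 1)).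

Let Dl s : is_derive (s : R) 1 l n.
Proof.
have := is_deriveB (is_deriveZ n (is_deriveD (is_derive_id s (1 : R)) (is_derive_cst (1 / 2 : R) s (1 : R))))
  (is_derive_cst (1 : R) s (1 : R)).
by rewrite /GRing.scale /= subr0 addr0 mulr1.
Qed.

Let Dr s : is_derive (s : R) 1 r (- n).
Proof.
have := is_deriveB (is_deriveZ n (is_deriveB (is_derive_cst (1 / 2 : R) s (1 : R)) (is_derive_id s (1 : R))))
  (is_derive_cst (1 : R) s (1 : R)).
by rewrite /GRing.scale /= subr0 sub0r mulrN1.
Qed.

Lemma cutoff_derive s : is_derive (s : R) 1 cutoff (cutoff' s).
Proof.
have D1 := is_derive_comp1 (Dl s) (step_derive (l s)).
have D2 := is_derive_comp1 (Dr s) (step_derive (r s)).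
apply: (is_derive_eq (is_deriveM D1 D2)).
by rewrite /cutoff' /l /r /GRing.scale /=; ring.
Qed.

Definition profile s : R := cos (pi * s) * cutoff s.
Definition profile' s : R := cos (pi * s) * cutoff' s - pi * sin (pi * s) * cutoff s.

Lemma profile_derive s : is_derive (s : R) 1 profile (profile' s).
Proof.
apply: (is_derive_eq (is_deriveM (is_derive_cos_scaled pi s) (cutoff_derive s))).
by rewrite /profile' /GRing.scale /=; ring.
Qed.

Let step'_cont : continuous (@step' R).
Proof. exact: is_derive_cont (flat_derive _). Qed.
Let step_cont : continuous (@step R).
Proof. exact: is_derive_cont (@step_derive R). Qed.
Let l_cont : continuous l. Proof. exact: is_derive_cont Dl. Qed.
Let r_cont : continuous r. Proof. exact: is_derive_cont Dr. Qed.

Let cutoff_cont : continuous cutoff. Proof. exact: is_derive_cont cutoff_derive. Qed.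
Let cutoff'_cont : continuous cutoff'.
Proof.
apply: contM; first exact: cst_continuous.
have c1 : continuous (fun s => step (l s)) by exact: cont_comp.
have c2 : continuous (fun s => step (r s)) by exact: cont_comp.
have c3 : continuous (fun s => step' (l s)) by exact: cont_comp.
have c4 : continuous (fun s => step' (r s)) by exact: cont_comp.
by apply: contB; apply: contM.
Qed.

Let cos_cont : continuous (fun s : R => cos (pi * s)). Proof. exact: cos_scaled_cont. Qed.
Let sin_cont : continuous (fun s : R => sin (pi * s)).
Proof. exact: is_derive_cont (is_derive_sin_scaled pi). Qed.

Lemma profile_cont : continuous profile. Proof. exact: contM. Qed.
Lemma profile'_cont : continuous profile'.
Proof.
apply: contB; apply: contM => //; apply: contM => //; exact: cst_continuous.
Qed.

Lemma cos_halfpi : cos (pi * (1 / 2)) = 0 :> R.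
Proof. by rewrite mulrA mulr1 cos_pihalf. Qed.

Lemma cos_pi_le s : - (1 / 2) <= s <= 1 / 2 ->
  cos (pi * s) ^+ 2 <= pi ^+ 2 * (s + 1 / 2) ^+ 2 /\ cos (pi * s) ^+ 2 <= pi ^+ 2 * (1 / 2 - s) ^+ 2.
Proof.
move=> /andP[s1 s2]; have p0 := pi_ge0 R.
have c0 : 0 <= cos (pi * s).
  apply: cos_ge0_pihalf; apply/andP; split.
    by rewrite -mulrN ler_pM2l ?pi_gt0 //; lra.
  by rewrite ler_pM2l ?pi_gt0 //; lra.
have key u v : u <= v -> `|cos (pi * v) - cos (pi * u)| <= pi * (v - u) :> R.
  move=> uv.
  have cf : continuous (fun x : R => - sin (pi * x) * pi).
    by apply: contM; [exact: contN|exact: cst_continuous].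
  have <- : int1 u v (fun x : R => - sin (pi * x) * pi) = cos (pi * v) - cos (pi * u).
    apply: (@int1_FTC _ _ _ (fun x : R => - sin (pi * x) * pi) (fun x : R => cos (pi * x))) => [//||x _].
      exact: cont_in.
    by exact: is_derive_cos_scaled.
  have cc c : {in `[u, v], continuous (fun=> c : R)} by apply: cont_in; exact: cst_continuous.
  have b x : - pi <= - sin (pi * x) * pi <= (pi : R).
    have := sin_max (pi * x); rewrite ler_norml => /andP[a b].
    by apply/andP; split; [rewrite -mulN1r|rewrite -[leRHS]mul1r]; rewrite ler_wpM2r //; lra.
  have U := int1_le (cont_in cf) (cc pi) (fun x _ => (andP (b x)).2).
  have L := int1_le (cc (- pi)) (cont_in cf) (fun x _ => (andP (b x)).1).
  rewrite !int1_cst // in U L; rewrite ler_norml; apply/andP; split => //.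
  by rewrite -mulNr.
have e1 : cos (pi * - (1 / 2)) = 0 :> R by rewrite mulrN cosN cos_halfpi.
split; rewrite -exprMn ler_sqr ?nnegrE //.
- by have := key _ _ s1; rewrite e1 subr0 opprK ger0_norm.
- by apply: mulr_ge0 => //; lra.
- by have := key _ _ s2; rewrite cos_halfpi sub0r normrN ger0_norm.
- by apply: mulr_ge0 => //; lra.
Qed.

Let int1_step'_l : int1S (fun s => n * step' (l s)) <= 1.
Proof.
rewrite (_ : int1S _ = step (l (1 / 2)) - step (l (- (1 / 2)))).
  by rewrite lerBlDr ler_wpDr ?step_ge0 ?step_le1.
apply: (@int1_FTC _ _ _ _ (fun s : R => step (l s))); first by lra.
  by apply: cont_in; apply: contM; [exact: cst_continuous|exact: cont_comp].
by move=> x _; rewrite mulrC; exact: (is_derive_comp1 (Dl x) (step_derive (l x))).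
Qed.

Let int1_step'_r : int1S (fun s => n * step' (r s)) <= 1.
Proof.
rewrite (_ : int1S _ = - step (r (1 / 2)) - - step (r (- (1 / 2)))).
  by have := step_ge0 (r (1 / 2)); have := step_le1 (r (- (1 / 2))); lra.
apply: (@int1_FTC _ _ _ _ (fun s : R => - step (r s))); first by lra.
  by apply: cont_in; apply: contM; [exact: cst_continuous|exact: cont_comp].
move=> x _; have := is_deriveN (is_derive_comp1 (Dr x) (step_derive (r x))).
by rewrite mulrN opprK mulrC.
Qed.

(** Cutting off the ground state [cos (pi s)] costs little energy: the
    excess is the integral of [cos^2 cutoff'^2] because [cos (pi s)] solves the
    eigenvalue equation, and the cosine is small where the cut-off varies. *)
Lemma profile_energy :
  int1S (fun s => profile' s ^+ 2) <= pi ^+ 2 * int1S (fun s => profile s ^+ 2) + 16 * pi ^+ 2 / n.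
Proof.
pose H s := - (pi * (cos (pi * s) * sin (pi * s))) * cutoff s ^+ 2.
have h2 : - (1 / 2) <= 1 / 2 :> R by lra.
have cX f : continuous f -> continuous (fun s => f s ^+ 2) by move=> cf; exact: contX.
have cc c : continuous (fun _ : R => c : R) by exact: cst_continuous.
pose e s := cos (pi * s) ^+ 2 * cutoff' s ^+ 2.
have ce : continuous e by apply: contM; exact: cX.
have cb := profile_cont; have cb' := profile'_cont.
have cpb : continuous (fun s => pi ^+ 2 * profile s ^+ 2) by apply: contM => //; exact: cX.
have E : int1S (fun s => profile' s ^+ 2 - pi ^+ 2 * profile s ^+ 2 - e s) = 0.
  rewrite (_ : int1S _ = H (1 / 2) - H (- (1 / 2))).
    have H0 s : cos (pi * s) = 0 -> H s = 0 by rewrite /H => ->; rewrite mul0r mulr0 oppr0 mul0r.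
    by rewrite !H0 ?subrr // ?cos_halfpi // mulrN cosN cos_halfpi.
  have cE : continuous (fun s => profile' s ^+ 2 - pi ^+ 2 * profile s ^+ 2 - e s).
    by apply: contB => //; apply: contB => //; exact: cX.
  apply: (@int1_FTC _ _ _ (fun s => profile' s ^+ 2 - pi ^+ 2 * profile s ^+ 2 - e s) H h2 (cont_in cE)).
  move=> x _; rewrite /H.
  have D1 := is_deriveM (is_derive_cos_scaled pi x) (is_derive_sin_scaled pi x).
  have D2 := is_deriveM (cutoff_derive x) (cutoff_derive x).
  have D := is_deriveM (is_deriveN (is_deriveZ pi D1)) D2.
  rewrite (_ : (fun s => _) = (- (pi \*: ((fun s : R => cos (pi * s)) * (fun s : R => sin (pi * s)))) * (cutoff * cutoff))).
    apply: (is_derive_eq D); rewrite /profile /profile' /e /GRing.scale /=.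
    have -> : (- (pi \*: ((fun s : R => cos (pi * s)) * (fun s : R => sin (pi * s))))) x =
      - (pi * (cos (pi * x) * sin (pi * x))) by [].
    have -> : (cutoff * cutoff) x = cutoff x * cutoff x by [].
    have -> : pi ^+ 2 * (cos (pi * x) * cutoff x) ^+ 2 = pi ^+ 2 * cos (pi * x) ^+ 2 * cutoff x ^+ 2 by ring.
    by ring.
  by apply/funext => s; rewrite expr2 !fctE /GRing.scale.
have Ee : int1S e <= 16 * pi ^+ 2 / n.
  pose b s := 8 * pi ^+ 2 / n * (n * step' (l s) + n * step' (r s)).
  have c1 : continuous (fun s => n * step' (l s)) by apply: contM => //; exact: cont_comp.
  have c2 : continuous (fun s => n * step' (r s)) by apply: contM => //; exact: cont_comp.
  have cbb : continuous b by apply: contM => //; exact: contD.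
  have : int1S e <= int1S b.
    apply: int1_le; [exact: cont_in|exact: cont_in|move=> s sP].
    have [p1 p2] := cos_pi_le sP.
    rewrite /e /b /cutoff' -/(l s) -/(r s).
    set c := cos (pi * s) ^+ 2 in p1 p2 *; have c0 : 0 <= c by exact: sqr_ge0.
    have [y0 y1] := (step_ge0 (l s), step_le1 (l s)); have [z0 z1] := (step_ge0 (r s), step_le1 (r s)).
    have ql := step'_sqr_le (l s); have qr := step'_sqr_le (r s).
    rewrite (_ : l s + 1 = n * (s + 1 / 2)) in ql; last by rewrite /l; ring.
    rewrite (_ : r s + 1 = n * (1 / 2 - s)) in qr; last by rewrite /r; ring.
    set y := step (l s) in y0 y1 *; set z := step (r s) in z0 z1 *.
    have y'0 := step'_ge0 (l s); have z'0 := step'_ge0 (r s).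
    set y' := step' (l s) in y'0 ql *; set z' := step' (r s) in z'0 qr *.
    have y2 : y ^+ 2 <= 1 by rewrite expr_le1.
    have z2 : z ^+ 2 <= 1 by rewrite expr_le1.
    have P2 : 0 <= (pi : R) ^+ 2 by exact: sqr_ge0.
    have nn : 0 <= n ^+ 2 by exact: sqr_ge0.
    have A1 : n ^+ 2 * c * y' ^+ 2 <= 4 * pi ^+ 2 * y'.
      apply: le_trans (_ : pi ^+ 2 * ((n * (s + 1 / 2)) ^+ 2 * y' ^+ 2) <= _).
        rewrite exprMn (_ : pi ^+ 2 * _ = n ^+ 2 * (pi ^+ 2 * (s + 1 / 2) ^+ 2) * y' ^+ 2); last by ring.
        by rewrite ler_wpM2r ?sqr_ge0 // ler_wpM2l.
      by rewrite (_ : 4 * pi ^+ 2 * y' = pi ^+ 2 * (4 * y')); [rewrite ler_wpM2l|ring].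
    have A2 : n ^+ 2 * c * z' ^+ 2 <= 4 * pi ^+ 2 * z'.
      apply: le_trans (_ : pi ^+ 2 * ((n * (1 / 2 - s)) ^+ 2 * z' ^+ 2) <= _).
        rewrite exprMn (_ : pi ^+ 2 * _ = n ^+ 2 * (pi ^+ 2 * (1 / 2 - s) ^+ 2) * z' ^+ 2); last by ring.
        by rewrite ler_wpM2r ?sqr_ge0 // ler_wpM2l.
      by rewrite (_ : 4 * pi ^+ 2 * z' = pi ^+ 2 * (4 * z')); [rewrite ler_wpM2l|ring].
    have nc : 0 <= n ^+ 2 * c by exact: mulr_ge0.
    have B1 : n ^+ 2 * c * y' ^+ 2 * z ^+ 2 <= n ^+ 2 * c * y' ^+ 2.
      exact: (ler_piMr (mulr_ge0 nc (sqr_ge0 y')) z2).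
    have B2 : n ^+ 2 * c * z' ^+ 2 * y ^+ 2 <= n ^+ 2 * c * z' ^+ 2.
      exact: (ler_piMr (mulr_ge0 nc (sqr_ge0 z')) y2).
    have S : 0 <= n ^+ 2 * c * (y' * z + y * z') ^+ 2 by exact: (mulr_ge0 nc (sqr_ge0 _)).
    rewrite (_ : c * (n * (y' * z - y * z')) ^+ 2 =
      2 * (n ^+ 2 * c * y' ^+ 2 * z ^+ 2) + 2 * (n ^+ 2 * c * z' ^+ 2 * y ^+ 2) -
      n ^+ 2 * c * (y' * z + y * z') ^+ 2); last by ring.
    rewrite (_ : 8 * pi ^+ 2 / n * (n * y' + n * z') = 2 * (4 * pi ^+ 2 * y') + 2 * (4 * pi ^+ 2 * z')); last first.
      by field; rewrite gt_eqF.
    apply: (le_trans (y := 2 * (n ^+ 2 * c * y' ^+ 2 * z ^+ 2) + 2 * (n ^+ 2 * c * z' ^+ 2 * y ^+ 2))).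
      by rewrite gerBl.
    by apply: lerD; rewrite ler_pM2l //; [exact: le_trans B1 A1|exact: le_trans B2 A2].
  move=> /le_trans; apply; rewrite /b int1Z; last by apply: cont_in; exact: contD.
  rewrite int1D; [|exact: cont_in|exact: cont_in].
  apply: le_trans (_ : 8 * pi ^+ 2 / n * 2 <= _).
    apply: ler_wpM2l; first by apply: divr_ge0; [apply: mulr_ge0 => //; exact: sqr_ge0|exact: ltW].
    exact: le_trans (lerD int1_step'_l int1_step'_r) _.
  by rewrite le_eqVlt; apply/orP; left; apply/eqP; field; rewrite gt_eqF.
have cd : continuous (fun s => profile' s ^+ 2 - pi ^+ 2 * profile s ^+ 2) by apply: contB => //; exact: cX.
move: E; rewrite (int1B (cont_in cd) (cont_in ce)) (int1B (cont_in (cX _ cb')) (cont_in cpb)).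
rewrite (int1Z _ (cont_in (cX _ cb))).
by move: Ee; move: (int1S e) => w Ew /eqP; rewrite subr_eq add0r subr_eq => /eqP ->; rewrite addrC lerD2l.
Qed.

Lemma profile_mass : expR (-1) ^+ 4 / 4 <= int1S (fun s => profile s ^+ 2).
Proof.
have cb : continuous (fun s => profile s ^+ 2) by apply: contX; exact: profile_cont.
have n8' := n8.
have := @int1_sub _ (- (1 / 2)) (1 / 2) (- (1 / 4)) (1 / 4) (fun s => profile s ^+ 2).
have h1 : - (1 / 2) <= - (1 / 4) :> R by lra.
have h2 : - (1 / 4) <= 1 / 4 :> R by lra.
have h3 : 1 / 4 <= 1 / 2 :> R by lra.
move=> /(_ h1 h2 h3 (cont_in cb) (fun z _ => sqr_ge0 _)); apply: le_trans.
have <- : int1 (- (1 / 4)) (1 / 4) (fun=> expR (-1) ^+ 4 / 2) = expR (-1) ^+ 4 / 4 :> R.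
  by rewrite int1_cst //; field.
apply: int1_le; [by apply: cont_in; exact: cst_continuous|exact: cont_in|move=> s /andP[s1 s2]].
have e0 : 0 <= expR (-1 : R) by exact: expR_ge0.
have ns : n * (1 / 4) <= n * (s + 1 / 2) by rewrite ler_pM2l //; lra.
have ns' : n * (1 / 4) <= n * (1 / 2 - s) by rewrite ler_pM2l //; lra.
have y1 : expR (-1) <= step (l s) by apply: step_ge; rewrite /l; lra.
have z1 : expR (-1) <= step (r s) by apply: step_ge; rewrite /r; lra.
have cut : expR (-1) * expR (-1) <= cutoff s by apply: ler_pM.
have cut2 : (expR (-1) * expR (-1)) ^+ 2 <= cutoff s ^+ 2.
  by rewrite ler_sqr ?nnegrE ?mulr_ge0 ?step_ge0.
have c2 : 2^-1 <= cos (pi * s) ^+ 2.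
  have p0 := pi_gt0 R.
  have : 0 <= cos (pi * s + pi * s).
    apply: cos_ge0_pihalf; rewrite -mulrDr; apply/andP; split.
      by rewrite -mulrN ler_pM2l //; lra.
    by rewrite ler_pM2l //; lra.
  by rewrite cosD -!expr2 sin2cos2; lra.
rewrite /profile exprMn (_ : expR (-1) ^+ 4 / 2 = 2^-1 * (expR (-1) * expR (-1)) ^+ 2); last by ring.
by apply: ler_pM => //; rewrite sqr_ge0.
Qed.

Lemma profile_out s : profile s <> 0 -> - (1 / 2) + n^-1 <= s <= 1 / 2 - n^-1.
Proof.
move=> b0; have [l0|l0] := leP (n * (s + 1 / 2) - 1) 0.
  by case: b0; rewrite /profile /cutoff step_le0 // mul0r mulr0.
have [r0|r0] := leP (n * (1 / 2 - s) - 1) 0.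
  by case: b0; rewrite /profile /cutoff (step_le0 r0) !mulr0.
have : n^-1 < s + 1 / 2 by rewrite -[n^-1]mulr1 ltr_pdivrMl //; lra.
have : n^-1 < 1 / 2 - s by rewrite -[n^-1]mulr1 ltr_pdivrMl //; lra.
by move=> *; apply/andP; split; lra.
Qed.

Lemma smooth_profile (h : R * R -> R) : smooth h -> smooth (fun z => profile (h z)).
Proof.
move=> sh; apply: smoothM.
  by apply: smooth_cos; apply: smoothM => //; exact: smooth_cst.
have s1 c : smooth (fun _ : R * R => c : R) by exact: smooth_cst.
apply: smoothM; apply: smooth_flat.
  apply: (smoothD (f := fun z => n * (h z + 1 / 2))) => //.
  by apply: smoothM => //; exact: smoothD.
apply: (smoothD (f := fun z => n * (1 / 2 - h z))) => //.
by apply: smoothM => //; apply: smoothD => //; exact: smoothN.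
Qed.

End trial_function.

(** * A trial function in the magnetic field *)

Section near_ground_state.
Variables (R : realType) (B : R).
Local Notation W := (tst (1 : R) 1).
Local Notation N := (ip (1 : R) 1).
Local Notation A := (sgauge B).
Local Notation int1S := (int1 (- (1 / 2)) (1 / 2 : R)).

Lemma int2_prod (f g : R -> R) : continuous f -> continuous g ->
  int2 1 1 (fun x : R * R => f x.1 * g x.2) = int1S f * int1S g.
Proof.
move=> cf cg.
have c1 := smooth_cont (@smooth_fst R); have c2 := smooth_cont (@smooth_snd R).
have ch : continuous (fun x : R * R => f x.1 * g x.2).
  by apply: contM; [exact: (cont_comp c1 cf)|exact: (cont_comp c2 cg)].
rewrite (int2_fubini12 _ _ ch) /= -(mulrC (int1S g)) -int1Z; last exact: cont_in.
by apply: eq_int1 => x _; rewrite (int1Z _ (cont_in cg)) mulrC.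
Qed.

(** In the gauge in which the potential is purely vertical, the trial function
    is a product of two cut-off cosines: its horizontal energy is that of the
    problem without field, and its vertical energy exceeds it by at most
    [B ^ 2 / 4], as the vertical potential is [B x.1]. *)
Lemma near_minimizer eta : 0 < eta -> exists w,
  [/\ W w, 0 < N w w, excess1 B w w <= eta * N w w & excess2 B w w <= (eta + B ^+ 2 / 4) * N w w].
Proof.
move=> eta0; have P2 : 0 <= (pi : R) ^+ 2 by exact: sqr_ge0.
pose m0 : R := expR (-1) ^+ 4 / 4.
have m00 : 0 < m0 by rewrite divr_gt0 // exprn_gt0 // expR_gt0.
pose n : R := 8 + 16 * pi ^+ 2 / (eta * m0).
have K0 : 0 <= 16 * pi ^+ 2 / (eta * m0).
  by apply: divr_ge0; [apply: mulr_ge0|apply: ltW; apply: mulr_gt0].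
have n8 : 8 <= n by rewrite /n lerDl.
have n0 : 0 < n by apply: lt_le_trans n8.
have nb : 16 * pi ^+ 2 / n <= eta * m0.
  by rewrite ler_pdivrMr // -ler_pdivrMl ?mulr_gt0 // [leLHS]mulrC /n lerDr.
pose b := profile n; pose b' := profile' n.
have cb : continuous b by exact: profile_cont.
have cb' : continuous b' by exact: profile'_cont.
pose m := int1S (fun s => b s ^+ 2); pose d := int1S (fun s => b' s ^+ 2).
have mm : m0 <= m by exact: profile_mass n8.
have m_gt0 : 0 < m by exact: lt_le_trans mm.
have dm : d <= pi ^+ 2 * m + eta * m.
  apply: le_trans (profile_energy n8) _; rewrite lerD2l; apply: le_trans nb _.
  by rewrite ler_pM2l.
pose u : R * R -> R * R := fun x => (b x.1 * b x.2, 0).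
have su1 : smooth (fun x => (u x).1).
  by apply: smoothM; apply: smooth_profile; [exact: smooth_fst|exact: smooth_snd].
have su2 : smooth (fun x => (u x).2) by exact: smooth_cst.
have tu : W u.
  have i0 : 0 < n^-1 by rewrite invr_gt0.
  pose s0 : R := 1 / 2 - n^-1.
  pose K : set (R * R) := `[(- s0), s0]%classic `*` `[(- s0), s0]%classic.
  have cK : compact K by apply: compact_setX; exact: segment_compact.
  have sub : closure [set x | cpx u x <> 0] `<=` K.
    apply: (subset_trans (B := closure K)).
      apply: closureS => x /= ux; split; rewrite /= in_itv /=.
        rewrite opprB addrC; apply: (profile_out n8) => bx; apply: ux.
        by apply/cpx_eq0; rewrite /u -/(b _) /b bx mul0r.
      rewrite opprB addrC; apply: (profile_out n8) => bx; apply: ux.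
      by apply/cpx_eq0; rewrite /u -/(b _) /b bx mulr0.
    by rewrite -(closure_id _).1 //; apply: compact_closed => //; exact: norm_hausdorff.
  split => //; first by apply: subclosed_compact sub => //; exact: closed_closure.
  move=> x /sub [] /=; rewrite !in_itv /= /s0 => /andP[x1 x2] /andP[y1 y2].
  by split; apply/andP; split; lra.
(* This phase carries the potential [(0, B x.1)] to the linear potential
   [sgauge B]. *)
pose chi : R * R -> R := fun x => - (B / 2) * (x.1 * x.2).
have schi : smooth chi.
  apply: smoothM; first exact: smooth_cst.
  by apply: smoothM; [exact: smooth_fst|exact: smooth_snd].
have dchi1 x : 'D_(e1 R) chi x = (A x).1 - 0.
  have D : is_derive x (e1 R) chi (- (B / 2) * x.2).
    apply/is_derive_e1P; have := is_deriveZ (- (B / 2) * x.2) (is_derive_id x.1 (1 : R)).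
    rewrite /GRing.scale /= mulr1; congr is_derive.
    apply/funext => s; change (- (B / 2) * x.2 * s = - (B / 2) * (s * x.2)); ring.
  by rewrite subr0 /sgauge /= -mulNr; have [_ ->] := D.
have dchi2 x : 'D_(e2 R) chi x = (A x).2 - B * x.1.
  have D : is_derive x (e2 R) chi (- (B / 2) * x.1).
    apply/is_derive_e2P; have := is_deriveZ (- (B / 2) * x.1) (is_derive_id x.2 (1 : R)).
    rewrite /GRing.scale /= mulr1; congr is_derive.
    apply/funext => s; change (- (B / 2) * x.1 * s = - (B / 2) * (x.1 * s)); ring.
  by have [_ ->] := D; rewrite /sgauge /=; field.
pose w := gauge chi u.
have tw : W w by exact: tst_gauge.
have db s : is_derive (s : R) 1 b (b' s) by exact: profile_derive.
have p1 x : pdv (e1 R) u x = (b' x.1 * b x.2, 0).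
  congr pair; last by have [_ ->] := is_derive_cst (0 : R) x (e1 R).
  have := is_deriveZ (b x.2) (db x.1).
  have -> : (b x.2 \*: b) = (fun s => b s * b x.2) by apply/funext => s; rewrite /GRing.scale /= mulrC.
  move=> H; have := iffRL (is_derive_e1P (fun y => (u y).1) x _) H => -[_ ->].
  by rewrite /GRing.scale /= mulrC.
have p2 x : pdv (e2 R) u x = (b x.1 * b' x.2, 0).
  congr pair; last by have [_ ->] := is_derive_cst (0 : R) x (e2 R).
  have H := is_deriveZ (b x.1) (db x.2).
  by have := iffRL (is_derive_e2P (fun y => (u y).1) x _) H => -[_ ->].
have sqc (f : R -> R) : continuous f -> continuous (fun s => f s ^+ 2) by move=> cf; exact: contX.
have Nw : N w w = m * m.
  rewrite (@ip_gauge _ _ _ chi u) // ip_sqrE -int2_prod; [|exact: sqc|exact: sqc].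
  by apply: eq_int2 => x _; rewrite /u /= expr0n addr0 exprMn.
have N1 : N (D1 A w) (D1 A w) = d * m.
  rewrite (@ip_gauge _ _ _ chi (cov (fun=> 0) u (pdv (e1 R) u))); last first.
    by move=> x _; exact: (gauge_cov (or_introl erefl) schi su1 su2 (dchi1 x)).
  rewrite ip_sqrE -int2_prod; [|exact: sqc|exact: sqc].
  by apply: eq_int2 => x _; rewrite /cov p1 /= !mul0r subr0 addr0 expr0n addr0 exprMn.
have N2 : N (D2 A w) (D2 A w) <= d * m + B ^+ 2 / 4 * (m * m).
  rewrite (@ip_gauge _ _ _ chi (cov (fun x => B * x.1) u (pdv (e2 R) u))); last first.
    by move=> x _; exact: (gauge_cov (A := fun x => B * x.1) (or_intror erefl) schi su1 su2 (dchi2 x)).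
  have c1 := smooth_cont (@smooth_fst R); have c2 := smooth_cont (@smooth_snd R).
  have pc (f g : R -> R) : continuous f -> continuous g ->
      continuous (fun x : R * R => f x.1 * g x.2).
    by move=> cf cg; apply: contM; [exact: (cont_comp c1 cf)|exact: (cont_comp c2 cg)].
  rewrite [d * m]mulrC -!int2_prod; [|exact: sqc..].
  rewrite -int2Z -?int2D; [|exact: (pc _ _ (sqc _ cb) (sqc _ cb'))| |exact: (pc _ _ (sqc _ cb) (sqc _ cb))]; last first.
    by apply: contM; [exact: cst_continuous|exact: (pc _ _ (sqc _ cb) (sqc _ cb))].
  rewrite ip_sqrE; apply: int2_le.
  - rewrite (_ : (fun x => _) = (fun x => (b x.1 * b' x.2) ^+ 2 + (B * x.1 * (b x.1 * b x.2)) ^+ 2)); last first.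
      by apply/funext => x; rewrite /cov p2 /= mulr0 addr0 sub0r sqrrN.
    apply: contD; apply: contX; first exact: pc.
    by apply: contM; [apply: contM => //; exact: cst_continuous|exact: pc].
  - apply: contD; first exact: (pc _ _ (sqc _ cb) (sqc _ cb')).
    by apply: contM; [exact: cst_continuous|exact: (pc _ _ (sqc _ cb) (sqc _ cb))].
  - move=> x [/andP[x1 x2] _]; rewrite /cov p2 /= mulr0 addr0 sub0r sqrrN.
    move: (b x.1) (b x.2) (b' x.2) => b1 b2 b2'; rewrite !exprMn lerD2l.
    have x4 : x.1 ^+ 2 <= 4^-1.
      rewrite -(real_normK (num_real x.1)) expr2.
      have h : `|x.1| <= 2^-1 by rewrite ler_norml; apply/andP; split; lra.
      apply: le_trans (_ : 2^-1 * 2^-1 <= _); first exact: ler_pM.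
      by rewrite -invfM -natrM.
    rewrite ler_wpM2r //; first by apply: mulr_ge0; exact: sqr_ge0.
    by rewrite ler_wpM2l // sqr_ge0.
exists w; split => //; rewrite /excess1 /excess2 ?Nw.
- exact: mulr_gt0.
- rewrite N1 mulrA [eta * (m * m)]mulrA -mulrBl ler_pM2r //; move: dm.
  by rewrite [leRHS]addrC -lerBlDr.
rewrite lerBlDr; apply: le_trans N2 _.
rewrite mulrDl [leRHS]addrAC lerD2r !mulrA -mulrDl ler_pM2r //.
by rewrite addrC.
Qed.

End near_ground_state.

(** * Reduction of the rectangles to the square *)

Section transfer.
Variables (R : realType) (B a : R) (A : R * R -> R * R).
Hypotheses (a0 : 0 < a) (mpA : magnetic_potential B (rect a a^-1) A).
Local Notation V := (R * R -> R * R).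
Local Notation A0 := (sgauge B).
Local Notation As := (adil a a^-1 A).
Local Notation N := (ip (1 : R) 1).

Let an0 : a != 0. Proof. by rewrite gt_eqF. Qed.
Let aV0 : 0 < a^-1. Proof. by rewrite invr_gt0. Qed.

Lemma adil_smooth1 : smooth (fun x => (As x).1).
Proof.
have [s1 _ _] := mpA; apply: smoothM; first exact: smooth_cst.
by move=> k; exact: (Ck_diag a a^-1 (s1 k)).
Qed.

Lemma adil_smooth2 : smooth (fun x => (As x).2).
Proof.
have [_ s2 _] := mpA; apply: smoothM; first exact: smooth_cst.
by move=> k; exact: (Ck_diag a a^-1 (s2 k)).
Qed.

Lemma rect_dil x : rect 1 1 x -> rect a a^-1 (a * x.1, a^-1 * x.2).
Proof.
have a0' := a0; have aV0' := aV0.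
have h (c s : R) : 0 < c -> - (1 / 2) < s < 1 / 2 -> - (c / 2) < c * s < c / 2.
  have E : c / 2 = c * (1 / 2) by rewrite mul1r.
  by move=> c0; rewrite E -[- (c * _)]mulrN !ltr_pM2l.
by move=> [x1 x2]; split; apply: h.
Qed.

Lemma gauge_to_symmetric : exists2 chi, smooth chi & forall x, rect 1 1 x ->
  'D_(e1 R) chi x = (As x).1 - (A0 x).1 /\ 'D_(e2 R) chi x = (As x).2 - (A0 x).2.
Proof.
have [s1 s2 curl] := mpA.
have b1 : smooth (fun x => (As x).1 - (A0 x).1).
  by apply: smoothD; [exact: adil_smooth1|exact: smoothN (sgauge_smooth1 B)].
have b2 : smooth (fun x => (As x).2 - (A0 x).2).
  by apply: smoothD; [exact: adil_smooth2|exact: smoothN (sgauge_smooth2 B)].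
apply: (poincare b1 b2) => x Rx.
have He1 : e1 R = e1 R \/ e1 R = e2 R by left.
have He2 : e2 R = e1 R \/ e2 R = e2 R by right.
have [_ ->] := is_deriveB (Ck_is_derive x He1 (adil_smooth2 1%N)) (Ck_is_derive x He1 (sgauge_smooth2 B 1%N)).
have [_ ->] := is_deriveB (Ck_is_derive x He2 (adil_smooth1 1%N)) (Ck_is_derive x He2 (sgauge_smooth1 B 1%N)).
have E2 : 'D_(e1 R) (fun y => (As y).2) x = 'D_(e1 R) (fun y => (A y).2) (a * x.1, a^-1 * x.2).
  have C : Ck 1 (fun y => (A (a * y.1, a^-1 * y.2)).2) by exact: (Ck_diag a a^-1 (s2 1%N)).
  have [_ ->] := is_deriveZ a^-1 (Ck_is_derive x He1 C).
  by have := derive_e1_dil a a^-1 x (s2 1%N) => /= ->; rewrite /GRing.scale /= mulKf.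
have E1 : 'D_(e2 R) (fun y => (As y).1) x = 'D_(e2 R) (fun y => (A y).1) (a * x.1, a^-1 * x.2).
  have C : Ck 1 (fun y => (A (a * y.1, a^-1 * y.2)).1) by exact: (Ck_diag a a^-1 (s1 1%N)).
  have [_ ->] := is_deriveZ a (Ck_is_derive x He2 C).
  by have := derive_e2_dil a a^-1 x (s1 1%N) => /= ->; rewrite /GRing.scale /= mulVKf.
have E3 : 'D_(e1 R) (fun y => (A0 y).2) x = B / 2.
  have D : is_derive x (e1 R) (fun y => (A0 y).2) (B / 2).
    apply/is_derive_e1P; have := is_deriveZ (B / 2) (is_derive_id x.1 (1 : R)).
    by rewrite /GRing.scale /= mulr1.
  by have [_ ->] := D.
have E4 : 'D_(e2 R) (fun y => (A0 y).1) x = - (B / 2).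
  have D : is_derive x (e2 R) (fun y => (A0 y).1) (- (B / 2)).
    apply/is_derive_e2P; have := is_deriveN (is_deriveZ (B / 2) (is_derive_id x.2 (1 : R))).
    by rewrite /GRing.scale /= mulr1.
  by have [_ ->] := D.
rewrite E1 E2 E3 E4; have := curl _ (rect_dil Rx); lra.
Qed.

(** Unitary equivalence with the square: a gauge transformation followed by a
    dilation turns the energy on the rectangle into an anisotropic energy on the
    square, with the same linear potential for all rectangles. *)
Lemma square_transfer : exists T : V -> V, [/\
  forall u, tst 1 1 u -> tst a a^-1 (T u),
  forall u v, T (u - v) = T u - T v,
  forall v, tst a a^-1 v -> exists2 u, tst 1 1 u & v = T u,
  forall u, tst 1 1 u -> ip a a^-1 (T u) (T u) = N u u &
  forall u, tst 1 1 u -> qA a a^-1 A (T u) (T u) =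
    (a ^+ 2)^-1 * N (D1 A0 u) (D1 A0 u) + a ^+ 2 * N (D2 A0 u) (D2 A0 u)].
Proof.
have [chi schi dchi] := gauge_to_symmetric.
have a0' := a0; have aV0' := aV0; have an0' := an0.
have smA : smooth (fun x => - chi x) by exact: smoothN.
pose T u := dil a^-1 a (gauge chi u).
have dd u : dil a^-1 a (dil a a^-1 u) = u.
  by apply/funext => -[x y]; rewrite /dil /= mulVKf // mulKf.
have AE : adil a^-1 a As = A.
  apply/funext => -[x y]; rewrite /adil /= !mulVKf // !mulKf //.
  by case: (A _).
have ipd w : continuous (fun x => (w x).1) -> continuous (fun x => (w x).2) ->
    ip a a^-1 (dil a^-1 a w) (dil a^-1 a w) = N w w.
  move=> c1 c2; have := ip_dil (ltW a0) (ltW aV0) aV0 a0 c1 c2.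
  by rewrite mulVf // mul1r mulfV.
have ipZ c w : continuous (fun x => (w x).1) -> continuous (fun x => (w x).2) ->
    ip a a^-1 (c *: dil a^-1 a w) (c *: dil a^-1 a w) = c ^+ 2 * N w w.
  move=> c1 c2; rewrite -(ipd _ c1 c2) !ip_sqrE -int2Z.
    by apply: eq_int2 => x _; rewrite !fE; ring.
  have cd (h : R * R -> R) : continuous h -> continuous (fun x : R * R => h (a^-1 * x.1, a * x.2)).
    move=> ch; apply: cont_comp => //; have cf := smooth_cont (@smooth_fst R).
    have cs := smooth_cont (@smooth_snd R).
    by apply: cont_pair; apply: contM => //; exact: cst_continuous.
  exact: (sqr_cont (cd _ c1) (cd _ c2)).
exists T; split.
- move=> u tu; apply: tst_dil => //; rewrite mulVf // mulfV //; exact: tst_gauge.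
- by move=> u v; rewrite /T gaugeB; apply/funext => x.
- move=> v tv; exists (gauge (fun x => - chi x) (dil a a^-1 v)).
    by apply: tst_gauge => //; apply: tst_dil => //; rewrite !mulr1.
  by rewrite /T gaugeK dd.
- move=> u tu; have [c1 c2] := tst_cont (tst_gauge schi tu).
  by rewrite ipd // (@ip_gauge _ _ _ chi u).
- move=> u tu; have tg := tst_gauge schi tu.
  have s1 := tst_smooth1 tu; have s2 := tst_smooth2 tu.
  rewrite /qA mul1r -[in D1 A _]AE -[in D2 A _]AE /T.
  rewrite (D1_dil As a^-1 a tg) (D2_dil As a^-1 a tg).
  have [c1 c2] := D1_cont adil_smooth1 tg; have [d1 d2] := D2_cont adil_smooth2 tg.
  rewrite (ipZ _ _ c1 c2) (ipZ _ _ d1 d2) exprVn; congr (_ * _ + _ * _).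
    apply: (@ip_gauge _ _ _ chi) => x /dchi [E _].
    exact: (gauge_cov (or_introl erefl) schi s1 s2 E).
  apply: (@ip_gauge _ _ _ chi) => x /dchi [_ E].
  exact: (gauge_cov (or_intror erefl) schi s1 s2 E).
Qed.

End transfer.

(** * Comparison of the ground state energies *)

Section trial_constants.
Variable R : realType.

Lemma trial_energy_arith (t b n x y : R) : 0 < t -> t <= 1 -> b <= 100^-1 -> 0 <= n ->
  x <= t ^+ 2 / 144 * n -> y <= (t ^+ 2 / 144 + b / 4) * n ->
  6 * t^-1 * (t^-1 * x + t * y) <= 4^-1 * n.
Proof.
move=> t0 t1; have t2 : t ^+ 2 <= 1 by have := ler_pM (ltW t0) (ltW t0) t1 t1; rewrite mulr1 expr2.
move=> b1 n0 h1 h2; have -> : 6 * t^-1 * (t^-1 * x + t * y) = 6 * (t ^+ 2)^-1 * x + 6 * y.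
  by field; rewrite gt_eqF.
have k1 : 6 * (t ^+ 2)^-1 * x <= 24^-1 * n.
  apply: le_trans (_ : 6 * (t ^+ 2)^-1 * (t ^+ 2 / 144 * n) <= _).
    by rewrite ler_wpM2l // mulr_ge0 // invr_ge0 sqr_ge0.
  by rewrite le_eqVlt; apply/orP; left; apply/eqP; field; rewrite gt_eqF.
have k2 : y <= (144^-1 + 100^-1 / 4) * n.
  apply: le_trans h2 _; rewrite ler_wpM2r //.
  by apply: lerD; last rewrite ler_wpM2r //; rewrite -[leRHS]mul1r ler_wpM2r.
by move: k1 k2 n0; move: (6 * (t ^+ 2)^-1 * x) => z; clear; move=> *; lra.
Qed.

End trial_constants.

Section ground_energy.
Variables (R : realType) (B : R).
Hypothesis Bs : `|B| <= 100^-1.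
Local Notation W := (tst (1 : R) 1).
Local Notation N := (ip (1 : R) 1).
Local Notation A0 := (sgauge B).
Local Notation q1 := (excess1 B).
Local Notation q2 := (excess2 B).
Local Notation amp := (@amp R).
Implicit Types (t e eta : R) (u v w : R * R -> R * R).

(** The energy of the rectangle with [t = a ^ 2] in excess of its lowest
    eigenvalue without field, as a form on the square. *)
Definition qt t u v : R := t^-1 * q1 u v + t * q2 u v.

Lemma qt_psd t : 0 < t -> psd W (qt t).
Proof.
move=> t0; have [D1 Z1 S1 P1] := excess1_psd B; have [D2 Z2 S2 P2] := excess2_psd B; split.
- by move=> u v w Wu Wv Ww; rewrite /qt D1 // D2 //; ring.
- by move=> c u w Wu Ww; rewrite /qt Z1 // Z2 //; ring.
- by move=> u v Wu Wv; rewrite /qt S1 // S2.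
- have tV0 : 0 < t^-1 by rewrite invr_gt0.
  by move=> u Wu; exact: (addr_ge0 (mulr_ge0 (ltW tV0) (P1 _ Wu)) (mulr_ge0 (ltW t0) (P2 _ Wu))).
Qed.

Lemma qt_Jinv t : Jinv W (@imul R) (qt t).
Proof. by move=> u v Wu Wv; rewrite /qt excess1_Jinv // excess2_Jinv. Qed.

Lemma B_sqr_le : B ^+ 2 <= 100^-1.
Proof.
rewrite -(real_normK (num_real B)) expr2.
rewrite -[leRHS]mulr1; apply: ler_pM => //; apply: le_trans Bs _.
by rewrite invf_le1 // ler1n.
Qed.

(** The factor [t^-1] is large and multiplies the horizontal energy, so that the
    magnetic energy of the trial function must be vertical. *)
Lemma qt_small_le1 t : 0 < t -> t <= 1 ->
  exists w, [/\ W w, 0 < N w w & 6 * t^-1 * qt t w w <= 4^-1 * N w w].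
Proof.
move=> t0 t1; have e0 : 0 < t ^+ 2 / 144 by rewrite divr_gt0 // exprn_gt0.
have [w [Ww Nw h1 h2]] := near_minimizer B e0; exists w.
by split; [exact: Ww|exact: Nw|exact: (trial_energy_arith t0 t1 B_sqr_le (ltW Nw) h1 h2)].
Qed.

(** For [1 <= t] a quarter turn reduces to [t^-1]. The constant is half of what
    the minimization asks for: on the square this makes [mu] at most [24^-1]. *)
Lemma qt_small t : 0 < t ->
  exists w, [/\ W w, 0 < N w w & 6 * Num.max t t^-1 * qt t w w <= 4^-1 * N w w].
Proof.
move=> t0; have [t1|t1] := leP t 1.
  have [w Hw] := qt_small_le1 t0 t1; exists w.
  by rewrite max_r // (le_trans t1) // invf_ge1.
have tV0 : 0 < t^-1 by rewrite invr_gt0.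
have tV1 : t^-1 <= 1 by rewrite invf_le1 // ltW.
have [w [Ww Nw Hw]] := qt_small_le1 tV0 tV1; exists (qturn w); split.
- exact: tst_qturn.
- by rewrite N_qturn.
- rewrite max_l; last by rewrite (le_trans tV1) // ltW.
  rewrite N_qturn //; apply: le_trans Hw; rewrite invrK /qt excess1_qturn // excess2_qturn // invrK.
  by rewrite addrC.
Qed.

(** Both weights [t^-1] and [t] are at least the inverse of [Num.max t t^-1]. *)
Lemma gap_qt t v : 0 < t -> W v ->
  N v v <= 8 * (amp v ^+ 2 + amp (imul v) ^+ 2) + 6 * Num.max t t^-1 * qt t v v.
Proof.
move=> t0 Wv; apply: le_trans (gap_magnetic Bs Wv) _.
rewrite lerD2l mul1r -mulrA ler_pM2l // /qt mulrDr.
have Q1 := psd_ge0 (excess1_psd B) Wv; have Q2 := psd_ge0 (excess2_psd B) Wv.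
have tV0 : 0 < t^-1 by rewrite invr_gt0.
have tn0 : t != 0 by rewrite gt_eqF.
apply: lerD.
  rewrite mulrA -[leLHS]mul1r ler_wpM2r // -(mulfV tn0).
  by rewrite ler_pM2r // le_max lexx.
rewrite mulrA -[leLHS]mul1r ler_wpM2r // -(mulVf tn0).
by rewrite ler_pM2r // le_max lexx orbT.
Qed.

Lemma inv_succ_eventually e : 0 < e -> exists M : nat, forall n, (M <= n)%N -> n.+1%:R^-1 <= e.
Proof.
move=> e0; have [M _ HM] := near_infty_natSinv_lt (PosNum e0).
by exists M => n Mn; apply: ltW; exact: HM.
Qed.

(** The forms on the square satisfy the assumptions of the abstract
    minimization, and [square_transfer] carries the minimizing sequence to the
    rectangle. *)
Lemma ground_energy a A : 0 < a -> magnetic_potential B (rect a a^-1) A ->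
  exists mu, [/\ 0 <= mu, Num.max (a ^+ 2) (a ^+ 2)^-1 * mu <= 24^-1,
    lowest_eigenvalue (rect a a^-1) A (pi ^+ 2 * ((a ^+ 2)^-1 + a ^+ 2) + mu),
    forall v, W v -> mu * N v v <= qt (a ^+ 2) v v &
    forall e, 0 < e -> exists u, [/\ W u, amp u = 1, amp (imul u) = 0 &
      qt (a ^+ 2) u u - mu * N u u <= e]].
Proof.
move=> a0 mpA; set t := a ^+ 2; have t0 : 0 < t by exact: exprn_gt0.
set M := Num.max t t^-1; pose K := 6 * M.
have M0 : 0 < M by rewrite lt_max t0.
have K0 : 0 < K by exact: mulr_gt0.
have St := tst_subspace 1 1 : linear_subspace W.
have WJ u : W u -> W (imul u) by exact: tst_imul.
have JJ u : W u -> imul (imul u) = - u by move=> _; exact: iimul.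
have JD u v : W u -> W v -> imul (u + v) = imul u + imul v by move=> _ _; exact: imulD.
have JZ c u : W u -> imul (c *: u) = c *: imul u by move=> _; exact: imulZ.
have pN := ip_psd_tst 1 1 : psd W N.
have [w0 [Ww0 Nw0 Hw0]] := qt_small t0.
have Hw0' : K * qt t w0 w0 <= 2^-1 * N w0 w0.
  by apply: le_trans Hw0 _; rewrite ler_pM2r //; lra.
have gap v (Wv : W v) := gap_qt t0 Wv.
have [mu [mu0 Kmu muw0 muq [u Hu]]] := minimizing_sequence St WJ JJ JD JZ pN (@N_Jinv R)
  (@ampD R) (@ampZ R) (qt_psd t0) (@qt_Jinv t) K0 gap Ww0 Nw0 Hw0'.
have Wu n : W (u n) by have [] := Hu n.
have lu n : amp (u n) = 1 by have [] := Hu n.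
have lJu n : amp (imul (u n)) = 0 by have [] := Hu n.
have Eu n : qt t (u n) (u n) - mu * N (u n) (u n) <= n.+1%:R^-1 by have [] := Hu n.
exists mu; split => //.
- rewrite -(ler_pM2r Nw0); move: Hw0; rewrite -/M.
  have : M * (mu * N w0 w0) <= M * qt t w0 w0 by rewrite ler_pM2l.
  by rewrite -!mulrA; move: (M * qt t w0 w0) (M * (mu * N w0 w0)) (N w0 w0) => *; lra.
- have [T [T1 T2 T3 T4 T5]] := square_transfer a0 mpA.
  have [s1 s2 _] := mpA.
  set L := pi ^+ 2 * (t^-1 + t).
  have L0 : 0 <= L by rewrite mulr_ge0 ?sqr_ge0 // addr_ge0 ?invr_ge0 // ltW.
  have TE v : W v -> qA a a^-1 A (T v) (T v) = qt t v v + L * N v v.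
    by move=> Wv; rewrite T5 // /qt /excess1 /excess2 /L -/t; ring.
  have aV0 : 0 < a^-1 by rewrite invr_gt0.
  apply: (@ground_state _ _ _ _ a0 aV0 (smooth_cont s1) (smooth_cont s2) (fun n => T (u n)) _ 4).
  + by move=> n; exact: T1.
  + move=> v /T3 [w Ww ->]; rewrite TE // T4 // mulrDl addrC lerD2r.
    exact: muq.
  + move=> e e0; have [n0 Hn0] := inv_succ_eventually e0; exists n0 => n nn0.
    rewrite TE // T4 //; apply: le_trans (Hn0 n nn0); apply: le_trans (Eu n).
    by rewrite mulrDl opprD [leLHS]addrA addrK.
  + move=> e e0; pose C := 8 * K + 8 + L * (8 * K).
    have K8 : 0 < 8 * K by exact: mulr_gt0.
    have C0 : 0 < C.
      by apply: ltr_wpDr; [exact: mulr_ge0 L0 (ltW K8)|exact: addr_gt0].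
    have [n0 Hn0] := inv_succ_eventually (divr_gt0 e0 C0); exists n0 => n m nn0 mm0.
    have Wd : W (u n - u m) by exact: (subspaceB St).
    rewrite -T2 TE // T4 //.
    have h1 := le_trans (Eu n) (Hn0 n nn0); have h2 := le_trans (Eu m) (Hn0 m mm0).
    have lE : amp (u n) = amp (u m) by rewrite !lu.
    have lJE : amp (imul (u n)) = amp (imul (u m)) by rewrite !lJu.
    have [c1 c2] := minimizing_cauchy St WJ JD JZ pN (@ampD R) (@ampZ R) (qt_psd t0) K0 gap
      mu0 Kmu muq (Wu n) (Wu m) lE lJE h1 h2.
    set e' := e / C in c1 c2; have e'0 : 0 <= e' by rewrite divr_ge0 ?ltW.
    have eE : e = 8 * K * e' + 8 * e' + L * (8 * K * e').
      by rewrite /e' /C; field; rewrite -/C gt_eqF.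
    have x1 : 0 <= 8 * e' by rewrite mulr_ge0.
    have x2 : 0 <= 8 * K * e' by exact: (mulr_ge0 (ltW K8) e'0).
    have x3 : 0 <= L * (8 * K * e') by rewrite mulr_ge0.
    split.
      by apply: le_trans c1 _; rewrite eE -addrA lerDl addr_ge0.
    apply: le_trans (lerD c2 (ler_wpM2l L0 c1)) _.
    by rewrite [leRHS]eE -[leRHS]addrA lerDr.
  + by [].
  + move=> n; rewrite T4 //; have := amp_sqr_le (Wu n); rewrite lu expr1n.
    by move: (N _ _) => *; lra.
move=> e e0; have [n0 Hn0] := inv_succ_eventually e0; exists (u n0); split => //.
exact: le_trans (Eu n0) (Hn0 n0 (leqnn _)).
Qed.

Lemma lambda1E (Om : set (R * R)) A lam : lowest_eigenvalue Om A lam -> lambda1 Om A = lam.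
Proof.
move=> H; apply: xget_unique => //= l' [l1 l2]; apply/eqP.
by rewrite eq_le l2 ?H.2 //; case: H.
Qed.

(** An almost minimizer for the rectangle would violate [dilated_energy_ge] if
    the rectangle had a lower energy than the square. *)
Lemma lambda1_square_le a A A' : 0 < a ->
  magnetic_potential B (rect a a^-1) A -> magnetic_potential B (rect 1 1) A' ->
  lambda1 (rect 1 1) A' <= lambda1 (rect a a^-1) A.
Proof.
move=> a0 mpA mpA'.
have [mu [mu0 _ lowA _ near_mu]] := ground_energy a0 mpA.
have mpA1 : magnetic_potential B (rect 1 1^-1) A' by rewrite invr1.
have [mu1 [mu10 mu1s lowA' muq1 near_mu1]] := ground_energy ltr01 mpA1.
rewrite invr1 in lowA'.
rewrite (lambda1E lowA) (lambda1E lowA'); move: mu1s muq1 near_mu1.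
rewrite expr1n invr1 maxxx mul1r => mu1s muq1 near_mu1.
set t := a ^+ 2 in near_mu *; have t0 : 0 < t by exact: exprn_gt0.
have St := tst_subspace 1 1 : linear_subspace W.
have WJ u : W u -> W (imul u) by exact: tst_imul.
have JJ u : W u -> imul (imul u) = - u by move=> _; exact: iimul.
have JD u v : W u -> W v -> imul (u + v) = imul u + imul v by move=> _ _; exact: imulD.
have JZ c u : W u -> imul (c *: u) = c *: imul u by move=> _; exact: imulZ.
have pN := ip_psd_tst 1 1 : psd W N.
have q1E u : qt 1 u u = q1 u u + 1 * q2 u u by rewrite /qt invr1 mul1r.
have key w : W w -> (2 * pi ^+ 2 + mu1) * N w w <=
    t^-1 * (q1 w w + pi ^+ 2 * N w w) + t * (q2 w w + pi ^+ 2 * N w w).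
  move=> Ww; have [c4 _] := andP (pi_sqr_bounds R).
  apply: (dilated_energy_ge St WJ JJ JD JZ pN (@N_Jinv R) (@ampD R) (@ampZ R)
    (excess1_psd B) (excess2_psd B) (@excess1_Jinv R B) (@excess2_Jinv R B) (rot := @qturn R)) => //.
  - by move=> u; exact: tst_qturn.
  - exact: N_qturn.
  - exact: excess1_qturn.
  - exact: excess2_qturn.
  - exact: amp_qturn.
  - by move=> u Wu; exact: (amp_qturn (WJ _ Wu)).
  - by move=> v Wv; exact: (gap_magnetic Bs Wv).
  - exact: amp_sqr_le.
  - by move=> v Wv; rewrite -q1E; exact: muq1.
  - move=> e e0; have [u [Wu lu lJu Eu]] := near_mu1 e e0; exists u; split => //.
    by rewrite -q1E.
rewrite leNgt; apply/negP; set lt_ := _ + mu; set l1 := _ + mu1 => lt.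
have d0 : 0 < l1 - lt_ by rewrite subr_gt0.
have [u [Wu lu _ Eu]] := near_mu _ d0.
have N4 : 4 <= N u u.
  by have := amp_sqr_le Wu; rewrite lu expr1n; move: (N u u) => *; lra.
have := key _ Wu; rewrite (_ : 2 * pi ^+ 2 + mu1 = l1); last by rewrite /l1; ring.
have -> : t^-1 * (q1 u u + pi ^+ 2 * N u u) + t * (q2 u u + pi ^+ 2 * N u u) =
    qt t u u + (lt_ - mu) * N u u.
  by rewrite /qt /lt_; move: (q1 u u) (q2 u u) (N u u) (t^-1) => *; ring.
have : 4 * (l1 - lt_) <= N u u * (l1 - lt_) by rewrite ler_pM2r.
rewrite [N u u * _]mulrC !mulrBl mulrBr.
by move: Eu d0; move: (l1 * N u u) (lt_ * N u u) (mu * N u u) (qt t u u) => *; lra.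
Qed.

End ground_energy.

Theorem theorem1 (R : realType) :
  exists2 C : R, 0 < C &
    forall B : R, `|B| <= C -> forall a : R, 0 < a ->
    forall A A' : R * R -> R * R,
      magnetic_potential B (rect a a^-1) A ->
      magnetic_potential B (rect 1 1) A' ->
      lambda1 (rect a a^-1) A >= lambda1 (rect 1 1) A'.
Proof.
exists 100^-1; first by rewrite invr_gt0.
by move=> B Bs a a0 A A' mpA mpA'; exact: (lambda1_square_le Bs a0 mpA mpA').
Qed.
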